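(* Assume $\|w(p)\|\le \overline{v}/\sqrt5$ for all $p\in\Omega$. Let $\xi_C\in\hat X$ be a minimizer of $T$ over $\hat X$, with path length $L=\|(\xi_C)_\tau\|>0$. Then there is a constant $r>0$, depending on $\xi_C$ and $w$, such that for all paths $\xi\in\hat X$ with $\|\xi-\xi_C\|_{C^{0,1}([0,1])}\le r$, writing $\delta\xi:=\xi-\xi_C$ and $\delta\xi_\tau$ for its derivative, $$T(\xi)\le T(\xi_C)+\int_0^1\Big(\alpha_0(\xi_C)\,\|\delta\xi\|^2+\alpha_1(\xi_C)\,\|\delta\xi\|\,\|\delta\xi_\tau\|+\alpha_2(\xi_C)\,\|\delta\xi_\tau\|^2\Big)\,d\tau ,$$ where all functions in the integrand are evaluated at $\tau$ and, for $p\in\Omega$, $$\alpha_0(p)=\frac{L}{\underline v^3(p)}\big(12c_1^2(p)+4\underline v(p)c_2(p)\big),\quad \alpha_1(p)=\frac{8c_1(p)}{\underline v^2(p)},\quad \alpha_2(p)=\frac{2}{L\,\underline v(p)} .$$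
   Context: Setting (planar flight planning, Zermelo navigation). $x_O\neq x_D$ are points in $\mathbb{R}^2$, $\overline v>0$ is a constant airspeed, and $w:\mathbb{R}^2\to\mathbb{R}^2$ is a stationary, twice continuously differentiable wind field with $\|w\|_{L^\infty(\mathbb{R}^2)}<\overline v$. $\Omega\subset\mathbb{R}^2$ is a (filled) ellipse with focal points $x_O,x_D$ in which every trajectory from $x_O$ to $x_D$ of minimal flight duration is contained. $\|\cdot\|$ is the Euclidean norm, respectively the induced operator norm. For $p\in\Omega$: $c_0(p)=\|w(p)\|$, $c_1(p)=\|w_x(p)\|$ (first derivative), $c_2(p)=\|w_{xx}(p)\|$ (second derivative), $\underline v(p)=\sqrt{\overline v^2-c_0^2(p)}$. For $p\in\Omega$ and $q\in\mathbb{R}^2\setminus\{0\}$ put $$f(p,q)=\frac{-q^Tw(p)+\sqrt{(q^Tw(p))^2+(\overline v^2-w(p)^Tw(p))\,q^Tq}}{\overline v^2-w(p)^Tw(p)} .$$ For a Lipschitz path $\xi:[0,1]\to\Omega$ with a.e. derivative $\xi_\tau$ (nonvanishing a.e.), the flight duration is $T(\xi)=\int_0^1 f(\xi(\tau),\xi_\tau(\tau))\,d\tau$. It does not depend on the parametrization. $\hat X$ is the set of all $\xi\in C^{0,1}([0,1],\Omega)$ with $\xi(0)=x_O$, $\xi(1)=x_D$, and $\|\xi_\tau(\tau)\|$ equal to a constant (the path length) for almost all $\tau\in[0,1]$. Norm on Lipschitz functions: $\|g\|_{C^{0,1}([0,1])}:=\|g\|_{L^\infty([0,1])}+\|g_\tau\|_{L^\infty([0,1])}$.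 *)

(* Defs.v *)
From HB Require Import structures.
From mathcomp Require Import all_boot all_order all_algebra.
From mathcomp Require Import all_classical all_reals all_analysis.

Set Implicit Arguments.
Unset Strict Implicit.
Unset Printing Implicit Defensive.

Import Order.TTheory GRing.Theory Num.Theory.
Import numFieldNormedType.Exports.

Local Open Scope classical_set_scope.
Local Open Scope ring_scope.

(* Points and vectors of the plane are row vectors.  The norm `|_| that the
   library puts on 'rV[R]_2 is the max norm: it only serves for the topology and
   for Lipschitz continuity, and the Euclidean norm is [enorm]. *)

Definition dot (R : realType) (u v : 'rV[R]_2) : R := (u *m v^T) 0 0.

Definition enorm (R : realType) (u : 'rV[R]_2) : R := Num.sqrt (dot u u).

Definition vec2 (R : realType) (x : R * R) : 'rV[R]_2 :=
  \row_(i < 2) (if i == 0 then x.1 else x.2).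

(* Essential supremum of the Euclidean norm, with respect to the Lebesgue measure
   of the plane, realized as a product measure on R * R. *)
Definition Linfty_plane (R : realType) (w : 'rV[R]_2 -> 'rV[R]_2) : \bar R :=
  ('N[(@lebesgue_measure R) \x (@lebesgue_measure R)]_+oo
     [EFin \o (@enorm R \o w \o @vec2 R)])%E.

Definition second_deriv (R : realType) (w : 'rV[R]_2 -> 'rV[R]_2)
    (p h k : 'rV[R]_2) : 'rV[R]_2 :=
  'd (fun y : 'rV[R]_2 => 'd w y k) p h.

(* In finite dimension, continuity of w_xx for the operator norm is continuity
   of w_xx(.)[h, k] for all h, k. *)
Definition twice_cont_diff (R : realType) (w : 'rV[R]_2 -> 'rV[R]_2) : Prop :=
  [/\ forall p : 'rV[R]_2, differentiable w p,
      forall k p : 'rV[R]_2, differentiable (fun y : 'rV[R]_2 => 'd w y k) p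
    & forall h k : 'rV[R]_2,
        continuous (fun p : 'rV[R]_2 => second_deriv w p h k)].

Section Wind.
Variables (R : realType) (v : R) (w : 'rV[R]_2 -> 'rV[R]_2).
Implicit Types p q : 'rV[R]_2.

Definition c0 p : R := enorm (w p).

Definition c1 p : R := sup [set enorm ('d w p h) | h in [set h | enorm h <= 1]].

Definition c2 p : R :=
  sup [set enorm (second_deriv w p hk.1 hk.2)
      | hk in [set hk : 'rV[R]_2 * 'rV[R]_2 | enorm hk.1 <= 1 /\ enorm hk.2 <= 1]].

Definition v_low p : R := Num.sqrt (v ^+ 2 - c0 p ^+ 2).

Definition flight_density p q : R :=
  (- dot q (w p)
   + Num.sqrt (dot q (w p) ^+ 2 + (v ^+ 2 - dot (w p) (w p)) * dot q q))
  / (v ^+ 2 - dot (w p) (w p)).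

Definition alpha0 (L : R) p : R :=
  L / v_low p ^+ 3 * (12 * c1 p ^+ 2 + 4 * v_low p * c2 p).

Definition alpha1 p : R := 8 * c1 p / v_low p ^+ 2.

Definition alpha2 (L : R) p : R := 2 / (L * v_low p).

(* A path is a function on R of which only the restriction to [0, 1] matters:
   the values of [derive1 xi] at 0 and 1 are irrelevant for the integral. *)
Definition flight_duration (xi : R -> 'rV[R]_2) : R :=
  \int[@lebesgue_measure R]_(t in `[0, 1]) flight_density (xi t) (derive1 xi t).

End Wind.

Section Paths.
Variable R : realType.
Implicit Types (xi g : R -> 'rV[R]_2) (xO xD : 'rV[R]_2) (Omega : set 'rV[R]_2).

Definition filled_ellipse xO xD (a : R) : set 'rV[R]_2 :=
  [set p | enorm (p - xO) + enorm (p - xD) <= 2 * a].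

Definition lipschitz_path xO xD Omega xi : Prop :=
  [/\ [lipschitz xi t | t in `[0, 1]],
      forall t, t \in `[0, 1] -> Omega (xi t),
      xi 0 = xO
    & xi 1 = xD].

Definition nonvanishing_speed xi : Prop :=
  {ae (@lebesgue_measure R), forall t, t \in `[0, 1] ->
     derivable xi t 1 /\ derive1 xi t != 0}.

(* The constant L is the length of xi. *)
Definition constant_speed xi (L : R) : Prop :=
  {ae (@lebesgue_measure R), forall t, t \in `[0, 1] ->
     derivable xi t 1 /\ enorm (derive1 xi t) = L}.

Definition Xhat xO xD Omega xi : Prop :=
  lipschitz_path xO xD Omega xi /\ exists L, constant_speed xi L.

Definition trajectory xO xD xi : Prop :=
  lipschitz_path xO xD setT xi /\ nonvanishing_speed xi.

Definition minimizer (T : (R -> 'rV[R]_2) -> R)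
    (X : (R -> 'rV[R]_2) -> Prop) xi : Prop :=
  X xi /\ forall xi', X xi' -> T xi <= T xi'.

Definition Linfty01 g : \bar R :=
  ('N[@lebesgue_measure R]_+oo [(EFin \o (@enorm R \o g)) \_ `[0%R, 1%R]])%E.

Definition C01_norm g : \bar R := (Linfty01 g + Linfty01 (derive1 g))%E.

End Paths.

(* Main.v *)
(* For fixed p, f(p, q) is the least s >= 0 with |q - s w(p)| <= v s.  Hence a path
   can be flown in time M exactly when, after reparametrization,
   |xi' - M w(xi)| <= v M; such paths form a compact set, so a globally fastest
   path exists.  It is a minimizing trajectory, so it stays in the ellipse, which
   is convex; polygons inscribed in it, run at constant speed, belong to Xhat and
   have almost the same duration.  So xi_C is fastest among all Lipschitz paths
   from x_O to x_D, in particular among xi_C + s dxi for |s| <= 1, although these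
   need neither have constant speed nor stay in the ellipse.

   Along such a segment, f is bounded by its first order expansion plus a quadratic
   form in (|dxi|, |dxi'|).  Minimality makes the first order term nonpositive.  The
   quadratic form has the constants 4/5, 13/2, 48/5, 2 in place of 2, 8, 12, 4, with
   c_1, c_2 increased by a small eps coming from the continuity of w_x and w_xx.  The
   error in eps is absorbed by these gaps and by the Poincare inequality
   |dxi(t)|^2 <= int |dxi'|^2, valid since dxi(0) = 0. *)

From HB Require Import structures.
Require Import Defs.
From mathcomp Require Import all_boot all_order all_algebra.
From mathcomp Require Import all_classical all_reals all_analysis.
From mathcomp Require Import measurable_realfun ess_sup_inf ring lra.
Import Order.TTheory GRing.Theory Num.Theory.
Import numFieldNormedType.Exports.
Local Open Scope classical_set_scope.
Local Open Scope ring_scope.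

Set Implicit Arguments.
Unset Strict Implicit.
Unset Printing Implicit Defensive.

(** * Lipschitz functions of a real variable *)

(** Elements of [Xhat] cannot be perturbed linearly inside [Xhat], so no first order condition can
    be read off minimality there. Hence the comparison with all Lipschitz paths, at the price of an
    existence proof and of an approximation that leads back into [Xhat].

    One reformulation carries the whole argument: [F = f(p, q)] satisfies [|q - F w(p)| = v F].
    Tested against unit vectors, this gives inequalities linear in [q], which can be integrated
    along a path; in integrated form they survive limits without any convergence of derivatives.
    Differentiated twice, the same relation bounds the second derivative of [f]: the part that is
    quadratic in the first derivatives reduces to one orthogonal component plus a mixed term.

    The quadratic form is written with powers of [v] where the theorem has [v_low]. As [v_low <= v],
    this is the stronger bound, and the smallness conditions on eps do not depend on the point.

    Lipschitz paths have derivatives only almost everywhere, so integrands are handled through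
    bounded measurable representatives. *)

Lemma aeS {R : realType} (P Q : R -> Prop) : (forall x, P x -> Q x) ->
  {ae (@lebesgue_measure R), forall x, P x} ->
  {ae (@lebesgue_measure R), forall x, Q x}.
Proof. by move=> PQ; exact: (@filterS _ _ (ae_filter_ringOfSetsType _)). Qed.

Lemma aeI {R : realType} (P Q : R -> Prop) :
  {ae (@lebesgue_measure R), forall x, P x} ->
  {ae (@lebesgue_measure R), forall x, Q x} ->
  {ae (@lebesgue_measure R), forall x, P x /\ Q x}.
Proof. by move=> hP hQ; exact: (@filterI _ _ (ae_filter_ringOfSetsType _)). Qed.

Lemma is_derive1P {R : realType} {V : normedModType R} (f : R -> V) (t : R) (l : V) :
  is_derive t 1 f l <-> h^-1 *: (f (h + t) - f t) @[h --> 0^'] --> l.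
Proof.
have E : (fun h : R => h^-1 *: (f (h *: 1 + t) - f t)) =
         (fun h => h^-1 *: (f (h + t) - f t)).
  by apply/funext => h; rewrite /GRing.scale/= mulr1.
split => [[dft <-]|H].
  by move: dft; rewrite /derivable /derive/= E.
apply: DeriveDef; rewrite /derivable /derive/= E; first by apply/cvg_ex; exists l.
exact/cvg_lim.
Qed.

Lemma is_derive1_le {R : realType} {V : normedModType R} (f : R -> V) (t : R) (l : V) (K : R) :
  is_derive t 1 f l -> (\forall s \near t, `|f s - f t| <= K * `|s - t|) ->
  `|l| <= K.
Proof.
move=> /is_derive1P H nK.
apply: (cvgr_to_le (cvg_norm H)); near=> h.
rewrite normrZ normfV mulrC ler_pdivrMr ?normr_gt0; last by near: h; exact: nbhs_dnbhs_neq.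
rewrite -[in leRHS](addrK t h); near: h.
have : h + t @[h --> 0^'] --> t.
  rewrite -[X in _ --> X]add0r; apply: cvgD; last exact: cvg_cst.
  by apply: cvg_within_filter; exact: cvg_id.
by move=> /(_ _ nK).
Unshelve. all: by end_near. Qed.

(** * Lipschitz functions as integrals of their derivatives *)

Section Stieltjes.
Context {R : realType} (u : R -> R) (K : R).
Hypothesis uK : forall s t, `|u t - u s| <= K * `|t - s|.

(** Adding the slope [K] makes the function nondecreasing, so that it carries a Lebesgue-Stieltjes
    measure; the slope is subtracted again from the density. *)
Let g (t : R) : R := u t + K * t.

Let g_incr s t : s <= t -> 0 <= g t - g s <= 2 * K * (t - s).
Proof.
move=> st; have := uK s t; rewrite (ger0_norm (x := t - s)) ?subr_ge0// ler_norml /g.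
by move=> /andP[? ?]; apply/andP; split; lra.
Qed.

Let g_nd : nondecreasing g.
Proof. by move=> s t /g_incr/andP[]; rewrite subr_ge0. Qed.

Let u_cont : continuous u.
Proof.
move=> x; apply/cvgrPdist_lt => e e0; have K0 : 0 < `|K| + 1 by rewrite ltr_wpDl.
near=> y.
have := uK y x; move/le_lt_trans; apply.
apply: (@le_lt_trans _ _ ((`|K| + 1) * `|x - y|)).
  by rewrite ler_wpM2r// (le_trans (ler_norm _))// lerDl.
rewrite mulrC -ltr_pdivlMr//; near: y.
by apply: cvgr_dist_lt; [exact: cvg_id | rewrite divr_gt0].
Unshelve. all: by end_near. Qed.

Let g_rc : right_continuous g.
Proof.
apply: right_continuousW => x; apply: cvgD; first exact: u_cont.
by apply: cvgM; [exact: cvg_cst|exact: cvg_id].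
Qed.

HB.instance Definition _ := isCumulative.Build R _ R g g_nd g_rc.

Let mug : {measure set (measurableTypeR R) -> \bar R} := lebesgue_stieltjes_measure g.

Let mug_itv s t : s <= t -> mug `]s, t]%classic = (g t - g s)%:E.
Proof.
move=> st; transitivity (wlength g `]s, t]%classic); last by rewrite wlength_itv_bnd.
have H := @measurable_mu_extE _ _ _ (wlength g) `]s, t]%classic (is_ocitv _ _).
exact: H.
Qed.

(** A Lipschitz constant of [g], made positive by the [+ 1] so that one may divide by it. *)
Let C : R := 2 * `|K| + 1.

Let wlength_le (A : set (ocitv_type R)) : measurable A ->
  (wlength g A <= C%:E * wlength idfun A)%E.
Proof.
move=> /ocitvP[->|[[a b] /= ab ->]]; first by rewrite !wlength0 mule0.
rewrite !wlength_itv_bnd ?(ltW ab)// -EFinM lee_fin.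
have /andP[_ /le_trans] := g_incr (ltW ab); apply.
rewrite ler_wpM2r ?subr_ge0 ?(ltW ab)// /C; have := ler_norm K; lra.
Qed.

(** Both measures are infima over countable covers by half-open intervals, on which the [g]-length
    is at most [C] times the length. A cover of total length below [e / C] therefore has [g]-length
    at most [e]. *)
Let mug_dom : mug `<< (@lebesgue_measure R).
Proof.
apply/null_content_dominatesP => A mA A0.
apply/eqP; rewrite eq_le measure_ge0 andbT.
have C0 : 0 < C by rewrite /C ltr_wpDl// mulr_ge0.
apply/lee_addgt0Pr => e e0; rewrite add0e.
have : (lebesgue_measure A < (e / C)%:E)%E by rewrite A0 lte_fin divr_gt0.
move=> /ereal_inf_lt[_ [F [mF AF] <-]] Fe.
apply: (@le_trans _ _ (\sum_(k <oo) wlength g (F k)))%E.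
  by apply: ereal_inf_lbound; exists F.
apply: (@le_trans _ _ (\sum_(k <oo) C%:E * wlength idfun (F k)))%E.
  apply: lee_nneseries => [k _ _|k _]; first exact: wlength_ge0.
  exact: wlength_le.
rewrite nneseriesZl//.
apply: (@le_trans _ _ (C%:E * (e / C)%:E)%E).
  by rewrite lee_pmul2l// ltW.
by rewrite -EFinM mulrCA divff ?mulr1// gt_eqF.
Qed.

(** The Stieltjes measure of [g], restricted to []a, b]] to make it finite, has a Radon-Nikodym
    density [f]. Its primitive differs from [u] by an affine function on []a, b[], so Lebesgue
    differentiation makes [f - K] the derivative of [u] almost everywhere. *)
Lemma lipschitz_ae_density (a b : R) : a < b -> exists h : R -> R,
  [/\ measurable_fun setT h, forall t, `|h t| <= K,
    forall s t, a <= s -> s <= t -> t <= b ->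
      u t - u s = \int[lebesgue_measure]_(x in `]s, t]) h x
  & {ae lebesgue_measure, forall t, a < t < b -> is_derive t 1 u (h t)}].
Proof.
move=> ab.
have mE : measurable (`]a, b] : set (measurableTypeR R)) by exact: measurable_itv.
have fE : (mug `]a, b]%classic < +oo)%E by rewrite mug_itv ?(ltW ab)// ltry.
pose nu : {finite_measure set (measurableTypeR R) -> \bar R} := mfrestr mE fE.
have numu : nu `<< (@lebesgue_measure R).
  apply/null_content_dominatesP => A mA A0.
  apply/eqP; rewrite eq_le measure_ge0 andbT.
  move/null_content_dominatesP : mug_dom => /(_ _ mA A0) <-.
  rewrite /nu/= /mfrestr /mrestr; apply: le_measure; rewrite ?inE//.
  exact: measurableI.
have [f [f0 ffin fint fE']] := radon_nikodym_sigma_finite numu.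

pose h0 x := fine (f x) - K.
have ffE : EFin \o (fine \o f) = f by apply/funext => x /=; rewrite fineK.
have locf : locally_integrable [set: R] (fine \o f).
  by apply: open_integrable_locally; [exact: openT | rewrite ffE].
have intf A : measurable A -> (lebesgue_measure).-integrable A (EFin \o (fine \o f)).
  by move=> mA; rewrite ffE; exact: integrableS fint.
have gE t : a <= t <= b -> \int[lebesgue_measure]_(x in `]a, t]) (fine \o f) x = g t - g a.
  move=> /andP[at_ tb]; rewrite /Rintegral.
  rewrite -[RHS]/(fine (g t - g a)%:E) -mug_itv//; congr fine.
  transitivity (\int[lebesgue_measure]_(x in `]a, t]) f x)%E.
    by apply: eq_integral => x _ /=; rewrite fineK.
  rewrite -fE' ?measurable_itv// /nu /= /mfrestr /mrestr.
  congr (mug _); rewrite setIidl//.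
  by move=> x /=; rewrite !in_itv/= => /andP[-> /le_trans ->].
have derf := FTC1 (a := BRight a) (fun y => intf _ (measurable_itv `]a, y])) locf.
have aeder : {ae lebesgue_measure, forall t, a < t < b -> is_derive t 1 u (h0 t)}.
  apply: aeS derf => t /= + /andP[at_ tb].
  move=> /(_ at_)[]; set F := fun x => _; rewrite -/F => dF FE.
  have Fg : \near t, F t = u t + (K * t - g a).
    near=> y; rewrite /F gE; last first.
      apply/andP; split; apply: ltW; near: y; [exact: lt_nbhsr|exact: lt_nbhsl].
    by rewrite /g; lra.
  have dFt : is_derive t 1 F (fine (f t)).
    by apply: DeriveDef => //; rewrite -derive1E FE.
  have dut : is_derive t 1 (fun y => F y - (K * y - g a)) (h0 t).
    rewrite /h0; apply: is_deriveB.
    have : is_derive t 1 (K \*: (@id R^o) - cst (g a)) (K *: 1 - 0).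
      by apply: is_deriveB.
    by rewrite subr0 /GRing.scale/= mulr1.
  apply: near_eq_is_derive dut; near=> y.
  suff -> : F y = u y + (K * y - g a) by rewrite addrK.
  by near: y.

have h0K : {ae lebesgue_measure, forall t, a < t < b -> `|h0 t| <= K}.
  apply: aeS aeder => t + /[dup] tab /andP[at_ tb] => /(_ tab) dt.
  by apply: is_derive1_le dt _; near=> s.
(* Truncation makes the bound hold everywhere; by [h0K] it changes [h0] only on a null set of []a,
   b[]. *)
pose h x := Num.min K (Num.max (- K) (h0 x)).
have K0 : 0 <= K.
  by have := uK 0 1; rewrite subr0 normr1 mulr1; apply: le_trans.
have mh0 : measurable_fun setT h0.
  apply: measurable_funB => //; apply/measurable_EFinP; rewrite ffE.
  exact: measurable_int fint.
have mh : measurable_fun setT h.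
  by apply: measurable_minr => //; apply: measurable_maxr.
have hK t : `|h t| <= K.
  rewrite ler_norml /h; apply/andP; split; first by rewrite le_min le_max; lra.
  by rewrite ge_min lexx.
have hh0 : {ae lebesgue_measure, forall t, a < t < b -> h t = h0 t}.
  apply: aeS h0K => t + tab => /(_ tab); rewrite ler_norml => /andP[h1 h2].
  by rewrite /h max_r// min_r.
exists h; split => //; last first.
  by apply: aeS (aeI aeder hh0) => t [+ +] tab => /(_ tab) + /(_ tab) ->.
move=> s t as_ st tb.
have fin : (lebesgue_measure `]s, t]%classic < +oo)%E.
  by rewrite lebesgue_measure_itv/=; case: ifP; rewrite ?ltry.
have -> : \int[lebesgue_measure]_(x in `]s, t]) h x =
          \int[lebesgue_measure]_(x in `]s, t]) h0 x.
  congr fine; apply: ae_eq_integral => //.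
  - by apply/measurable_EFinP; exact: measurable_funTS.
  - by apply/measurable_EFinP; exact: measurable_funTS.
  - have Hb : {ae lebesgue_measure, forall x, x != b}.
      exists [set b]; split => //; first exact: lebesgue_measure_set1.
      by move=> x /= /negP; rewrite negbK => /eqP.
    apply: aeS (aeI Hb hh0) => x [xb +] /=; rewrite in_itv/= => + /andP[sx xt].
    by move=> -> //; rewrite (le_lt_trans as_ sx)/= lt_neqAle xb (le_trans xt tb).
have intc : lebesgue_measure.-integrable `]s, t] (EFin \o cst K).
  apply: measurable_bounded_integrable => //.
  by exists `|K|; split => // y Ky x _; exact: ltW.
have mst : measurable (`]s, t] : set (measurableTypeR R)) by exact: measurable_itv.
rewrite /h0 (RintegralB (f2 := cst K))//; last exact: intf.
have muE : fine (lebesgue_measure `]s, t]%classic) = t - s.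
  rewrite lebesgue_measure_itv/= lte_fin.
  by case: ltP => //= ts; apply/eqP; rewrite eq_sym subr_eq0 eq_le ts st.
have -> : \int[lebesgue_measure]_(x in `]s, t]) cst K x = K * (t - s).
  by rewrite -muE; exact: Rintegral_cst.
have : \int[lebesgue_measure]_(x in `]a, t]) (fine \o f) x -
    \int[lebesgue_measure]_(x in `]a, s]) (fine \o f) x =
    \int[lebesgue_measure]_(x in `]s, t]) (fine \o f) x.
  apply: Rintegral_itvB; [exact: intf|by rewrite bnd_simp|by rewrite bnd_simp].
move=> <-; rewrite !gE ?(le_trans as_ st)// ?as_ ?(le_trans st tb)//.
by rewrite /g; lra.
Unshelve. all: by end_near. Qed.

End Stieltjes.

(** * Integration of functions known up to null sets *)

Section AeIntegral.
Context d (T : measurableType d) (R : realType) (mu : {measure set T -> \bar R}).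
Import HBNNSimple.

(** A simple function below [F], set to 0 on the null set [N], lies below [G] everywhere and keeps
    its integral. *)
Let le_sup_sintegral (F G : T -> \bar R) (N : set T) : measurable N -> mu N = 0 ->
  (forall x, ~ N x -> F x <= G x)%E -> (forall x, 0 <= G x)%E ->
  (ereal_sup [set sintegral mu h | h in
     [set h : {nnsfun T >-> R} | forall x, ((h x)%:E <= F x)%E]] <=
   ereal_sup [set sintegral mu h | h in
     [set h : {nnsfun T >-> R} | forall x, ((h x)%:E <= G x)%E]])%E.
Proof.
move=> mN N0 FG G0; apply: ge_ereal_sup => _ [h /= hF <-].
have mCN : measurable (~` N) by exact: measurableC.
apply: ereal_sup_ubound => /=; exists (proj_nnsfun h mCN).
  move=> x /=; rewrite mindicE.
  have [|] := boolP (x \in ~` N); rewrite ?mulr1 ?mulr0//.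
  by rewrite inE => /= Nx; rewrite (le_trans (hF x))// FG.
rewrite -!integralT_nnsfun; apply: ae_eq_integral => //.
- by apply/measurable_EFinP.
- by apply/measurable_EFinP.
exists N; split => // x /= /not_implyP[_]; apply: contra_notP => Nx.
by rewrite mindicE mem_set// mulr1.
Qed.

(* Neither function is assumed measurable: [derive1] of a Lipschitz path is only
   known to agree almost everywhere with a measurable function. *)
Lemma ae_integral_congr (D : set T) (f g : T -> \bar R) :
  {ae mu, forall x, D x -> f x = g x} ->
  (\int[mu]_(x in D) f x = \int[mu]_(x in D) g x)%E.
Proof.
case=> N [mN N0 NE].
have fgN x : ~ N x -> (f \_ D) x = (g \_ D) x.
  move=> Nx; rewrite /patch; case: ifP => // /[1!inE] Dx.
  by apply: contrapT => ne; apply: Nx; apply: NE => /= /(_ Dx).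
rewrite /integral; congr (_ - _)%E; apply/eqP; rewrite eq_le; apply/andP; split;
  apply: (@le_sup_sintegral _ _ N) => // x Nx;
  by rewrite ?funepos.unlock ?funeneg.unlock fgN.
Qed.

End AeIntegral.

Lemma ae_Rintegral_congr (R : realType) (D : set R) (f g : R -> R) :
  {ae lebesgue_measure, forall x, D x -> f x = g x} ->
  \int[lebesgue_measure]_(x in D) f x = \int[lebesgue_measure]_(x in D) g x.
Proof.
move=> fg; congr fine; apply: ae_integral_congr.
by apply: aeS fg => x + Dx => /(_ Dx) /= ->.
Qed.

Section BoundedMeasurable.
Context {R : realType}.
Local Notation mu := (@lebesgue_measure R).
Implicit Types f g : R -> R.

Definition bounded_measurable f :=
  measurable_fun setT f /\ exists K, forall t, `|f t| <= K.

(** A class that is stable under sums, products, square roots and changes on null sets, and whose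
    representatives are integrable on [[0, 1]]. It contains the integrands built from [derive1]. *)
Definition ae_bounded_measurable f := exists2 f', bounded_measurable f' &
  {ae mu, forall t, t \in `[0, 1] -> f t = f' t}.

Local Notation bm := bounded_measurable.
Local Notation abm := ae_bounded_measurable.

Lemma bmD f g : bm f -> bm g -> bm (fun t => f t + g t).
Proof.
move=> [mf [K fK]] [mg [M gM]]; split; first exact: measurable_funD.
by exists (K + M) => t; rewrite (le_trans (ler_normD _ _))// lerD.
Qed.

Lemma bmN f : bm f -> bm (fun t => - f t).
Proof.
move=> [mf [K fK]]; split; first exact: measurableT_comp.
by exists K => t; rewrite normrN.
Qed.

Lemma bmM f g : bm f -> bm g -> bm (fun t => f t * g t).
Proof.
move=> [mf [K fK]] [mg [M gM]]; split; first exact: measurable_funM.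
by exists (K * M) => t; rewrite normrM ler_pM.
Qed.

Lemma bm_cst k : bm (fun=> k).
Proof. by split; [exact: measurable_cst | exists `|k|]. Qed.

Lemma bm_norm f : bm f -> bm (fun t => `|f t|).
Proof.
move=> [mf [K fK]]; split; first exact: measurableT_comp.
by exists K => t; rewrite normr_id.
Qed.

Lemma bm_sqrt f : bm f -> bm (fun t => Num.sqrt (f t)).
Proof.
move=> [mf [K fK]]; split.
  apply: (measurableT_comp (f := @Num.sqrt R)) => //.
  by apply: continuous_measurable_fun; exact: sqrt_continuous.
exists (Num.sqrt K) => t; rewrite ger0_norm ?sqrtr_ge0// ler_wsqrtr//.
by rewrite (le_trans (ler_norm _)).
Qed.

Lemma bm_integrable f (A : set R) : bm f -> measurable A ->
  (mu A < +oo)%E -> mu.-integrable A (EFin \o f).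
Proof.
move=> [mf [K fK]] mA fA; apply: measurable_bounded_integrable => //.
  exact: measurable_funTS.
by exists K; split => [|y Ky x _]; [exact: num_real | exact: le_trans (ltW Ky)].
Qed.

Lemma mu_itv_lty b c (s t : R) : (mu [set` Interval (BSide b s) (BSide c t)] < +oo)%E.
Proof. by rewrite lebesgue_measure_itv/=; case: ifP; rewrite ?ltry. Qed.

Lemma bm_integrable_itv f b c s t : bm f ->
  mu.-integrable [set` Interval (BSide b s) (BSide c t)] (EFin \o f).
Proof.
by move=> bf; apply: bm_integrable => //; exact: mu_itv_lty.
Qed.

Lemma bm_abm f : bm f -> abm f.
Proof. by move=> bf; exists f => //; apply: aeW. Qed.

Lemma abm_ae f g : {ae mu, forall t, t \in `[0, 1] -> f t = g t} -> abm g -> abm f.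
Proof.
move=> fg [g' bg' gg']; exists g' => //.
by apply: aeS (aeI fg gg') => t [+ +] t01 => /(_ t01) -> /(_ t01).
Qed.

Lemma abmD f g : abm f -> abm g -> abm (fun t => f t + g t).
Proof.
move=> [f' bf ff] [g' bg gg]; exists (fun t => f' t + g' t); first exact: bmD.
by apply: aeS (aeI ff gg) => t [+ +] t01 => /(_ t01) -> /(_ t01) ->.
Qed.

Lemma abmM f g : abm f -> abm g -> abm (fun t => f t * g t).
Proof.
move=> [f' bf ff] [g' bg gg]; exists (fun t => f' t * g' t); first exact: bmM.
by apply: aeS (aeI ff gg) => t [+ +] t01 => /(_ t01) -> /(_ t01) ->.
Qed.

Lemma abmN f : abm f -> abm (fun t => - f t).
Proof.
move=> [f' bf ff]; exists (fun t => - f' t); first exact: bmN.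
by apply: aeS ff => t + t01 => /(_ t01) ->.
Qed.

Lemma abm_cst k : abm (fun=> k).
Proof. exact/bm_abm/bm_cst. Qed.

Lemma abm_norm f : abm f -> abm (fun t => `|f t|).
Proof.
move=> [f' bf ff]; exists (fun t => `|f' t|); first exact: bm_norm.
by apply: aeS ff => t + t01 => /(_ t01) ->.
Qed.

Lemma abm_sqrt f : abm f -> abm (fun t => Num.sqrt (f t)).
Proof.
move=> [f' bf ff]; exists (fun t => Num.sqrt (f' t)); first exact: bm_sqrt.
by apply: aeS ff => t + t01 => /(_ t01) ->.
Qed.

Lemma abmX2 f : abm f -> abm (fun t => f t ^+ 2).
Proof. by move=> af; under eq_fun do rewrite expr2; exact: abmM. Qed.

Local Notation I f := (\int[mu]_(t in `[0, 1]) f t).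

Lemma abm_int f f' : bm f' -> {ae mu, forall t, t \in `[0, 1] -> f t = f' t} ->
  I f = I f'.
Proof. by move=> bf ff; apply: ae_Rintegral_congr; exact: ff. Qed.

Lemma abm_int_cst k : I (fun=> k) = k.
Proof.
have -> : I (fun=> k) = k * fine (mu `[0, 1]%classic).
  by apply: (@Rintegral_cst _ (measurableTypeR R) R mu); exact: measurable_itv.
by rewrite lebesgue_measure_itv/= lte_fin ltr01/= subr0 mulr1.
Qed.

Lemma abm_intD f g : abm f -> abm g -> I (fun t => f t + g t) = I f + I g.
Proof.
move=> [f' bf ff] [g' bg gg]; rewrite (abm_int bf ff) (abm_int bg gg).
rewrite (@abm_int _ (fun t => f' t + g' t)); first last.
- by apply: aeS (aeI ff gg) => t [+ +] t01 => /(_ t01) -> /(_ t01) ->.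
- exact: bmD.
by apply: RintegralD => //; exact: bm_integrable_itv.
Qed.

Lemma abm_intZ k f : abm f -> I (fun t => k * f t) = k * I f.
Proof.
move=> [f' bf ff]; rewrite (abm_int bf ff).
rewrite (@abm_int _ (fun t => k * f' t)); first last.
- by apply: aeS ff => t + t01 => /(_ t01) ->.
- by apply: bmM => //; exact: bm_cst.
by apply: RintegralZl => //; exact: bm_integrable_itv.
Qed.

Lemma abm_intB f g : abm f -> abm g -> I (fun t => f t - g t) = I f - I g.
Proof.
move=> af ag; rewrite (abm_intD af (abmN ag)) -[in RHS]mulN1r -abm_intZ//.
by congr (_ + _); apply: eq_Rintegral => t _; rewrite mulN1r.
Qed.

Lemma abm_int_ge0 f : abm f -> {ae mu, forall t, t \in `[0, 1] -> 0 <= f t} ->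
  0 <= I f.
Proof.
move=> [f' bf ff] f0; rewrite (_ : I f = I (fun t => `|f' t|)).
  by apply: Rintegral_ge0.
apply: (abm_int (bm_norm bf)); apply: aeS (aeI ff f0) => t [+ +] t01.
by move=> /(_ t01) <- /(_ t01) f0t; rewrite ger0_norm.
Qed.

Lemma abm_int_le f g : abm f -> abm g ->
  {ae mu, forall t, t \in `[0, 1] -> f t <= g t} -> I f <= I g.
Proof.
move=> af ag fg; rewrite -subr_ge0 -abm_intB//; apply: abm_int_ge0.
  by apply: abmD => //; exact: abmN.
by apply: aeS fg => t + t01 => /(_ t01); rewrite subr_ge0.
Qed.

(* Cauchy-Schwarz against the constant 1: expand the integral of (f - m)^2. *)
Lemma abm_int_sqr f : abm f -> (I f) ^+ 2 <= I (fun t => f t ^+ 2).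
Proof.
move=> af; set m := I f.
have : 0 <= I (fun t => (f t ^+ 2 + - (2 * m) * f t) + m ^+ 2).
  apply: abm_int_ge0.
    apply: abmD (abm_cst _); apply: abmD; first exact: abmX2.
    by apply: abmM => //; exact: abm_cst.
  apply: aeW => t _.
  suff -> : f t ^+ 2 + - (2 * m) * f t + m ^+ 2 = (f t - m) ^+ 2 by exact: sqr_ge0.
  by ring.
have amf : abm (fun t => - (2 * m) * f t) by apply: abmM => //; exact: abm_cst.
rewrite !abm_intD//; [|exact: abmX2|by apply: abmD => //; exact: abmX2|exact: abm_cst].
by rewrite abm_int_cst abm_intZ// -/m; lra.
Qed.

Lemma abm_int_eq0 f : abm f -> {ae mu, forall t, t \in `[0, 1] -> 0 <= f t} ->
  I f = 0 -> {ae mu, forall t, t \in `[0, 1] -> f t = 0}.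
Proof.
move=> [f' bf ff] f0; rewrite (_ : I f = I (fun t => `|f' t|)); last first.
  apply: (abm_int (bm_norm bf)); apply: aeS (aeI ff f0) => t [+ +] t01.
  by move=> /(_ t01) <- /(_ t01) f0t; rewrite ger0_norm.
move=> f'0.
have := ae_eq_integral_abs mu (measurable_itv `[0, 1])
  (f := EFin \o f') (measurable_int _ (bm_integrable_itv true false 0 1 bf)).
move=> [H _].
have : (\int[mu]_(t in `[0%R, 1%R]) `|(EFin \o f') t| = 0)%E.
  rewrite -[LHS]fineK; first by rewrite -[RHS]/(0%:E); congr (_%:E).
  have := bm_integrable_itv true false 0 1 (bm_norm bf).
  by move=> /integrable_fin_num; apply; exact: measurable_itv.
move=> /H f'0'; apply: aeS (aeI ff f'0') => t [+ +] t01.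
by move=> /(_ t01) -> /(_ t01) /= [].
Qed.

End BoundedMeasurable.

(** * The Euclidean plane and the flight density *)

Section Plane.
Context {R : realType}.
Implicit Types u v n : 'rV[R]_2.

Lemma dotE u v : dot u v = u 0 0 * v 0 0 + u 0 1 * v 0 1.
Proof.
rewrite /dot mxE big_ord_recl big_ord1 !mxE.
by congr (_ + u _ _ * v _ _); apply/val_inj.
Qed.

Lemma rV2P u v : u 0 0 = v 0 0 -> u 0 1 = v 0 1 -> u = v.
Proof.
move=> h0 h1; apply/rowP => i; case: i => [[|[|//]] i2].
  by move: h0; congr (u _ _ = v _ _); apply/val_inj.
by move: h1; congr (u _ _ = v _ _); apply/val_inj.
Qed.

Lemma dotC u v : dot u v = dot v u.
Proof. by rewrite !dotE; ring. Qed.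

Lemma dotDl u u' v : dot (u + u') v = dot u v + dot u' v.
Proof. by rewrite !dotE !mxE; ring. Qed.

Lemma dotZl k u v : dot (k *: u) v = k * dot u v.
Proof. by rewrite !dotE !mxE; ring. Qed.

Lemma dotNl u v : dot (- u) v = - dot u v.
Proof. by rewrite !dotE !mxE; ring. Qed.

Lemma dotDr u v v' : dot u (v + v') = dot u v + dot u v'.
Proof. by rewrite !dotE !mxE; ring. Qed.

Lemma dotZr k u v : dot u (k *: v) = k * dot u v.
Proof. by rewrite !dotE !mxE; ring. Qed.

Lemma dotNr u v : dot u (- v) = - dot u v.
Proof. by rewrite !dotE !mxE; ring. Qed.

Lemma dot0l u : dot 0 u = 0.
Proof. by rewrite !dotE !mxE; ring. Qed.

Lemma dot_ge0 u : 0 <= dot u u.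
Proof. by rewrite dotE -!expr2 addr_ge0// sqr_ge0. Qed.

Lemma enorm_ge0 u : 0 <= enorm u.
Proof. exact: sqrtr_ge0. Qed.

Lemma enormX2 u : enorm u ^+ 2 = dot u u.
Proof. by rewrite sqr_sqrtr// dot_ge0. Qed.

Lemma enorm_le u k : 0 <= k -> (enorm u <= k) = (dot u u <= k ^+ 2).
Proof. by move=> k0; rewrite -enormX2 ler_sqr// nnegrE enorm_ge0. Qed.

Lemma dot_eq0 u : dot u u = 0 -> u = 0.
Proof.
rewrite dotE -!expr2 => /eqP; rewrite paddr_eq0 ?sqr_ge0// !sqrf_eq0.
by move=> /andP[/eqP h0 /eqP h1]; apply: rV2P; rewrite mxE.
Qed.

Lemma enorm0 : enorm (0 : 'rV[R]_2) = 0.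
Proof. by rewrite /enorm dot0l sqrtr0. Qed.

Lemma enorm_eq0 u : (enorm u == 0) = (u == 0).
Proof.
apply/eqP/eqP => [h|->]; last exact: enorm0.
by apply: dot_eq0; rewrite -enormX2 h expr0n.
Qed.

Lemma enorm_gt0 u : (0 < enorm u) = (u != 0).
Proof. by rewrite lt_neqAle enorm_ge0 andbT eq_sym enorm_eq0. Qed.

Lemma enormZ k u : enorm (k *: u) = `|k| * enorm u.
Proof. by rewrite /enorm dotZl dotZr mulrA -expr2 sqrtrM ?sqr_ge0// sqrtr_sqr. Qed.

Lemma enormN u : enorm (- u) = enorm u.
Proof. by rewrite /enorm dotNl dotNr opprK. Qed.

Lemma dot_le u v : dot u v <= enorm u * enorm v.
Proof.
have [//|h] := leP (dot u v) 0.
  by move=> h; rewrite (le_trans h)// mulr_ge0// enorm_ge0.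
rewrite -ler_sqr ?nnegrE ?mulr_ge0 ?enorm_ge0 ?(ltW h)//.
rewrite exprMn !enormX2 !dotE -subr_ge0.
suff -> : forall a b c d : R, (a * a + b * b) * (c * c + d * d) -
  (a * c + b * d) ^+ 2 = (a * d - b * c) ^+ 2 by exact: sqr_ge0.
by move=> a b c d; ring.
Qed.

Lemma dot_norm_le u v : `|dot u v| <= enorm u * enorm v.
Proof. by rewrite ler_norml dot_le lerNl -dotNl -(enormN u) dot_le. Qed.

Lemma enormD u v : enorm (u + v) <= enorm u + enorm v.
Proof.
rewrite enorm_le ?addr_ge0 ?enorm_ge0// sqrrD !enormX2 dotDl !dotDr (dotC v u).
by have := dot_le u v; lra.
Qed.

Lemma enormB u v : enorm (u - v) <= enorm u + enorm v.
Proof. by rewrite -(enormN v) enormD. Qed.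

Lemma enorm_distC u v : enorm (u - v) = enorm (v - u).
Proof. by rewrite -enormN opprB. Qed.

Lemma enorm_dist_le u v : `|enorm u - enorm v| <= enorm (u - v).
Proof.
rewrite ler_norml; apply/andP; split.
  by have := enormD u (v - u); rewrite addrC subrK enorm_distC; lra.
by have := enormD v (u - v); rewrite addrC subrK; lra.
Qed.

(** Reduces a bound on a vector to scalar bounds, which can be integrated; the direction that
    matters is [u / |u|]. *)
Lemma enorm_dual u k : (forall n, enorm n = 1 -> dot n u <= k) -> 0 <= k -> enorm u <= k.
Proof.
move=> H k0; have [->|u0] := eqVneq u 0; first by rewrite enorm0.
have e0 : 0 < enorm u by rewrite enorm_gt0.
have := H ((enorm u)^-1 *: u); rewrite enormZ ger0_norm ?invr_ge0 ?enorm_ge0//.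
rewrite mulVf ?gt_eqF// dotZl -enormX2 expr2 mulrA mulVf ?gt_eqF// mul1r.
exact.
Qed.

Lemma coord_le_enorm u i : `|u 0 i| <= enorm u.
Proof.
have le0 : (u 0 0) ^+ 2 <= dot u u by rewrite dotE -!expr2 lerDl sqr_ge0.
have le1 : (u 0 1) ^+ 2 <= dot u u by rewrite dotE -!expr2 lerDr sqr_ge0.
rewrite -ler_sqr ?nnegrE ?enorm_ge0// enormX2 real_normK ?num_real//.
case: i => [[|[|//]] i2].
  by move: le0; congr (u _ _ ^+ _ <= _); apply/val_inj.
by move: le1; congr (u _ _ ^+ _ <= _); apply/val_inj.
Qed.

Lemma norm_le_enorm u : `|u| <= enorm u.
Proof.
rewrite /Num.norm/= mx_normrE; apply: bigmax_le; first exact: enorm_ge0.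
by move=> [i j] _ /=; rewrite ord1; exact: coord_le_enorm.
Qed.

Lemma coord_le_norm u i : `|u 0 i| <= `|u|.
Proof.
rewrite [leRHS]/Num.norm/= mx_normrE.
exact: (le_bigmax _ (fun ij : 'I_1 * 'I_2 => `|u ij.1 ij.2|) (0, i)).
Qed.

Lemma enorm_le_coord u : enorm u <= `|u 0 0| + `|u 0 1|.
Proof.
rewrite enorm_le ?addr_ge0// dotE sqrrD -!expr2 !real_normK ?num_real//.
have := mulr_ge0 (normr_ge0 (u 0 0)) (normr_ge0 (u 0 1)); lra.
Qed.

Lemma enorm_le_norm u : enorm u <= 2 * `|u|.
Proof.
rewrite (le_trans (enorm_le_coord u))// mulr_natl mulr2n lerD//;
  exact: coord_le_norm.
Qed.

End Plane.

Section FlightDensity.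
Context {R : realType} (v : R) (w : 'rV[R]_2 -> 'rV[R]_2) (p : 'rV[R]_2).
Hypothesis wv : enorm (w p) < v.
Implicit Types q n : 'rV[R]_2.
Local Notation fd := (flight_density v w p).
Local Notation W := (w p).

Let a := v ^+ 2 - dot W W.
Let rho q := Num.sqrt (dot q W ^+ 2 + a * dot q q).

Let v0 : 0 < v. Proof. exact: le_lt_trans (enorm_ge0 _) wv. Qed.

Lemma slack_gt0 : 0 < a.
Proof. by rewrite /a subr_gt0 -enormX2 ltr_sqr ?nnegrE ?enorm_ge0// ltW. Qed.
Let a0 := slack_gt0.

Lemma rhoX2 q : rho q ^+ 2 = dot q W ^+ 2 + a * dot q q.
Proof. by rewrite sqr_sqrtr// addr_ge0 ?sqr_ge0// mulr_ge0 ?dot_ge0// ltW. Qed.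

Lemma rho_ge q : `|dot q W| <= rho q.
Proof.
rewrite -sqrtr_sqr ler_sqrt; last by rewrite -rhoX2 sqr_ge0.
by rewrite lerDl mulr_ge0 ?dot_ge0// ltW.
Qed.

Lemma fd_rho q : a * fd q + dot q W = rho q.
Proof. by rewrite /flight_density -/a -/(rho q); field; rewrite gt_eqF. Qed.

Lemma fd_ge0 q : 0 <= fd q.
Proof.
rewrite /flight_density -/a -/(rho q) divr_ge0 ?(ltW a0)// addrC subr_ge0.
by rewrite (le_trans (ler_norm _)) ?rho_ge.
Qed.

(** Squaring [|q - s W| = v s] gives this equation for [s], and [flight_density] is the formula for
    its nonnegative root. *)
Lemma fd_quad q : a * fd q ^+ 2 + 2 * dot q W * fd q = dot q q.
Proof.
have a0' : a != 0 by rewrite gt_eqF.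
apply: (mulfI a0'); have := rhoX2 q; rewrite -fd_rho => h.
by move: h; rewrite sqrrD; lra.
Qed.

Lemma fd_dot q : dot (q - fd q *: W) (q - fd q *: W) = v ^+ 2 * fd q ^+ 2.
Proof.
rewrite dotDl !dotDr !dotNl !dotNr !dotZl !dotZr (dotC W q).
by have := fd_quad q; rewrite /a; lra.
Qed.

Lemma fd_enorm q : enorm (q - fd q *: W) = v * fd q.
Proof.
by rewrite /enorm fd_dot -exprMn sqrtr_sqr ger0_norm// mulr_ge0 ?fd_ge0// ltW.
Qed.

(** With [F = fd q], subtracting [fd_quad] turns the hypothesis into
    [(s - F) (a s + rho q + q.W) >= 0]. The second factor is nonnegative since [|q.W| <= rho q], so
    [s < F] forces it to vanish; then [s = 0] and [q = 0], where [F = 0]. *)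
Lemma fd_le q s : 0 <= s -> enorm (q - s *: W) <= v * s -> fd q <= s.
Proof.
move=> s0; rewrite enorm_le ?mulr_ge0 ?(ltW v0)//.
rewrite dotDl !dotDr !dotNl !dotNr !dotZl !dotZr (dotC W q) => h.
rewrite leNgt; apply/negP => sf.
have Q := fd_quad q; have rh := fd_rho q.
have := rho_ge q; rewrite ler_norml => /andP[rb _].
have h1 : 0 <= (s - fd q) * (a * s + (rho q + dot q W)).
  rewrite -rh; move: Q h; rewrite /a => Q h; nra.
have as0 : 0 <= a * s by rewrite mulr_ge0// ltW.
have h2 : a * s + (rho q + dot q W) <= 0.
  by move: h1; rewrite nmulr_rge0// subr_lt0.
have s00 : s = 0.
  have : a * s = 0 by apply/eqP; rewrite eq_le as0 andbT; lra.
  by move=> /eqP; rewrite mulf_eq0 gt_eqF//= => /eqP.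
have rb0 : rho q + dot q W = 0.
  by apply/eqP; rewrite eq_le; move: h2; rewrite s00 mulr0 add0r => ->/=; lra.
have C0 : dot q q = 0.
  rewrite -Q; have -> : a * fd q ^+ 2 + 2 * dot q W * fd q = fd q * (rho q + dot q W).
    by rewrite -rh; ring.
  by rewrite rb0 mulr0.
have q0 := dot_eq0 C0.
move: sf; rewrite s00 /flight_density q0 !dot0l expr0n/= mulr0 addr0 sqrtr0.
by rewrite oppr0 addr0 mul0r ltxx.
Qed.

(** The relation [|q - F W| = v F] seen through one unit vector: linear in [q], hence suitable for
    integration along a path. *)
Lemma fd_dual q n : enorm n = 1 -> dot n q <= fd q * (v + dot n W).
Proof.
move=> n1; have := dot_le n (q - fd q *: W); rewrite fd_enorm n1 mul1r.
by rewrite dotDr dotNr dotZr; lra.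
Qed.

Lemma fd_upper q : fd q <= enorm q / (v - enorm W).
Proof.
have vw : 0 < v - enorm W by rewrite subr_gt0.
set s := enorm q / _; have s0 : 0 <= s by rewrite divr_ge0 ?enorm_ge0// ltW.
have sE : s * (v - enorm W) = enorm q by rewrite divfK// gt_eqF.
apply: fd_le => //; rewrite (le_trans (enormB _ _))// enormZ ger0_norm//.
by rewrite -sE; lra.
Qed.

Lemma fd_lower q : enorm q <= 2 * v * fd q.
Proof.
have -> : q = (q - fd q *: W) + fd q *: W by rewrite subrK.
rewrite (le_trans (enormD _ _))// subrK fd_enorm enormZ ger0_norm ?fd_ge0//.
have : fd q * enorm W <= fd q * v by rewrite ler_wpM2l ?fd_ge0// ltW.
by lra.
Qed.

End FlightDensity.

(** * Uniform estimates on bounded sets of the plane *)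

Section Compactness.
Context {R : realType}.
Implicit Types (x y : 'rV[R]_2) (Phi : 'rV[R]_2 -> 'rV[R]_2).

Lemma near_enorm_dist x (e : R) : 0 < e -> \forall y \near x, enorm (y - x) <= e.
Proof.
move=> e0; apply/nbhs_ballP; exists (e / 2); first by rewrite /= divr_gt0.
move=> y; rewrite /ball/= /mx_ball => -[_ xy].
have H i : `|(y - x) 0 i| <= e / 2.
  by have := xy 0 i; rewrite /ball/= !mxE distrC => /ltW.
by rewrite (le_trans (enorm_le_coord _))// [leRHS]splitr lerD.
Qed.

Lemma continuous_enorm : continuous (@enorm R).
Proof.
move=> x; apply/(cvgrPdist_le (FF := nbhs_filter x)) => e e0.
apply: (@filterS _ _ (nbhs_filter x) _ _ _ (near_enorm_dist x e0)) => y.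
by rewrite enorm_distC; exact/le_trans/enorm_dist_le.
Qed.

Lemma compact_box (r : R) : compact [set x : 'rV[R]_2 | forall i, `|x 0 i| <= r].
Proof.
rewrite (_ : mkset _ = [set x : 'rV[R]_2 | forall i, `[- r, r]%classic (x ord0 i)]).
  exact: (@rV_compact R 2 (fun=> `[- r, r]%classic) (fun=> @segment_compact R _ _)).
by apply/seteqP; split => x /= H i; move: (H i); rewrite /= in_itv/= ler_norml.
Qed.

Lemma continuous_enormP Phi x (e : R) : {for x, continuous Phi} -> 0 < e ->
  exists2 d, 0 < d & forall y, enorm (y - x) <= d -> enorm (Phi y - Phi x) <= e.
Proof.
move=> cP e0; have e20 : 0 < e / 2 by rewrite divr_gt0.
have /nbhs_ballP[d /= d0 H] : \forall y \near x, `|Phi x - Phi y| <= e / 2.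
  exact: (cvgr_dist_le (FF := nbhs_filter x) _ _ cP).
exists (d / 2); first by rewrite divr_gt0.
move=> y yx; rewrite (le_trans (enorm_le_norm _))// mulrC -ler_pdivlMr// distrC.
apply: H; rewrite /ball/= /mx_ball; split=> [//|i j].
rewrite /ball/= ord1 distrC (le_lt_trans _ (_ : d / 2 < d))//; last by lra.
by rewrite (le_trans _ yx)// (le_trans _ (coord_le_enorm _ j))// !mxE.
Qed.

(** Only [x] is confined to the ball; [y] may leave it, as perturbed points do later. Compactness is
    used in its near-covering form, with the radius halved to pass from a centre to the points
    around it. *)
Lemma heine_enorm Phi (r e : R) : continuous Phi -> 0 < e ->
  exists2 d, 0 < d & forall x y, enorm x <= r -> enorm (y - x) <= d ->
    enorm (Phi y - Phi x) <= e.
Proof.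
move=> cP e0.
have /compact_near_coveringP cov := compact_box (r := r).
have := cov R (at_right 0)
  (fun d x => forall y, enorm (y - x) <= d -> enorm (Phi y - Phi x) <= e) _.
have e20 : 0 < e / 2 by rewrite divr_gt0.
case=> [x _|d /= d0 H].
  have [d d0 H] := continuous_enormP (cP x) e20.
  have d20 : 0 < d / 2 by rewrite divr_gt0.
  have nx : \forall x' \near x, enorm (x' - x) <= d / 2.
    exact: near_enorm_dist.
  have nd : \forall d' \near at_right (0 : R), d' <= d / 2.
    exact: nbhs_right_le.
  near=> x' d' => /= y yx'.
  have x'x : enorm (x' - x) <= d / 2 by near: x'.
  have d'd : d' <= d / 2 by near: d'.
  have -> : Phi y - Phi x' = (Phi y - Phi x) - (Phi x' - Phi x).
    by rewrite opprB addrA subrK.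
  rewrite (le_trans (enormB _ _))// [leRHS]splitr lerD//; apply: H; last lra.
  have -> : y - x = (y - x') + (x' - x) by rewrite addrA subrK.
  rewrite (le_trans (enormD _ _))//; lra.
have [d' d'0 d'd] : exists2 d', 0 < d' & d' < d.
  by exists (d / 2); rewrite ?divr_gt0//; lra.
exists d' => // x y xr; apply: (H d') => //.
  by rewrite /= sub0r normrN gtr0_norm.
by move=> i; rewrite (le_trans (coord_le_enorm _ _)).
Unshelve. all: by end_near. Qed.

Lemma bounded_enorm Phi (r : R) : continuous Phi ->
  exists2 M, 0 <= M & forall x, enorm x <= r -> enorm (Phi x) <= M.
Proof.
move=> cP; have /compact_bounded : compact (Phi @` [set x : 'rV[R]_2 | forall i, `|x 0 i| <= r]).
  apply: continuous_compact (compact_box (r := r)); exact: continuous_subspaceT.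
move=> [M [_ HM]]; exists (2 * (`|M| + 1)); first by rewrite mulr_ge0// addr_ge0.
move=> x xr; rewrite (le_trans (enorm_le_norm _))// ler_pM2l//.
apply: (HM (`|M| + 1)); first by rewrite ltr_pwDr// ler_norm.
by exists x => // i; rewrite (le_trans (coord_le_enorm _ _)).
Qed.

Lemma mvt_le (f df : R -> R) (M b : R) : 0 <= b ->
  (forall t : R, 0 <= t <= b -> is_derive t 1 f (df t)) ->
  (forall t : R, 0 <= t <= b -> df t <= M) -> f b - f 0 <= M * b.
Proof.
move=> b0 df' dM; have df0b (x : R) : x \in `]0, b[ -> is_derive x 1 f (df x).
  by rewrite in_itv/= => /andP[? ?]; apply: df'; rewrite !ltW.
have fc : {within `[0, b], continuous f}.
  apply: derivable_within_continuous => x; rewrite in_itv/= => x01.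
  by have [] := df' x x01.
have [c c01 ->] := MVT_segment b0 df0b fc.
by rewrite subr0 ler_wpM2r// dM//; move: c01; rewrite in_itv.
Qed.

End Compactness.

(** * The wind field *)

Section LinearBounds.
Context {R : realType}.
Implicit Types h k : 'rV[R]_2.

Definition e_ (i : 'I_2) : 'rV[R]_2 := delta_mx 0 i.

Lemma rV2_decomp h : h = h 0 0 *: e_ 0 + h 0 1 *: e_ 1.
Proof. by apply: rV2P; rewrite !mxE/= ?mulr1 ?mulr0 ?addr0 ?add0r. Qed.

Lemma linear_scale (A : 'rV[R]_2 -> 'rV[R]_2) (t : R) h : linear A ->
  A (t *: h) = t *: A h.
Proof.
move=> lA; have A0 : A 0 = 0.
  by have := lA (- 1) 0 0; rewrite scaler0 addr0 scaleN1r addNr.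
by rewrite -[t *: h]addr0 lA A0 addr0.
Qed.

Lemma linear_decomp (A : 'rV[R]_2 -> 'rV[R]_2) h : linear A ->
  A h = h 0 0 *: A (e_ 0) + h 0 1 *: A (e_ 1).
Proof.
by move=> lA; rewrite {1}(rV2_decomp h) lA (linear_scale _ (e_ 1) lA).
Qed.

Lemma linear_enorm_le (A : 'rV[R]_2 -> 'rV[R]_2) h : linear A ->
  enorm (A h) <= (enorm (A (e_ 0)) + enorm (A (e_ 1))) * enorm h.
Proof.
move=> lA; rewrite (linear_decomp h lA) (le_trans (enormD _ _))// !enormZ.
by rewrite mulrDl lerD// mulrC ler_wpM2l ?enorm_ge0// coord_le_enorm.
Qed.

(** Reduces continuity in operator norm to continuity of the values at two basis vectors, which is
    what [twice_cont_diff] offers. *)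
Lemma linear_dist_le (A A' : 'rV[R]_2 -> 'rV[R]_2) h : linear A -> linear A' ->
  enorm (A h - A' h) <=
  (enorm (A (e_ 0) - A' (e_ 0)) + enorm (A (e_ 1) - A' (e_ 1))) * enorm h.
Proof.
move=> lA lA'; rewrite (linear_decomp h lA) (linear_decomp h lA').
rewrite opprD addrACA -!scalerBr (le_trans (enormD _ _))// !enormZ.
by rewrite mulrDl lerD// mulrC ler_wpM2l ?enorm_ge0// coord_le_enorm.
Qed.

End LinearBounds.

Section Wind.
Context {R : realType} (w : 'rV[R]_2 -> 'rV[R]_2).
Hypothesis w_C2 : twice_cont_diff w.
Implicit Types p e h k x y : 'rV[R]_2.

Lemma is_derive_line (F : 'rV[R]_2 -> 'rV[R]_2) p e (s : R) :
  differentiable F (p + s *: e) ->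
  is_derive s 1 (fun s => F (p + s *: e)) ('d F (p + s *: e) e).
Proof.
move=> dF; apply/is_derive1P; rewrite -deriveE//.
have : derivable F (p + s *: e) e by exact: diff_derivable.
rewrite /derivable /derive; set g := (X in cvg (X @ _) -> _).
set g' := (X in _ -> X @ _ --> _); have -> : g' = g.
  by apply/funext => t; rewrite /g /g' scalerDl addrCA.
exact.
Qed.

Lemma wind_line p e (s : R) :
  is_derive s 1 (fun s => w (p + s *: e)) ('d w (p + s *: e) e).
Proof. by apply: is_derive_line; case: w_C2. Qed.

Lemma dwind_line p e k (s : R) :
  is_derive s 1 (fun s => 'd w (p + s *: e) k) (second_deriv w (p + s *: e) e k).
Proof. by apply: is_derive_line; case: w_C2 => _ + _; apply. Qed.

Lemma wind_continuous : continuous w.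
Proof. by move=> x; apply: differentiable_continuous; case: w_C2. Qed.

Lemma dwind_continuous k : continuous (fun x => 'd w x k).
Proof. by move=> x; apply: differentiable_continuous; case: w_C2 => _ + _; apply. Qed.

(** The direction [k] sits inside the function being differentiated, so linearity in [k] combines
    linearity of ['d w y] with that of differentiation itself. *)
Lemma second_deriv_linear p h : linear (second_deriv w p h).
Proof.
have dk k : differentiable (fun y => 'd w y k : 'rV[R]_2) p.
  by case: w_C2 => _ + _; apply.
move=> t k k'; rewrite /second_deriv.
set f := fun y => 'd w y k : 'rV[R]_2.
set g := fun y => 'd w y k' : 'rV[R]_2.
have df : differentiable f p := dk k.
have dg : differentiable g p := dk k'.
have -> : (fun y => 'd w y (t *: k + k') : 'rV[R]_2) = (t *: f + g).
  apply/funext => y; transitivity (t *: 'd w y k + 'd w y k'); last by [].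
  exact: (linearP ('d w y) t k k').
clearbody f g.
have dtf : differentiable (t *: f) p by exact: differentiableZ.
transitivity (('d (t *: f) p \+ 'd g p) h).
  exact: (congr1 (fun F => F h) (diffD dtf dg)).
congr (_ + _); exact: (congr1 (fun F => F h) (diffZ t df)).
Qed.

Lemma diff_linear p : linear ('d w p).
Proof. exact: linearP. Qed.

Lemma second_deriv_linearl p k : linear (fun h => second_deriv w p h k).
Proof. exact: (linearP ('d (fun y : 'rV[R]_2 => 'd w y k : 'rV[R]_2) p)). Qed.

Lemma second_derivZ p h k (s t : R) :
  second_deriv w p (s *: h) (t *: k) = s *: (t *: second_deriv w p h k).
Proof.
rewrite (linear_scale s h (second_deriv_linearl p (t *: k))).
by rewrite (linear_scale t k (second_deriv_linear p h)).
Qed.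

(** A crude bound from the four pairs of basis vectors. It shows that the set in [c2] is bounded, so
    that its [sup] is a genuine supremum. *)
Let d2bound p :=
  (enorm (second_deriv w p (e_ 0) (e_ 0)) + enorm (second_deriv w p (e_ 1) (e_ 0)) +
   (enorm (second_deriv w p (e_ 0) (e_ 1)) + enorm (second_deriv w p (e_ 1) (e_ 1)))).

Lemma second_deriv_enorm_le p h k : enorm (second_deriv w p h k) <=
  d2bound p * enorm h * enorm k.
Proof.
rewrite /d2bound.
apply: (le_trans (linear_enorm_le k (second_deriv_linear p h))).
rewrite ler_wpM2r ?enorm_ge0// mulrDl lerD//.
  exact: (linear_enorm_le h (second_deriv_linearl p (e_ 0))).
exact: (linear_enorm_le h (second_deriv_linearl p (e_ 1))).
Qed.

Lemma c1_ge p h : enorm ('d w p h) <= c1 w p * enorm h.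
Proof.
have ub : has_ubound [set enorm ('d w p h) | h in [set h | enorm h <= 1]].
  exists (enorm ('d w p (e_ 0)) + enorm ('d w p (e_ 1))) => _ [k /= k1 <-].
  rewrite (le_trans (linear_enorm_le _ (diff_linear p)))// ler_piMr// addr_ge0//; exact: enorm_ge0.
have [->|h0] := eqVneq h 0; first by rewrite linear0 enorm0 mulr0.
have eh0 : 0 < enorm h by rewrite enorm_gt0.
rewrite -ler_pdivrMr// mulrC; apply: ub_le_sup => //=.
exists ((enorm h)^-1 *: h).
  by rewrite /= enormZ ger0_norm ?invr_ge0 ?enorm_ge0// mulVf ?gt_eqF.
by rewrite linearZ/= enormZ ger0_norm ?invr_ge0 ?enorm_ge0.
Qed.

Lemma c1_ge0 p : 0 <= c1 w p.
Proof.
have := c1_ge p (e_ 0); have : enorm (e_ 0 : 'rV[R]_2) = 1.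
  by rewrite /enorm dotE !mxE/= mulr1 mulr0 addr0 sqrtr1.
by move=> ->; rewrite mulr1; apply/le_trans/enorm_ge0.
Qed.

Lemma c1_le p (M : R) : (forall h, enorm ('d w p h) <= M * enorm h) -> 0 <= M ->
  c1 w p <= M.
Proof.
move=> H M0; apply: ge_sup; first by exists (enorm ('d w p 0)); exists 0; rewrite //= enorm0.
by move=> _ [h /= h1 <-]; rewrite (le_trans (H h))// ler_piMr.
Qed.

Lemma c2_ge p h k : enorm (second_deriv w p h k) <= c2 w p * enorm h * enorm k.
Proof.
have ub : has_ubound [set enorm (second_deriv w p hk.1 hk.2)
      | hk in [set hk : 'rV[R]_2 * 'rV[R]_2 | enorm hk.1 <= 1 /\ enorm hk.2 <= 1]].
  exists (d2bound p) => _ [[h' k'] /= [h1 k1] <-].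
  apply: (le_trans (second_deriv_enorm_le _ _ _)).
  rewrite -mulrA ler_piMr// ?mulr_ile1 ?enorm_ge0//.
  by rewrite !addr_ge0// enorm_ge0.
have [->|h0] := eqVneq h 0.
  rewrite -(scale0r (0 : 'rV[R]_2)) -[k in leLHS]scale1r second_derivZ !scale0r.
  by rewrite enorm0 mulr0 mul0r.
have [->|k0] := eqVneq k 0.
  rewrite -(scale0r (0 : 'rV[R]_2)) -[h in leLHS]scale1r second_derivZ !scale0r.
  by rewrite scaler0 enorm0 mulr0.
have eh0 : 0 < enorm h by rewrite enorm_gt0.
have ek0 : 0 < enorm k by rewrite enorm_gt0.
rewrite -mulrA -ler_pdivrMr ?mulr_gt0//; apply: ub_le_sup => //=.
exists ((enorm h)^-1 *: h, (enorm k)^-1 *: k) => /=.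
  by rewrite !enormZ !ger0_norm ?invr_ge0 ?enorm_ge0// !mulVf ?gt_eqF.
rewrite second_derivZ !enormZ !ger0_norm ?invr_ge0 ?enorm_ge0//.
by rewrite invfM mulrA mulrC.
Qed.

Lemma c2_ge0 p : 0 <= c2 w p.
Proof.
have := c2_ge p (e_ 0) (e_ 0); have : enorm (e_ 0 : 'rV[R]_2) = 1.
  by rewrite /enorm dotE !mxE/= mulr1 mulr0 addr0 sqrtr1.
by move=> ->; rewrite !mulr1; apply/le_trans/enorm_ge0.
Qed.

Lemma c2_le p (M : R) :
  (forall h k, enorm (second_deriv w p h k) <= M * enorm h * enorm k) -> 0 <= M ->
  c2 w p <= M.
Proof.
move=> H M0; apply: ge_sup.
  by exists (enorm (second_deriv w p 0 0)); exists (0, 0); rewrite //= enorm0.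
move=> _ [[h k] /= [h1 k1] <-]; rewrite (le_trans (H h k))// -mulrA ler_piMr//.
by rewrite mulr_ile1// enorm_ge0.
Qed.

End Wind.

Section Curves.
Context {R : realType}.
Implicit Types (F G : R -> 'rV[R]_2) (t : R).

Lemma is_derive_coord F t (l : 'rV[R]_2) i :
  is_derive t 1 F l -> is_derive t 1 (fun s => F s 0 i) (l 0 i).
Proof.
move=> /is_derive1P H; apply/is_derive1P.
have -> : (fun h => h^-1 *: (F (h + t) 0 i - F t 0 i)) =
    (fun h => (h^-1 *: (F (h + t) - F t)) 0 i).
  by apply/funext => h; rewrite !mxE.
exact: continuous_cvg _ (@coord_continuous R 1 2 0 i l) H.
Qed.

Lemma is_derive_rV2 F t (l : 'rV[R]_2) :
  is_derive t 1 (fun s => F s 0 0) (l 0 0) ->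
  is_derive t 1 (fun s => F s 0 1) (l 0 1) -> is_derive t 1 F l.
Proof.
move=> /is_derive1P H0 /is_derive1P H1; apply/is_derive1P.
apply/cvgrPdist_le => e e0.
have e20 : 0 < e / 2 by rewrite divr_gt0.
have K0 := cvgr_dist_le _ _ H0 _ e20.
have K1 := cvgr_dist_le _ _ H1 _ e20.
have E h i : (l - h^-1 *: (F (h + t) - F t)) 0 i =
    l 0 i - h^-1 *: (F (h + t) 0 i - F t 0 i) by rewrite !mxE.
near=> h; apply: (le_trans (norm_le_enorm _)); apply: (le_trans (enorm_le_coord _)).
by rewrite [leRHS]splitr !E; apply: lerD; near: h; [exact: K0|exact: K1].
Unshelve. all: by end_near. Qed.

Lemma is_derive_dot F G t (l m : 'rV[R]_2) : is_derive t 1 F l -> is_derive t 1 G m ->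
  is_derive t 1 (fun s => dot (F s) (G s)) (dot l (G t) + dot (F t) m).
Proof.
move=> dF dG; have := is_derive_coord 0 dF; have := is_derive_coord 1 dF.
have := is_derive_coord 0 dG; have := is_derive_coord 1 dG => G1 G0 F1 F0.
have -> : (fun s => dot (F s) (G s)) =
    (fun s => F s 0 0) * (fun s => G s 0 0) + (fun s => F s 0 1) * (fun s => G s 0 1).
  by apply/funext => s; rewrite dotE.
apply: is_derive_eq; rewrite !dotE /GRing.scale/=; ring.
Qed.

End Curves.

Section Wind.
Context {R : realType} (w : 'rV[R]_2 -> 'rV[R]_2).
Hypothesis w_C2 : twice_cont_diff w.
Implicit Types p e h k x y : 'rV[R]_2.

Lemma dwind_modulus (r e : R) : 0 < e -> exists2 d, 0 < d & forall x y,
  enorm x <= r -> enorm (y - x) <= d ->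
  forall h, enorm ('d w y h - 'd w x h) <= e * enorm h.
Proof.
move=> e0; have e20 : 0 < e / 2 by rewrite divr_gt0.
have [d0 d00 H0] := heine_enorm r (dwind_continuous w_C2 (k := e_ 0)) e20.
have [d1 d10 H1] := heine_enorm r (dwind_continuous w_C2 (k := e_ 1)) e20.
exists (Num.min d0 d1); first by rewrite lt_min d00.
move=> x y xr; rewrite le_min => /andP[y0 y1] h.
rewrite (le_trans (linear_dist_le h (diff_linear w y) (diff_linear w x)))//.
by rewrite ler_wpM2r ?enorm_ge0// [leRHS]splitr lerD// ?H0 ?H1.
Qed.

Lemma second_deriv_modulus (r e : R) : 0 < e -> exists2 d, 0 < d & forall x y,
  enorm x <= r -> enorm (y - x) <= d ->
  forall h k, enorm (second_deriv w y h k - second_deriv w x h k)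
     <= e * enorm h * enorm k.
Proof.
move=> e0; have e20 : 0 < e / 2 / 2 by rewrite !divr_gt0.
have sc h k : continuous (fun p => second_deriv w p h k) by case: w_C2 => _ _; apply.
have [d0 d00 H0] := heine_enorm r (sc (e_ 0) (e_ 0)) e20.
have [d1 d10 H1] := heine_enorm r (sc (e_ 0) (e_ 1)) e20.
have [d2 d20 H2] := heine_enorm r (sc (e_ 1) (e_ 0)) e20.
have [d3 d30 H3] := heine_enorm r (sc (e_ 1) (e_ 1)) e20.
exists (Num.min (Num.min d0 d1) (Num.min d2 d3)).
  by rewrite !lt_min d00 d10 d20 d30.
move=> x y xr; rewrite !le_min => /andP[/andP[y0 y1] /andP[y2 y3]] h k.
have l2 z := second_deriv_linear w_C2 z h.
have l1 z k' := second_deriv_linearl w z k'.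
rewrite (le_trans (linear_dist_le k (l2 y) (l2 x)))// ler_wpM2r ?enorm_ge0//.
rewrite [e in leRHS]splitr mulrDl lerD//.
  rewrite (le_trans (linear_dist_le h (l1 y _) (l1 x _)))// ler_wpM2r ?enorm_ge0//.
  by rewrite [leRHS]splitr lerD//; [exact: H0|exact: H2].
rewrite (le_trans (linear_dist_le h (l1 y _) (l1 x _)))// ler_wpM2r ?enorm_ge0//.
by rewrite [leRHS]splitr lerD//; [exact: H1|exact: H3].
Qed.

Let le_mulD (a b c n e C : R) : a <= b + c -> b <= e * n -> c <= C * n ->
  a <= (C + e) * n.
Proof. by rewrite mulrDl; lra. Qed.

Lemma c1_modulus x y (e : R) : 0 <= e ->
  (forall h, enorm ('d w y h - 'd w x h) <= e * enorm h) ->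
  `|c1 w y - c1 w x| <= e.
Proof.
move=> e0 H.
have H' : c1 w y <= c1 w x + e.
  apply: c1_le; last by rewrite addr_ge0// c1_ge0.
  move=> h; have := enormD ('d w y h - 'd w x h) ('d w x h); rewrite subrK.
  by move=> /le_mulD; apply; [exact: H|exact: c1_ge].
have H'' : c1 w x <= c1 w y + e.
  apply: c1_le; last by rewrite addr_ge0// c1_ge0.
  move=> h; have := enormD ('d w x h - 'd w y h) ('d w y h); rewrite subrK.
  rewrite enorm_distC => /le_mulD; apply; [exact: H|exact: c1_ge].
move: H' H''; move: (c1 w x) (c1 w y) => m n H' H''.
by rewrite ler_norml; apply/andP; split; lra.
Qed.

Lemma c2_modulus x y (e : R) : 0 <= e ->
  (forall h k, enorm (second_deriv w y h k - second_deriv w x h k)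
     <= e * enorm h * enorm k) ->
  `|c2 w y - c2 w x| <= e.
Proof.
move=> e0 H.
have H' : c2 w y <= c2 w x + e.
  apply: c2_le; last by rewrite addr_ge0// c2_ge0.
  move=> h k; have := enormD (second_deriv w y h k - second_deriv w x h k)
    (second_deriv w x h k).
  rewrite subrK => /le_mulD H'; rewrite -mulrA; apply: H'; rewrite mulrA;
    [exact: H|exact: c2_ge].
have H'' : c2 w x <= c2 w y + e.
  apply: c2_le; last by rewrite addr_ge0// c2_ge0.
  move=> h k; have := enormD (second_deriv w x h k - second_deriv w y h k)
    (second_deriv w y h k).
  rewrite subrK enorm_distC => /le_mulD H''; rewrite -mulrA; apply: H''; rewrite mulrA;
    [exact: H|exact: c2_ge].
move: H' H''; move: (c2 w x) (c2 w y) => m n H' H''.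
by rewrite ler_norml; apply/andP; split; lra.
Qed.

Lemma c1_continuous : continuous (c1 w).
Proof.
move=> x; apply/(cvgrPdist_le (FF := nbhs_filter x)) => e e0.
have [d d0 H] := dwind_modulus (enorm x) e0.
apply: (@filterS _ _ (nbhs_filter x) _ _ _ (near_enorm_dist x d0)) => y yx.
by rewrite distrC; apply: c1_modulus; [exact: ltW|exact: H].
Qed.

Lemma c2_continuous : continuous (c2 w).
Proof.
move=> x; apply/(cvgrPdist_le (FF := nbhs_filter x)) => e e0.
have [d d0 H] := second_deriv_modulus (enorm x) e0.
apply: (@filterS _ _ (nbhs_filter x) _ _ _ (near_enorm_dist x d0)) => y yx.
by rewrite distrC; apply: c2_modulus; [exact: ltW|exact: H].
Qed.

Lemma enorm_convex (r : R) x y (s : R) : 0 <= s <= 1 ->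
  enorm x <= r -> enorm y <= r -> enorm (x + s *: (y - x)) <= r.
Proof.
move=> /andP[s0 s1] xr yr.
have -> : x + s *: (y - x) = (1 - s) *: x + s *: y.
  by rewrite scalerBr scalerBl scale1r addrCA addrC.
rewrite (le_trans (enormD _ _))// !enormZ !ger0_norm ?subr_ge0//.
have : (1 - s) * enorm x <= (1 - s) * r by rewrite ler_wpM2l// subr_ge0.
have : s * enorm y <= s * r by rewrite ler_wpM2l.
lra.
Qed.

(** Mean value inequality for each scalar function [n.w] along the segment from [x] to [y], which
    stays in the ball. *)
Lemma wind_lipschitz (r : R) : exists2 K, 0 <= K & forall x y,
  enorm x <= r -> enorm y <= r -> enorm (w y - w x) <= K * enorm (y - x).
Proof.
have [M M0 HM] := bounded_enorm r (dwind_continuous w_C2 (k := e_ 0)).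
have [N N0 HN] := bounded_enorm r (dwind_continuous w_C2 (k := e_ 1)).
exists (M + N); first exact: addr_ge0.
move=> x y xr yr; apply: enorm_dual; last by rewrite mulr_ge0 ?addr_ge0 ?enorm_ge0.
move=> n n1; have := @mvt_le _ (fun s => dot n (w (x + s *: (y - x))))
  (fun s => dot n ('d w (x + s *: (y - x)) (y - x))) ((M + N) * enorm (y - x))
  1 ler01.
rewrite scale1r scale0r addr0 addrCA subrr addr0 dotDr dotNr mulr1.
apply => [s _|s s01].
  have := is_derive_dot (is_derive_cst n s 1) (wind_line w_C2 x (y - x) s).
  by rewrite dot0l add0r.
rewrite (le_trans (dot_le _ _))// n1 mul1r (le_trans (linear_enorm_le _ (diff_linear w _)))//.
rewrite ler_wpM2r ?enorm_ge0// lerD// ?HM ?HN//; exact: enorm_convex.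
Qed.

End Wind.

(** The essential supremum itself serves as [c]. It bounds the wind almost everywhere, and by
    continuity everywhere: a violation would persist on a square, which has positive measure. *)
Lemma wind_lt {R : realType} (w : 'rV[R]_2 -> 'rV[R]_2) (v : R) :
  continuous w -> 0 < v -> (Linfty_plane w < v%:E)%E ->
  exists2 c, 0 <= c < v & forall p, enorm (w p) <= c.
Proof.
move=> cw v0; rewrite /Linfty_plane unlock /Lnorm.
set mu2 := (_ \x _)%E.
have rect (a b r : R) : 0 < r ->
    (0 < mu2 (`[(a - r)%R, (a + r)%R]%classic `*` `[(b - r)%R, (b + r)%R]%classic))%E.
  have muI (x : R) : 0 < r -> lebesgue_measure `[(x - r)%R, (x + r)%R]%classic = (2 * r)%:E.
    move=> r0; rewrite lebesgue_measure_itv/= lte_fin.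
    have -> : x - r < x + r by lra.
    by rewrite -EFinD; congr EFin; lra.
  move=> r0; have -> : mu2 (`[(a - r)%R, (a + r)%R]%classic `*`
      `[(b - r)%R, (b + r)%R]%classic) = ((2 * r)%:E * (2 * r)%:E)%E.
    etransitivity; first by apply: product_measure1E; exact: measurable_itv.
    by congr (_ * _)%E; exact: muI.
  by rewrite -EFinM lte_fin !mulr_gt0.
(* The norm of exponent [+oo] is an essential supremum only if the whole space has positive
   measure. *)
have muT : (0 < mu2 setT)%E.
  apply: (lt_le_trans (rect 0 0 1 ltr01)); apply: le_measure; rewrite ?inE//.
  by apply: measurableX; exact: measurable_itv.
rewrite muT => H.
have [c cv Hc] : exists2 c : R, c < v &
    {ae mu2, forall x, enorm (w (vec2 x)) <= c}.
  move: H; set s := ess_sup _ _ => sv.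
  have s0 : (0 <= s)%E.
    apply: ess_sup_gee => //; apply: aeW => x; exact: abse_ge0.
  have sf : s \is a fin_num by rewrite ge0_fin_numE// (lt_trans sv) ?ltry.
  exists (fine s); first by rewrite -lte_fin fineK.
  have := ess_sup_ge mu2 (abse \o (EFin \o (@enorm R \o w \o @vec2 R))).
  move=> [N [mN N0 NH]]; exists N; split => // x Hx; apply: NH => /= K; apply: Hx.
  move: K; rewrite -/s -(fineK sf) lee_fin; exact/le_trans/ler_norm.
have wc p : enorm (w p) <= c.
  rewrite leNgt; apply/negP => cp.
  have e0 : 0 < (enorm (w p) - c) / 2 by rewrite divr_gt0// subr_gt0.
  have [d d0 Hd] := continuous_enormP (cw p) e0.
  have d20 : 0 < d / 2 by rewrite divr_gt0.
  case: Hc => N [mN N0 NH].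
  have := rect (p 0 0) (p 0 1) _ d20; apply/negP; rewrite -leNgt -N0.
  apply: le_measure; rewrite ?inE//.
    by apply: measurableX; exact: measurable_itv.
  move=> [x y] [/= xI yI]; apply: NH => /= wxy.
  have : enorm (vec2 (x, y) - p) <= d.
    rewrite (le_trans (enorm_le_coord _))// [leRHS]splitr !mxE/=.
    move: xI yI; rewrite !in_itv/= => /andP[? ?] /andP[? ?].
    by rewrite lerD// ler_norml; apply/andP; split; lra.
  move=> /Hd; rewrite enorm_distC; have := enormD (w p - w (vec2 (x, y))) (w (vec2 (x, y))).
  rewrite subrK; move: wxy cp; move: (enorm (w p)) (enorm (w (vec2 (x, y))))
    (enorm (w p - w (vec2 (x, y)))).
  by move=> *; lra.
exists c => //; rewrite cv andbT; exact: le_trans (enorm_ge0 _) (wc 0).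
Qed.

(** * Second order expansion of the flight density *)

Section ScalarCalculus.
Context {R : realType}.
Implicit Types (f g : R -> R) (t l m : R).

Lemma is_derive_add f g t l m : is_derive t 1 f l -> is_derive t 1 g m ->
  is_derive t 1 (fun s => f s + g s) (l + m).
Proof. by move=> df dg; exact: is_deriveD. Qed.

Lemma is_derive_sub f g t l m : is_derive t 1 f l -> is_derive t 1 g m ->
  is_derive t 1 (fun s => f s - g s) (l - m).
Proof. by move=> df dg; exact: is_deriveB. Qed.

Lemma is_derive_mul f g t l m : is_derive t 1 f l -> is_derive t 1 g m ->
  is_derive t 1 (fun s => f s * g s) (f t * m + l * g t).
Proof.
by move=> df dg; have := is_deriveM df dg; rewrite /GRing.scale/= (mulrC (g t)).
Qed.

(** The derivative is expressed through the quotient itself, so that [fdW1] reappears inside its own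
    derivative. *)
Lemma is_derive_div f g t l m : g t != 0 ->
  is_derive t 1 f l -> is_derive t 1 g m ->
  is_derive t 1 (fun s => f s / g s) ((l - f t / g t * m) / g t).
Proof.
move=> g0 df dg; have := is_derive_mul df (is_deriveV g0 dg).
suff -> : (l - f t / g t * m) / g t =
   f t * (- g t ^- 2 *: m) + l * (g t)^-1 by [].
by rewrite /GRing.scale/=; field.
Qed.

Lemma is_derive_comp_sqrt f t l : 0 < f t -> is_derive t 1 f l ->
  is_derive t 1 (fun s => Num.sqrt (f s)) (l / (2 * Num.sqrt (f t))).
Proof.
move=> f0 df; have := is_derive1_comp (is_derive1_sqrt f0) df.
by rewrite mulrC.
Qed.

End ScalarCalculus.

Section SecondOrder.
Context {R : realType} (v : R).
Implicit Types (Q d W : 'rV[R]_2).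

(** A constant wind field turns the wind vector into a variable of its own, while the lemmas on
    [flight_density] remain applicable. *)
Definition fdW W Q : R := flight_density v (fun=> W) 0 Q.
Definition rhoW W Q : R := (v ^+ 2 - dot W W) * fdW W Q + dot Q W.

Lemma rhoW_ge W Q : enorm W < v ->
  Num.sqrt (v ^+ 2 - dot W W) * enorm Q <= rhoW W Q.
Proof.
move=> Wv; have a0 := @slack_gt0 _ v (fun=> W) 0 Wv; rewrite /rhoW fd_rho//.
rewrite /enorm -sqrtrM ?(ltW a0)// ler_sqrt; first by rewrite lerDr sqr_ge0.
by rewrite addr_ge0 ?sqr_ge0// mulr_ge0 ?dot_ge0// ltW.
Qed.

Lemma rhoW_gt0 W Q : enorm W < v -> Q != 0 -> 0 < rhoW W Q.
Proof.
move=> Wv Q0; apply: lt_le_trans (rhoW_ge Q Wv).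
by rewrite mulr_gt0 ?enorm_gt0// sqrtr_gt0; exact: (@slack_gt0 _ v (fun=> W) 0 Wv).
Qed.

Lemma fdW_gt0 W Q : enorm W < v -> Q != 0 -> 0 < fdW W Q.
Proof.
move=> Wv Q0; have v0 : 0 < v by exact: le_lt_trans (enorm_ge0 _) Wv.
have := @fd_lower _ v (fun=> W) 0 Wv Q; rewrite -enorm_gt0 in Q0.
by move=> /(lt_le_trans Q0); rewrite pmulr_rgt0// mulr_gt0.
Qed.

Lemma rhoW_dot W Q : enorm W < v ->
  rhoW W Q = v ^+ 2 * fdW W Q + dot (Q - fdW W Q *: W) W.
Proof. by move=> Wv; rewrite /rhoW dotDl dotNl dotZl; ring. Qed.

(** In [rhoW_dot] the vector [Q - F W] has norm [v F]. This bounds [F] by the denominator of its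
    derivatives. *)
Lemma rhoW_ge' W Q : enorm W < v -> v * fdW W Q * (v - enorm W) <= rhoW W Q.
Proof.
move=> Wv; rewrite rhoW_dot//.
have := dot_norm_le (Q - fdW W Q *: W) W.
rewrite (@fd_enorm _ v (fun=> W) 0 Wv) -/(fdW W Q) ler_norml => /andP[+ _].
lra.
Qed.

(* [fdW1] and [fdW2] are the first two derivatives of s |-> fdW (W s) (Q s) when
   W' = W1, W'' = W2 and Q' = d; [rhoW] is the square root in [flight_density]. *)
Definition fdW1 W (W1 : 'rV[R]_2) Q d : R :=
  dot (Q - fdW W Q *: W) (d - fdW W Q *: W1) / rhoW W Q.

Let det Q d : R := Q 0 0 * d 0 1 - Q 0 1 * d 0 0.

(** Let [u = Q - F W] and [z = d - F W1], so that [u' = z - F1 W]. From [|u| = v F] and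
    [u.u' = v^2 F F1], the left side is the squared component of [u'] orthogonal to [u], that is
    [det(u, u')^2 / |u|^2]. It equals [v^2 det(Q, z)^2 / rho^2], and [|det(Q, z)| <= |Q| |z|]. *)
Lemma fdW1_perp W (W1 : 'rV[R]_2) Q d (u' := d - fdW W Q *: W1 - fdW1 W W1 Q d *: W) :
  enorm W < v -> Q != 0 ->
  dot u' u' - v ^+ 2 * fdW1 W W1 Q d ^+ 2 <=
    v ^+ 2 * enorm Q ^+ 2 * enorm (d - fdW W Q *: W1) ^+ 2 / rhoW W Q ^+ 2.
Proof.
move=> Wv Q0; have r0 := rhoW_gt0 Wv Q0; have F0 := fdW_gt0 Wv Q0.
have v0 : 0 < v by exact: le_lt_trans (enorm_ge0 _) Wv.
have uu := @fd_dot _ v (fun=> W) 0 Wv Q; rewrite -/(fdW W Q) in uu.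
have rE := rhoW_dot Q Wv.
have F1E : fdW1 W W1 Q d * rhoW W Q = dot (Q - fdW W Q *: W) (d - fdW W Q *: W1).
  by rewrite /fdW1 divfK// gt_eqF.
rewrite /u' {u'} !enormX2.
have QE : Q = (Q - fdW W Q *: W) + fdW W Q *: W by rewrite subrK.
move: QE uu rE F1E; move: (fdW1 _ _ _ _) (rhoW W Q) (fdW W Q) r0 F0.
move=> F1 r F r0 F0; move: (d - F *: W1) => z.
move: (Q - F *: W) => u QE uu rE F1E.
have det_le : det Q z ^+ 2 <= dot Q Q * dot z z.
  rewrite -subr_ge0 !dotE /det.
  suff -> : forall a b c e : R, (a * a + b * b) * (c * c + e * e) -
    (a * e - b * c) ^+ 2 = (a * c + b * e) ^+ 2 by exact: sqr_ge0.
  by move=> a b c e; ring.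
have v20 : v ^+ 2 != 0 by rewrite gt_eqF// exprn_gt0.
have F40 : F ^+ 4 * v ^+ 2 != 0 by rewrite mulf_neq0// gt_eqF// exprn_gt0.
have key : r ^+ 2 * (dot (z - F1 *: W) (z - F1 *: W) - v ^+ 2 * F1 ^+ 2) =
    v ^+ 2 * det Q z ^+ 2.
  apply: (mulfI F40).
  have E1 : F * r = dot u Q.
    by rewrite rE QE dotDr dotZr uu; ring.
  have E2 : dot u (z - F1 *: W) = v ^+ 2 * F * F1.
    by rewrite dotDr dotNr dotZr -F1E rE; ring.
  have E3 : F ^+ 2 * v ^+ 2 * (dot (z - F1 *: W) (z - F1 *: W) - v ^+ 2 * F1 ^+ 2)
     = det u (z - F1 *: W) ^+ 2.
    have -> : det u (z - F1 *: W) ^+ 2 = dot u u * dot (z - F1 *: W) (z - F1 *: W)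
      - dot u (z - F1 *: W) ^+ 2 by rewrite !dotE /det; ring.
    by rewrite E2 uu; ring.
  (* Eliminating [F1] and [W] by [F1 r = u.z] and [Q = u + F W] leaves the planar identity [(u.Q)
     det(u, z) - (u.z) det(u, Q) = |u|^2 det(Q, z)]. *)
  have E4 : F * r * det u (z - F1 *: W) = dot u u * det Q z.
    transitivity (dot u Q * det u z - dot u z * (F * det u W)).
      by rewrite -F1E -E1 /det !mxE; ring.
    have -> : F * det u W = det u Q by rewrite QE /det !mxE; ring.
    by rewrite !dotE /det; ring.
  transitivity ((F * r * det u (z - F1 *: W)) ^+ 2).
    rewrite exprMn -E3; ring.
  by rewrite E4 uu; ring.
by rewrite ler_pdivlMr ?exprn_gt0// mulrC key -mulrA ler_wpM2l ?sqr_ge0.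
Qed.

Definition fdW2 W (W1 W2 : 'rV[R]_2) Q d : R :=
  let F := fdW W Q in let F1 := fdW1 W W1 Q d in
  (dot (d - (F1 *: W + F *: W1)) (d - F *: W1)
   + dot (Q - F *: W) (- (F1 *: W1 + F *: W2))
   - F1 * (- (2 * dot W W1) * F + (v ^+ 2 - dot W W) * F1 + (dot d W + dot Q W1)))
  / rhoW W Q.

(** The form obtained by differentiating [|u|^2 = v^2 F^2] twice, with [u = Q - F W]. Its first
    difference is what [fdW1_perp] bounds. *)
Lemma fdW2E W (W1 W2 : 'rV[R]_2) Q d
    (u' := d - fdW W Q *: W1 - fdW1 W W1 Q d *: W) :
  fdW2 W W1 W2 Q d = (dot u' u' - v ^+ 2 * fdW1 W W1 Q d ^+ 2
    - fdW W Q * dot (Q - fdW W Q *: W) W2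
    - 2 * fdW1 W W1 Q d * dot (Q - fdW W Q *: W) W1) / rhoW W Q.
Proof.
rewrite /fdW2 {}/u' /=; congr (_ / _).
by move: (fdW W Q) (fdW1 W W1 Q d) => F F1; rewrite !dotE !mxE; ring.
Qed.

(* 6/13 > 1/sqrt 5, and the bounds on [enorm Q] are not sharp: the margins leave
   room for evaluating the derivatives at points near the reference path. *)
Lemma fdW2_le W (W1 W2 : 'rV[R]_2) Q d (L A1 A2 D E : R) : 0 < v -> 0 < L ->
  0 <= A1 -> 0 <= A2 -> 0 <= E ->
  enorm W <= 6 / 13 * v -> 49 / 50 * L <= enorm Q <= 51 / 50 * L ->
  enorm d <= D -> enorm W1 <= A1 * E -> enorm W2 <= A2 * E ^+ 2 ->
  fdW2 W W1 W2 Q d <= 2 * (4 / 5 / (L * v) * D ^+ 2 + 13 / 2 * A1 / v ^+ 2 * D * E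
    + (48 / 5 * L * A1 ^+ 2 / v ^+ 3 + 2 * L * A2 / v ^+ 2) * E ^+ 2).
Proof.
move=> v0 L0 A10 A20 E0 W46 /andP[Ql Qu] dD W1E W2E.
have Wv : enorm W < v by apply: (le_lt_trans W46); rewrite gtr_pMl//; lra.
have Q0 : Q != 0 by rewrite -enorm_gt0; apply: lt_le_trans Ql; rewrite mulr_gt0//; lra.
have r0 := rhoW_gt0 Wv Q0; have F0 := fdW_gt0 Wv Q0.
have uE : enorm (Q - fdW W Q *: W) = v * fdW W Q by exact: fd_enorm.
have perp := fdW1_perp W1 d Wv Q0.
(* The next constants: [7/8 < sqrt(1 - (6/13)^2)], [7/13 = 1 - 6/13] and
   [19/10 > (51/50) (13/7)]. *)
have rQ : 7 / 8 * v * enorm Q <= rhoW W Q.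
  apply: le_trans (rhoW_ge Q Wv); rewrite ler_wpM2r ?enorm_ge0//.
  have v78 : 0 <= 7 / 8 * v by rewrite mulr_ge0 ?(ltW v0)//; lra.
  rewrite -(ger0_norm v78) -sqrtr_sqr ler_wsqrtr// -enormX2.
  have : enorm W ^+ 2 <= (6 / 13 * v) ^+ 2.
    by rewrite ler_sqr ?nnegrE ?enorm_ge0// mulr_ge0 ?(ltW v0)//; lra.
  have := sqr_ge0 v; rewrite !exprMn; move: (v ^+ 2) (enorm W ^+ 2) => x y; lra.
have rF : 7 / 13 * v * (v * fdW W Q) <= rhoW W Q.
  apply: le_trans (rhoW_ge' Q Wv); rewrite mulrC ler_wpM2l//; last lra.
  by rewrite ltW// mulr_gt0.
have FL : v * fdW W Q <= 19 / 10 * L.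
  have := @fd_upper _ v (fun=> W) 0 Wv Q; rewrite -/(fdW W Q).
  have vW : 7 / 13 * v <= v - enorm W by lra.
  rewrite ler_pdivlMr; last by rewrite subr_gt0.
  move=> FQ; have : fdW W Q * (7 / 13 * v) <= 51 / 50 * L.
    by apply: le_trans Qu; apply: le_trans FQ; rewrite ler_wpM2l// ltW.
  by move: (fdW W Q) => F; lra.
have uW2 := dot_norm_le (Q - fdW W Q *: W) W2.
have uW1 := dot_norm_le (Q - fdW W Q *: W) W1.
have uz := dot_norm_le (Q - fdW W Q *: W) (d - fdW W Q *: W1).
have F1E : fdW1 W W1 Q d * rhoW W Q = dot (Q - fdW W Q *: W) (d - fdW W Q *: W1).
  by rewrite /fdW1 divfK// gt_eqF.
have zE : enorm (d - fdW W Q *: W1) <= D + fdW W Q * (A1 * E).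
  by rewrite (le_trans (enormB _ _))// lerD// enormZ ger0_norm ?(ltW F0)// ler_wpM2l// ltW.
have z0 := enorm_ge0 (d - fdW W Q *: W1).
rewrite uE in uW2 uW1 uz.
rewrite fdW2E ler_pdivrMr//.
move: perp uW2 uW1 uz F1E zE z0 FL rF rQ r0 F0; clear uE.
move: (fdW1 _ _ _ _) (rhoW W Q) (fdW W Q) => F1 r F.
move: (dot (d - _ *: W1 - _ *: W) _) => uu.
move: (dot (Q - F *: W) W2) (dot (Q - F *: W) W1) => s2 s1.
move: (dot (Q - F *: W) (d - F *: W1)) (enorm (d - F *: W1)) => sz z.
move: (enorm Q) Ql Qu => nQ Ql Qu.
move=> perp uW2 uW1 uz F1E zE z0 FL rF rQ r0 F0.
have q0 : 0 < nQ by apply: lt_le_trans Ql; rewrite mulr_gt0//; lra.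
have B0 : 0 <= A1 * E by rewrite mulr_ge0.
have vF0 : 0 <= v * F by rewrite mulr_ge0// ltW.
have A2E0 : 0 <= A2 * E ^+ 2 by rewrite mulr_ge0// sqr_ge0.
have vn0 : v != 0 by rewrite gt_eqF.
have Ln0 : L != 0 by rewrite gt_eqF.
(* The inverse of [7/13 v]; it bounds both [v F] in terms of [r] and [|F1|] in terms of [z]. *)
pose G := 13 / 7 / v; have G0 : 0 < G by rewrite divr_gt0//; lra.
have vFG : v * F <= G * r.
  have -> : G * r = 13 / 7 * r / v by rewrite /G; ring.
  by rewrite ler_pdivlMr//; move: rF; move: (v * F) => x; lra.
have F1G : `|F1| <= G * z.
  have -> : G * z = 13 / 7 * z / v by rewrite /G; ring.
  rewrite ler_pdivlMr// -(ler_pM2r r0).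
  have h0 : `|F1| * r <= v * F * z by rewrite -(gtr0_norm r0) -normrM F1E.
  have h1 := ler_wpM2r (ltW v0) h0.
  have h2 : 7 / 13 * v * (v * F) * z <= r * z by rewrite ler_wpM2r.
  by move: h1 h2; move: `|F1| => f; lra.
(* Works because [(8/5) (7/8)^3 (49/50) > 1]. *)
have bound1 : uu - v ^+ 2 * F1 ^+ 2 <= 8 / 5 / (L * v) * z ^+ 2 * r.
  apply: (le_trans perp); rewrite ler_pdivrMr ?exprn_gt0//.
  have r3 : (7 / 8 * v * nQ) ^+ 3 <= r ^+ 3.
    rewrite lerXn2r ?nnegrE ?(ltW r0)// !mulr_ge0 ?(ltW v0) ?(ltW q0)//; lra.
  have : v ^+ 2 * nQ ^+ 2 <= 8 / 5 / (L * v) * r ^+ 3.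
    have -> : 8 / 5 / (L * v) * r ^+ 3 = 8 / 5 * r ^+ 3 / (L * v) by rewrite mulrAC.
    rewrite ler_pdivlMr ?mulr_gt0//.
    have vq : 0 <= v ^+ 3 * nQ ^+ 2 by rewrite mulr_ge0 ?exprn_ge0 ?(ltW v0) ?(ltW q0).
    have : v ^+ 3 * nQ ^+ 2 * (49 / 50 * L) <= v ^+ 3 * nQ ^+ 2 * nQ by rewrite ler_wpM2l.
    have vqL : 0 <= v ^+ 3 * nQ ^+ 2 * L by rewrite mulr_ge0// ltW.
    have -> : v ^+ 2 * nQ ^+ 2 * (L * v) = v ^+ 3 * nQ ^+ 2 * L by ring.
    move: r3; rewrite !exprMn.
    have -> : v ^+ 3 * nQ ^+ 2 * nQ = v ^+ 3 * nQ ^+ 3 by ring.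
    have -> : v ^+ 3 * nQ ^+ 2 * (49 / 50 * L) = 49 / 50 * (v ^+ 3 * nQ ^+ 2 * L) by ring.
    rewrite -mulrA; move: vqL; move: (v ^+ 3 * nQ ^+ 2 * L) (v ^+ 3 * nQ ^+ 3) (r ^+ 3).
    by move=> x y r' *; lra.
  move=> h; have := ler_wpM2r (sqr_ge0 z) h; move/le_trans; apply.
  by rewrite le_eqVlt; apply/orP; left; apply/eqP; ring.
(* Works because [(19/10) (13/7) < 4]. *)
have bound2 : - (F * s2) <= 4 * L * A2 / v ^+ 2 * E ^+ 2 * r.
  have s2b : - s2 <= v * F * (A2 * E ^+ 2).
    by rewrite (le_trans (ler_norm _))// normrN (le_trans uW2)// ler_wpM2l.
  apply: (@le_trans _ _ (F * (v * F * (A2 * E ^+ 2)))).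
    by rewrite -mulrN ler_wpM2l// ltW.
  have -> : F * (v * F * (A2 * E ^+ 2)) = (v * F) * (v * F) * (A2 * E ^+ 2) / v.
    by field.
  rewrite ler_pdivrMr//.
  have FF : (v * F) * (v * F) <= 19 / 10 * L * (G * r) by rewrite ler_pM.
  apply: (le_trans (ler_wpM2r A2E0 FF)); rewrite -subr_ge0.
  have -> : 4 * L * A2 / v ^+ 2 * E ^+ 2 * r * v - 19 / 10 * L * (G * r) * (A2 * E ^+ 2)
     = (4 - 19 / 10 * (13 / 7)) * (L * (A2 * E ^+ 2) * r / v) by rewrite /G; field.
  rewrite mulr_ge0//; first by lra.
  by rewrite divr_ge0 ?(ltW v0)// mulr_ge0 ?(ltW r0)// mulr_ge0// ltW.
have X0 : 0 <= (A1 * E) * z / v ^+ 2 * r.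
  by apply: mulr_ge0 (ltW r0); apply: divr_ge0 (sqr_ge0 _); exact: mulr_ge0.
(* Works because [2 (13/7)^2 < 69/10]. *)
have bound3 : - (2 * F1 * s1) <= 69 / 10 * ((A1 * E) * z / v ^+ 2 * r).
  have s1b : `|s1| <= v * F * (A1 * E) by rewrite (le_trans uW1)// ler_wpM2l.
  have h : `|F1 * s1| <= G * z * (G * r * (A1 * E)).
    rewrite normrM ler_pM//; apply: (le_trans s1b); exact: ler_wpM2r.
  have := le_trans (ler_norm (- (F1 * s1))); rewrite normrN => /(_ _ h).
  have -> : G * z * (G * r * (A1 * E)) = 13 / 7 * (13 / 7) * ((A1 * E) * z / v ^+ 2 * r).
    by rewrite /G; field.
  by move: X0; move: (A1 * E * z / v ^+ 2 * r) => x; lra.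
have zZ : z <= D + 19 / 10 * L / v * (A1 * E).
  apply: (le_trans zE); rewrite lerD2l ler_wpM2r// ler_pdivlMr// mulrC.
  by move: FL; lra.
have D0 : 0 <= D by apply: le_trans dD; exact: enorm_ge0.
have zz : z ^+ 2 <= (D + 19 / 10 * L / v * (A1 * E)) ^+ 2.
  by rewrite ler_sqr ?nnegrE// (le_trans z0).
have c10 : 0 <= 8 / 5 / (L * v) by rewrite divr_ge0 ?mulr_ge0 ?(ltW v0) ?(ltW L0)//; lra.
have k0 : 0 <= 69 / 10 :> R by lra.
have c20 : 0 <= 69 / 10 * (A1 * E) / v ^+ 2.
  by apply: divr_ge0 (sqr_ge0 _); exact: mulr_ge0.
have Y0 : 0 <= A1 * E * D / v ^+ 2 by apply: divr_ge0 (sqr_ge0 _); exact: mulr_ge0.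
have Z0 : 0 <= L * (A1 * E) ^+ 2 / v ^+ 3.
  by apply: divr_ge0; [apply: mulr_ge0 (ltW L0) (sqr_ge0 _)|apply/exprn_ge0/ltW].
have T1 := ler_wpM2l c10 zz.
have T2 := ler_wpM2l c20 zZ.
(* After inserting [zZ], the mixed coefficient is [2 (8/5) (19/10) + 69/10 = 12.98 < 13], and that
   of [(A1 E)^2] is [(8/5) (19/10)^2 + (69/10) (19/10) = 18.886 < 96/5]. *)
have main : 8 / 5 / (L * v) * z ^+ 2 + 4 * L * A2 / v ^+ 2 * E ^+ 2 +
    69 / 10 * (A1 * E) / v ^+ 2 * z <=
  2 * (4 / 5 / (L * v) * D ^+ 2 + 13 / 2 * A1 / v ^+ 2 * D * E +
  (48 / 5 * L * A1 ^+ 2 / v ^+ 3 + 2 * L * A2 / v ^+ 2) * E ^+ 2).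
  have E1 : 8 / 5 / (L * v) * (D + 19 / 10 * L / v * (A1 * E)) ^+ 2 =
    8 / 5 / (L * v) * D ^+ 2 + 8 / 5 * 2 * (19 / 10) * (A1 * E * D / v ^+ 2) +
    8 / 5 * (19 / 10) * (19 / 10) * (L * (A1 * E) ^+ 2 / v ^+ 3) by field; rewrite vn0 Ln0.
  have E2 : 69 / 10 * (A1 * E) / v ^+ 2 * (D + 19 / 10 * L / v * (A1 * E)) =
    69 / 10 * (A1 * E * D / v ^+ 2) + 69 / 10 * (19 / 10) * (L * (A1 * E) ^+ 2 / v ^+ 3).
    by field.
  have E3 : 2 * (4 / 5 / (L * v) * D ^+ 2 + 13 / 2 * A1 / v ^+ 2 * D * E +
    (48 / 5 * L * A1 ^+ 2 / v ^+ 3 + 2 * L * A2 / v ^+ 2) * E ^+ 2) =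
    8 / 5 / (L * v) * D ^+ 2 + 13 * (A1 * E * D / v ^+ 2) +
    96 / 5 * (L * (A1 * E) ^+ 2 / v ^+ 3) + 4 * L * A2 / v ^+ 2 * E ^+ 2.
    by field; rewrite vn0 Ln0.
  rewrite E3; move: T1 T2 Y0 Z0; rewrite E1 E2.
  move: (8 / 5 / (L * v) * z ^+ 2) (69 / 10 * (A1 * E) / v ^+ 2 * z).
  move: (8 / 5 / (L * v) * D ^+ 2) (A1 * E * D / v ^+ 2) (L * (A1 * E) ^+ 2 / v ^+ 3).
  by move: (4 * L * A2 / v ^+ 2 * E ^+ 2); clear; move=> *; lra.
apply: le_trans (ler_wpM2r (ltW r0) main).
have -> : (8 / 5 / (L * v) * z ^+ 2 + 4 * L * A2 / v ^+ 2 * E ^+ 2 +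
    69 / 10 * (A1 * E) / v ^+ 2 * z) * r =
  8 / 5 / (L * v) * z ^+ 2 * r + 4 * L * A2 / v ^+ 2 * E ^+ 2 * r +
    69 / 10 * (A1 * E * z / v ^+ 2 * r) by ring.
move: bound1 bound2 bound3.
move: (8 / 5 / (L * v) * z ^+ 2 * r) (4 * L * A2 / v ^+ 2 * E ^+ 2 * r).
move: (69 / 10 * (A1 * E * z / v ^+ 2 * r)) (F * s2) (2 * F1 * s1) (v ^+ 2 * F1 ^+ 2).
by clear; move=> *; lra.
Qed.

End SecondOrder.

(** * Taylor bound for the flight density along a segment *)

Section Taylor.
Context {R : realType} (v : R) (w : 'rV[R]_2 -> 'rV[R]_2).
Hypothesis w_C2 : twice_cont_diff w.
Implicit Types (F G : R -> 'rV[R]_2) (t : R).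

Lemma is_derive_scale (f : R -> R) G t (l : R) (m : 'rV[R]_2) :
  is_derive t 1 f l -> is_derive t 1 G m ->
  is_derive t 1 (fun s => f s *: G s) (f t *: m + l *: G t).
Proof.
move=> df dG.
have H i : is_derive t 1 (fun s => (f s *: G s) 0 i) ((f t *: m + l *: G t) 0 i).
  have -> : (fun s => (f s *: G s) 0 i) = (fun s => f s * G s 0 i).
    by apply/funext => s; rewrite mxE.
  by rewrite !mxE; apply: is_derive_mul => //; exact: is_derive_coord.
exact: is_derive_rV2.
Qed.

(** On the left, the quotient rule applied to the explicit root; on the right, [a f^2 + 2 b f = C]
    differentiated implicitly, which is the shape of [fdW1]. *)
Lemma quadratic_root_derive (a b C f rho a' b' C' : R) : a != 0 -> rho != 0 ->
  rho = a * f + b -> a * f ^+ 2 + 2 * b * f = C ->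
  (- b' + (b * b' + b' * b + (a * C' + a' * C)) / (2 * rho) - f * a') / a =
  (C' / 2 - b' * f - a' * f ^+ 2 / 2) / rho.
Proof.
move=> a0 r0 rE <-; have := r0; rewrite rE => abf; field.
by rewrite a0 abf.
Qed.

Section Line.
Variables (p e q d : 'rV[R]_2).
Let W s := w (p + s *: e).
Let W1 s : 'rV[R]_2 := 'd w (p + s *: e) e.
Let W2 s := second_deriv w (p + s *: e) e e.
Let Q s : 'rV[R]_2 := q + s *: d.

Let dW (s : R) : is_derive s 1 W (W1 s). Proof. exact: wind_line. Qed.
Let dW1 (s : R) : is_derive s 1 W1 (W2 s). Proof. exact: dwind_line. Qed.

Let dQ (s : R) : is_derive s 1 Q d.
Proof.
have ds := is_derive_scale (is_derive_id s (1 : R)) (is_derive_cst d s 1).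
have := is_deriveD (is_derive_cst q s 1) ds.
by rewrite scaler0 add0r scale1r add0r.
Qed.

Let F s := fdW v (W s) (Q s).
Let F1 s := fdW1 v (W s) (W1 s) (Q s) d.
Let F2 s := fdW2 v (W s) (W1 s) (W2 s) (Q s) d.

(** The explicit formula is differentiable since its radicand is positive; [quadratic_root_derive]
    brings the derivative into implicit form. *)
Let dF (s : R) : enorm (W s) < v -> Q s != 0 -> is_derive s 1 F (F1 s).
Proof.
move=> Wv Q0; have a0 := @slack_gt0 _ v (fun=> W s) 0 Wv.
have r0 := rhoW_gt0 Wv Q0.
have rho0 : 0 < dot (Q s) (W s) ^+ 2 + (v ^+ 2 - dot (W s) (W s)) * dot (Q s) (Q s).
  rewrite ltr_wpDl ?sqr_ge0// mulr_gt0// -enormX2 exprn_gt0// enorm_gt0//.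
have rhoE : Num.sqrt (dot (Q s) (W s) ^+ 2 + (v ^+ 2 - dot (W s) (W s)) * dot (Q s) (Q s))
   = rhoW v (W s) (Q s).
  by rewrite -(@fd_rho _ v (fun=> W s) 0 Wv).
have db := is_derive_dot (dQ s) (dW s).
have da := is_derive_sub (is_derive_cst (v ^+ 2) s 1) (is_derive_dot (dW s) (dW s)).
have dC := is_derive_dot (dQ s) (dQ s).
have dbb : is_derive s 1 (fun s => dot (Q s) (W s) ^+ 2)
    (dot (Q s) (W s) * (dot d (W s) + dot (Q s) (W1 s)) +
     (dot d (W s) + dot (Q s) (W1 s)) * dot (Q s) (W s)).
  have -> : (fun s => dot (Q s) (W s) ^+ 2) = (fun s => dot (Q s) (W s) * dot (Q s) (W s)).
    by apply/funext => t; rewrite expr2.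
  exact: is_derive_mul.
have dsq := is_derive_comp_sqrt (t := s) (f := fun s => dot (Q s) (W s) ^+ 2 +
  (v ^+ 2 - dot (W s) (W s)) * dot (Q s) (Q s)) rho0
  (is_derive_add dbb (is_derive_mul da dC)).
have dnum := is_derive_add (is_deriveN db) dsq.
have := @is_derive_div _ _ (fun s => v ^+ 2 - dot (W s) (W s)) s _ _
  (lt0r_neq0 a0) dnum da.
rewrite rhoE.
have -> : (- dot (Q s) (W s) + rhoW v (W s) (Q s)) / (v ^+ 2 - dot (W s) (W s)) =
    fdW v (W s) (Q s).
  rewrite /rhoW; field; exact: lt0r_neq0.
rewrite sub0r (quadratic_root_derive (C := dot (Q s) (Q s)) _ _ _
  (lt0r_neq0 a0) (lt0r_neq0 r0)) //; last first.
  by rewrite -[in RHS](@fd_quad _ v (fun=> W s) 0 Wv).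
suff -> : ((dot d (Q s) + dot (Q s) d) / 2 -
    (dot d (W s) + dot (Q s) (W1 s)) * fdW v (W s) (Q s) -
    - (dot (W1 s) (W s) + dot (W s) (W1 s)) * fdW v (W s) (Q s) ^+ 2 / 2) /
   rhoW v (W s) (Q s) = F1 s by [].
rewrite /F1 /fdW1; congr (_ / _); move: (fdW v (W s) (Q s)) (W s) (W1 s) (Q s).
by move=> f x x1 y; rewrite !dotE !mxE; field.
Qed.

Let dF1 (s : R) : enorm (W s) < v -> Q s != 0 -> is_derive s 1 F1 (F2 s).
Proof.
move=> Wv Q0; have dFs := dF Wv Q0.
have r0 := rhoW_gt0 Wv Q0.
have db := is_derive_dot (dQ s) (dW s).
have da := is_derive_sub (is_derive_cst (v ^+ 2) s 1) (is_derive_dot (dW s) (dW s)).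
have drho := is_derive_add (is_derive_mul da dFs) db.
have du := is_deriveB (dQ s) (is_derive_scale dFs (dW s)).
have dz := is_deriveB (is_derive_cst d s 1) (is_derive_scale dFs (dW1 s)).
have := @is_derive_div _ _ (fun s => rhoW v (W s) (Q s)) s _ _
  (lt0r_neq0 r0) (is_derive_dot du dz) drho.
suff -> : F2 s = (dot (d - (F s *: W1 s + F1 s *: W s)) (d - F s *: W1 s) +
     dot (Q s - F s *: W s) (0 - (F s *: W2 s + F1 s *: W1 s)) -
     dot (Q s - F s *: W s) (d - F s *: W1 s) / rhoW v (W s) (Q s) *
     (((v ^+ 2 - dot (W s) (W s)) * F1 s +
       (0 - (dot (W1 s) (W s) + dot (W s) (W1 s))) * F s) +
      (dot d (W s) + dot (Q s) (W1 s)))) / rhoW v (W s) (Q s) by [].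
rewrite -/(fdW1 v (W s) (W1 s) (Q s) d) -/(F1 s) /F2 /fdW2; congr (_ / _).
rewrite -/(F s) -/(F1 s); move: (F s) (F1 s) (W s) (W1 s) (W2 s) (Q s).
by move=> f f1 x x1 x2 y; rewrite !dotE !mxE; ring.
Qed.

(** Two mean value inequalities: [F2 <= 2 K] gives [F1 s - F1 0 <= 2 K s], so [F s - s F1 0 - K s^2]
    has nonpositive derivative. *)
Lemma fd_taylor (L A1 A2 : R) : 0 < v -> 0 < L -> 0 <= A1 -> 0 <= A2 ->
  (forall s : R, 0 <= s <= 1 ->
     [/\ enorm (w (p + s *: e)) <= 6 / 13 * v,
         49 / 50 * L <= enorm (q + s *: d) <= 51 / 50 * L,
         enorm ('d w (p + s *: e) e) <= A1 * enorm e
       & enorm (second_deriv w (p + s *: e) e e) <= A2 * enorm e ^+ 2]) ->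
  flight_density v w (p + e) (q + d) <= flight_density v w p q +
    fdW1 v (w p) ('d w p e) q d +
    (4 / 5 / (L * v) * enorm d ^+ 2 + 13 / 2 * A1 / v ^+ 2 * enorm d * enorm e
    + (48 / 5 * L * A1 ^+ 2 / v ^+ 3 + 2 * L * A2 / v ^+ 2) * enorm e ^+ 2).
Proof.
move=> v0 L0 A10 A20 H; set K := (X in _ <= _ + X).
have ok (s : R) : 0 <= s <= 1 -> enorm (W s) < v /\ Q s != 0.
  move=> /H[W6 /andP[Ql _] _ _]; split.
    by apply: (le_lt_trans W6); rewrite gtr_pMl//; lra.
  by rewrite -enorm_gt0; apply: lt_le_trans Ql; rewrite mulr_gt0//; lra.
have F2K (s : R) : 0 <= s <= 1 -> F2 s <= 2 * K.
  by move=> /H[W6 Qs W1s W2s]; apply: fdW2_le => //; exact: enorm_ge0.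
have F1K (s : R) : 0 <= s <= 1 -> F1 s - F1 0 <= 2 * K * s.
  move=> /andP[s0 s1]; apply: (mvt_le (df := F2)) => // t /andP[t0 ts].
    by have [] := ok t; [rewrite t0 (le_trans ts)|exact: dF1].
  by apply: F2K; rewrite t0 (le_trans ts).
have dG (s : R) : 0 <= s <= 1 -> is_derive s 1
    (fun s => F s - (s * F1 0 + K * (s * s))) (F1 s - (F1 0 + K * (s + s))).
  move=> /ok[Wv Q0]; have dFs := dF Wv Q0.
  have ds := is_derive_id s (1 : R).
  have := is_derive_sub dFs (is_derive_add (is_derive_mul ds (is_derive_cst (F1 0) s 1))
    (is_derive_mul (is_derive_cst K s 1) (is_derive_mul ds ds))).
  by rewrite mulr0 add0r !mul1r mul0r addr0 mulr1.
have F1le (s : R) : 0 <= s <= 1 -> F1 s - (F1 0 + K * (s + s)) <= 0.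
  by move=> /F1K; rewrite -[s + s]mulr2n mulrnAr -[(K * s) *+ 2]mulr_natl mulrA subr_le0 -lerBlDl.
have := mvt_le ler01 dG F1le.
rewrite mul0r !mul1r !mul0r mulr0 addr0 subr0 mulr1 subr_le0 lerBlDr.
have -> : F 1 = flight_density v w (p + e) (q + d) by rewrite /F /W /Q !scale1r.
have -> : F 0 = flight_density v w p q by rewrite /F /W /Q !scale0r !addr0.
have -> : F1 0 = fdW1 v (w p) ('d w p e) q d by rewrite /F1 /W /W1 /Q !scale0r !addr0.
by rewrite -addrA [leRHS]addrC.
Qed.

End Line.

End Taylor.

(** * Lipschitz paths and their flight duration *)

Section Paths.
Context {R : realType}.
Local Notation mu := (@lebesgue_measure R).
Local Notation abm := ae_bounded_measurable.
Implicit Types (xi : R -> 'rV[R]_2) (s t : R).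

(** Composition with [clamp] extends a path from [[0, 1]] to the whole line without increasing its
    Lipschitz constant. *)
Definition clamp t : R := Num.max 0 (Num.min t 1).

Lemma clamp01 t : 0 <= clamp t <= 1.
Proof. by rewrite /clamp le_max lexx ge_max ler01 ge_min lexx orbT. Qed.

Lemma clampE t : 0 <= t <= 1 -> clamp t = t.
Proof. by move=> /andP[t0 t1]; rewrite /clamp min_l// max_r. Qed.

Lemma clamp_lip s t : `|clamp t - clamp s| <= `|t - s|.
Proof.
wlog st : s t / s <= t.
  by move=> H; have [/H//|/ltW/H] := leP s t; rewrite distrC (distrC s).
rewrite [leRHS]ger0_norm ?subr_ge0// /clamp.
rewrite ler_norml; case: (leP t 1) => t1; case: (leP s 1) => s1.
- by case: (leP 0 t) => t0; case: (leP 0 s) => s0; apply/andP; split; lra.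
- by lra.
- by rewrite (max_r ler01); case: (leP 0 s) => s0; apply/andP; split; lra.
- by rewrite (max_r ler01) subrr; apply/andP; split; lra.
Qed.

(** The Euclidean counterpart of [[lipschitz ...]], which refers to the max norm, with an explicit
    constant. *)
Definition lip_path xi (K : R) := forall s t, 0 <= s <= 1 -> 0 <= t <= 1 ->
  enorm (xi t - xi s) <= K * `|t - s|.

Lemma lipschitz_lip_path xi : [lipschitz xi t | t in `[0, 1]] ->
  exists2 K, 0 <= K & lip_path xi K.
Proof.
move=> [M [_ HM]]; exists (2 * (`|M| + 1)); first by rewrite mulr_ge0// addr_ge0.
move=> s t s01 t01; apply: (le_trans (enorm_le_norm _)); rewrite -mulrA ler_pM2l//.
apply: (HM _ _ (t, s)); first by rewrite ltr_pwDr// ler_norm.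
by split => /=; rewrite in_itv/=.
Qed.

Lemma lip_path_lipschitz xi K : lip_path xi K -> [lipschitz xi t | t in `[0, 1]].
Proof.
move=> H; exists `|K|; split => [//|M KM [t s] [/= t01 s01]].
rewrite in_itv/= in t01; rewrite in_itv/= in s01.
apply: (le_trans (norm_le_enorm _)); apply: (le_trans (H _ _ s01 t01)).
by rewrite ler_wpM2r// (le_trans (ler_norm _))// ltW.
Qed.

Lemma in01_0 : 0 <= (0 : R) <= 1. Proof. by rewrite lexx ler01. Qed.
Lemma in01_1 : 0 <= (1 : R) <= 1. Proof. by rewrite lexx ler01. Qed.

Lemma lip_path_ge0 xi K : lip_path xi K -> 0 <= K.
Proof.
move=> H; have := H _ _ in01_0 in01_1; rewrite subr0 normr1 mulr1.
exact/le_trans/enorm_ge0.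
Qed.

Lemma ae_neq (a : R) : {ae mu, forall t, t != a}.
Proof.
exists [set a]; split => //; first exact: lebesgue_measure_set1.
by move=> x /= /negP; rewrite negbK => /eqP.
Qed.

Lemma ae_oo01 : {ae mu, forall t, t \in `[0, 1] -> 0 < t < 1}.
Proof.
apply: aeS (aeI (ae_neq 0) (ae_neq 1)) => t [t0 t1].
by rewrite in_itv/= !lt_neqAle t1 (eq_sym 0) t0.
Qed.

(** Each coordinate of the clamped path is Lipschitz on the line and has a density. Near an interior
    point clamping changes nothing, so the densities form the derivative of [xi] itself. *)
Lemma lip_path_derivative xi K : lip_path xi K -> exists H : R -> 'rV[R]_2,
  [/\ forall i, bounded_measurable (fun t => H t 0 i),
    forall s t i, 0 <= s -> s <= t -> t <= 1 ->
      xi t 0 i - xi s 0 i = \int[mu]_(x in `]s, t]) H x 0 i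
  & {ae mu, forall t, t \in `[0, 1] -> is_derive t 1 xi (H t)}].
Proof.
move=> xiK; have K0 := lip_path_ge0 xiK.
pose u i t := xi (clamp t) 0 i.
have uK i s t : `|u i t - u i s| <= K * `|t - s|.
  have := xiK _ _ (clamp01 s) (clamp01 t) => /(le_trans (coord_le_enorm _ i)).
  by rewrite !mxE => /le_trans; apply; rewrite ler_wpM2l// clamp_lip.
have [h0 [mh0 hK0 hI0 hd0]] := lipschitz_ae_density (uK 0) ltr01.
have [h1 [mh1 hK1 hI1 hd1]] := lipschitz_ae_density (uK 1) ltr01.
pose H t : 'rV[R]_2 := \row_j (if j == 0 then h0 t else h1 t).
have H0 t : H t 0 0 = h0 t by rewrite mxE.
have H1 t : H t 0 1 = h1 t by rewrite mxE.
have i01 (i : 'I_2) : i = 0 \/ i = 1.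
  by case: i => [[|[|//]] ?]; [left|right]; exact/val_inj.
exists H; split.
- move=> i; case: (i01 i) => ->.
    by under eq_fun do rewrite H0; split => //; exists K.
  by under eq_fun do rewrite H1; split => //; exists K.
- move=> s t i s0 st t1.
  have ct : clamp t = t by rewrite clampE// t1 (le_trans s0).
  have cs : clamp s = s by rewrite clampE// s0 (le_trans st).
  case: (i01 i) => ->.
    by under eq_Rintegral do rewrite H0; rewrite -hI0// /u ct cs.
  by under eq_Rintegral do rewrite H1; rewrite -hI1// /u ct cs.
- apply: aeS (aeI ae_oo01 (aeI hd0 hd1)) => t [+ [+ +]] t01 => /(_ t01) t01'.
  move=> /(_ t01') D0 /(_ t01') D1.
  have nt : \near t, xi (clamp t) = xi t.
    case/andP: t01' => t0 t1; near=> s; rewrite clampE//.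
    apply/andP; split; apply: ltW; near: s; [exact: lt_nbhsr|exact: lt_nbhsl].
  apply: is_derive_rV2; rewrite ?H0 ?H1.
    apply: near_eq_is_derive D0; apply: filterS nt => s.
    by rewrite /u => ->.
  apply: near_eq_is_derive D1; apply: filterS nt => s.
  by rewrite /u => ->.
Unshelve. all: by end_near. Qed.

Lemma is_derive_derive1 xi t (l : 'rV[R]_2) : is_derive t 1 xi l -> derive1 xi t = l.
Proof. by move=> d; rewrite derive1E derive_val. Qed.

Lemma bounded_on_ball (Phi : 'rV[R]_2 -> R) (r : R) : continuous Phi ->
  exists M, forall x, enorm x <= r -> `|Phi x| <= M.
Proof.
move=> cP; have cP' : continuous (fun x => Phi x *: e_ 0 : 'rV[R]_2).
  by move=> x; exact: (cvgZ (FF := nbhs_filter x) (cP x) (cvg_cst (e_ 0 : 'rV[R]_2))).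
have [M _ HM] := bounded_enorm r cP'; exists M => x /HM.
rewrite enormZ; have -> : enorm (e_ 0 : 'rV[R]_2) = 1.
  by rewrite /enorm dotE !mxE/= mulr1 mulr0 addr0 sqrtr1.
by rewrite mulr1.
Qed.

Lemma abm_path (Phi : 'rV[R]_2 -> R) xi K : continuous Phi -> lip_path xi K ->
  abm (fun t => Phi (xi t)).
Proof.
move=> cP xiK; have K0 := lip_path_ge0 xiK.
exists (fun t => Phi (xi (clamp t))); last first.
  by apply: aeW => t; rewrite in_itv/= => t01; rewrite clampE.
split.
  apply: continuous_measurable_fun => t.
  apply: (@continuous_comp _ _ _ (xi \o clamp) Phi); last exact: cP.
  apply/cvgrPdist_le => e e0.
  have K1 : 0 < K + 1 by rewrite ltr_wpDl.
  have : \forall s \near t, `|t - s| <= e / (K + 1).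
    by apply/nbhs_ballP; exists (e / (K + 1)); [exact: divr_gt0|move=> s /ltW].
  apply: filterS => s ts; apply: (le_trans (norm_le_enorm _)).
  apply: (le_trans (xiK _ _ (clamp01 s) (clamp01 t))).
  apply: (@le_trans _ _ ((K + 1) * (e / (K + 1)))).
    by rewrite ler_pM// ?lerDl// (le_trans (clamp_lip _ _)).
  by rewrite mulrCA divff ?mulr1// gt_eqF.
have [M HM] := bounded_on_ball (enorm (xi 0) + K) cP.
exists M => t; apply: HM.
have := xiK _ _ in01_0 (clamp01 t); rewrite subr0 => h.
rewrite -[xi (clamp t)](subrK (xi 0)) (le_trans (enormD _ _))// addrC lerD2l.
apply: (le_trans h); rewrite ler_piMr//.
by case/andP: (clamp01 t) => c0 c1; rewrite ger0_norm.
Qed.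

End Paths.

(** * Reparametrization by elapsed flight time *)

Section Reparametrization.
Context {R : realType} (v c : R) (w : 'rV[R]_2 -> 'rV[R]_2).
Hypothesis w_cont : continuous w.
Hypotheses (cv : 0 <= c < v) (wc : forall p, enorm (w p) <= c).
Local Notation mu := (@lebesgue_measure R).
Local Notation abm := ae_bounded_measurable.
Local Notation bm := bounded_measurable.
Implicit Types (xi : R -> 'rV[R]_2) (s t : R).

Let wv p : enorm (w p) < v.
Proof. by apply: (le_lt_trans (wc p)); case/andP: cv. Qed.

Lemma abm_dot (F G : R -> 'rV[R]_2) : (forall i, abm (fun t => F t 0 i)) ->
  (forall i, abm (fun t => G t 0 i)) -> abm (fun t => dot (F t) (G t)).
Proof.
move=> mF mG; rewrite (_ : (fun t => _) = fun t => F t 0 0 * G t 0 0 + F t 0 1 * G t 0 1).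
  by apply: abmD; exact: abmM.
by apply/funext => t; rewrite dotE.
Qed.

Lemma continuous_coord (Phi : 'rV[R]_2 -> 'rV[R]_2) i : continuous Phi ->
  continuous (fun p => Phi p 0 i).
Proof.
move=> cP p; apply: (@continuous_comp _ _ _ Phi (fun x : 'rV[R]_2 => x 0 i)).
  exact: cP.
exact: coord_continuous.
Qed.

Lemma continuous_enorm2 (Phi : 'rV[R]_2 -> 'rV[R]_2) : continuous Phi ->
  continuous (fun p => enorm (Phi p)).
Proof.
move=> cP p; apply: (@continuous_comp _ _ _ Phi (@enorm R)); first exact: cP.
exact: continuous_enorm.
Qed.

Lemma slack_continuous : continuous (fun p => v ^+ 2 - dot (w p) (w p)).
Proof.
rewrite (_ : (fun p => _) = fun p => v ^+ 2 - enorm (w p) * enorm (w p)); last first.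
  by apply/funext => p; rewrite -expr2 enormX2.
move=> p; apply: (cvgB (FF := nbhs_filter p)); first exact: cvg_cst.
by apply: (cvgM (FF := nbhs_filter p)); exact: continuous_enorm2.
Qed.

Lemma fd_abm xi K (H : R -> 'rV[R]_2) : lip_path xi K ->
  (forall i, bm (fun t => H t 0 i)) ->
  abm (fun t => flight_density v w (xi t) (H t)).
Proof.
move=> xiK mH; have aH i : abm (fun t => H t 0 i) by exact: bm_abm.
have aw i : abm (fun t => w (xi t) 0 i).
  by apply: (@abm_path _ (fun p => w p 0 i) _ K _ xiK); exact: continuous_coord.
have ai : abm (fun t => (v ^+ 2 - dot (w (xi t)) (w (xi t)))^-1).
  apply: (@abm_path _ (fun p => (v ^+ 2 - dot (w p) (w p))^-1) _ K _ xiK) => p.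
  apply: (cvgV (FF := nbhs_filter p)); last exact: slack_continuous.
  by rewrite gt_eqF// slack_gt0.
rewrite /flight_density; apply: abmM ai; apply: abmD.
  by apply: abmN; exact: abm_dot.
apply: abm_sqrt; apply: abmD; first by apply: abmX2; exact: abm_dot.
apply: abmM; last exact: abm_dot.
by apply: abmD; [exact: abm_cst|apply: abmN; exact: abm_dot].
Qed.

Lemma flight_duration_abm xi K : lip_path xi K ->
  abm (fun t => flight_density v w (xi t) (derive1 xi t)).
Proof.
move=> xiK; have [H [mH _ dH]] := lip_path_derivative xiK.
apply: abm_ae (fd_abm xiK mH); apply: aeS dH => t + t01 => /(_ t01) d.
by rewrite (is_derive_derive1 d).
Qed.

(** Replacing [f] by the minimum of [f] and [g], equal to it almost everywhere on the interval,
    turns the hypothesis into a pointwise inequality. *)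
Lemma bm_int_le f g s t : bm f -> bm g ->
  {ae mu, forall x, s < x <= t -> f x <= g x} ->
  \int[mu]_(x in `]s, t]) f x <= \int[mu]_(x in `]s, t]) g x.
Proof.
move=> bf bg fg; have bfg : bm (fun x => Num.min (f x) (g x)).
  case: bf => mf [K fK]; case: bg => mg [M gM]; split; first exact: measurable_minr.
  exists (Num.max K M) => x; rewrite le_max.
  by case: (leP (f x) (g x)) => _; [rewrite fK|rewrite gM orbT].
rewrite (@ae_Rintegral_congr _ _ f (fun x => Num.min (f x) (g x))).
  apply: le_Rintegral => //; [exact: bm_integrable_itv..|].
  by move=> x _; rewrite ge_min lexx orbT.
by apply: aeS fg => x + /=; rewrite in_itv/= => /[apply] h; rewrite min_l.
Qed.

Lemma bm_intZ k f s t : bm f ->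
  \int[mu]_(x in `]s, t]) (k * f x) = k * \int[mu]_(x in `]s, t]) f x.
Proof. by move=> bf; apply: RintegralZl => //; exact: bm_integrable_itv. Qed.

Lemma bm_intB f s t : bm f -> 0 <= s -> s <= t ->
  \int[mu]_(x in `]0, t]) f x - \int[mu]_(x in `]0, s]) f x =
  \int[mu]_(x in `]s, t]) f x.
Proof.
move=> bf s0 st; apply: Rintegral_itvB; [exact: bm_integrable_itv|..];
  by rewrite bnd_simp.
Qed.

(* The inclusion |xi' - M w(xi)| <= v M, which says that [xi] flies the whole way
   in time M at constant rate, integrated over [s, t] up to a second order error.
   In this form it passes to pointwise limits. *)
Definition adm xO xD (K M : R) xi := [/\ xi 0 = xO, xi 1 = xD &
  forall s t, 0 <= s -> s <= t -> t <= 1 ->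
    enorm (xi t - xi s) <= 2 * v * (M * (t - s)) /\
    enorm (xi t - xi s - (M * (t - s)) *: w (xi s)) <=
      M * (t - s) * (v + K * (M * (t - s)))].

Section Path.
Variables (xi : R -> 'rV[R]_2) (K : R) (H : R -> 'rV[R]_2) (f : R -> R).
Hypotheses (xiK : lip_path xi K) (mH : forall i, bm (fun t => H t 0 i)).
Hypothesis xiI : forall s t i, 0 <= s -> s <= t -> t <= 1 ->
      xi t 0 i - xi s 0 i = \int[mu]_(x in `]s, t]) H x 0 i.
Hypotheses (bf : bm f)
  (fE : {ae mu, forall t, t \in `[0, 1] -> flight_density v w (xi t) (H t) = f t}).

(** The flight time elapsed up to [t]. *)
Let sigma t := \int[mu]_(x in `]0, t]) f x.

Let dual_int n s t : 0 <= s -> s <= t -> t <= 1 ->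
  dot n (xi t - xi s) = \int[mu]_(x in `]s, t]) dot n (H x).
Proof.
move=> s0 st t1; have nH i : bm (fun x => n 0 i * H x 0 i) by apply: bmM (bm_cst _) _.
rewrite (_ : \int[mu]_(x in `]s, t]) dot n (H x) =
  \int[mu]_(x in `]s, t]) (n 0 0 * H x 0 0 + n 0 1 * H x 0 1)); last first.
  by apply: eq_Rintegral => x _; rewrite dotE.
rewrite RintegralD//; [|exact: bm_integrable_itv..].
rewrite !bm_intZ// -!xiI//.
by rewrite dotE !mxE.
Qed.

Let bmn n : bm (fun x => dot n (H x)).
Proof.
rewrite (_ : (fun x => _) = fun x => n 0 0 * H x 0 0 + n 0 1 * H x 0 1).
  by apply: bmD; apply: bmM (bm_cst _) _.
by apply/funext => x; rewrite dotE.
Qed.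

(** [fd_dual] integrated over [[s, t]], with the factor [v + n.w] replaced by an upper bound. *)
Let fdual (m : R) n s t : enorm n = 1 -> 0 <= s -> s <= t -> t <= 1 ->
  (forall x, s <= x <= t -> v + dot n (w (xi x)) <= m) ->
  dot n (xi t - xi s) <= m * (sigma t - sigma s).
Proof.
move=> n1 s0 st t1 Hm; rewrite dual_int// bm_intB// -bm_intZ//.
apply: bm_int_le; [exact: bmn|by apply: bmM => //; exact: bm_cst|].
apply: aeS fE => x + /andP[sx xt].
rewrite in_itv/= (le_trans s0 (ltW sx)) (le_trans xt t1) => /(_ isT) <-.
apply: (le_trans (fd_dual (wv (xi x)) _ n1)); rewrite mulrC ler_wpM2r ?fd_ge0//.
by apply: Hm; rewrite (ltW sx).
Qed.

Let sigma_le s t : 0 <= s -> s <= t -> t <= 1 -> sigma s <= sigma t.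
Proof.
move=> s0 st t1; rewrite -subr_ge0 bm_intB//.
have -> : 0 = \int[mu]_(x in `]s, t]) (0 * f x) by rewrite bm_intZ// mul0r.
apply: bm_int_le => //; first by apply: bmM => //; exact: bm_cst.
apply: aeS fE => x + /andP[sx xt].
rewrite in_itv/= (le_trans s0 (ltW sx)) (le_trans xt t1) mul0r => /(_ isT) <-.
exact: fd_ge0.
Qed.

Let sigma_speed s t : 0 <= s -> s <= t -> t <= 1 ->
  enorm (xi t - xi s) <= 2 * v * (sigma t - sigma s).
Proof.
move=> s0 st t1; have v0 : 0 <= v by case/andP: cv => ? /ltW; exact: le_trans.
apply: enorm_dual; last by rewrite !mulr_ge0// subr_ge0 sigma_le.
move=> n n1; apply: fdual => // x _.
have := dot_le n (w (xi x)); rewrite n1 mul1r; have := wv (xi x).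
by move: (enorm (w (xi x))) (dot n (w (xi x))) => *; lra.
Qed.

Let sigma0 : sigma 0 = 0.
Proof. by rewrite /sigma set_itvoc0 Rintegral_set0. Qed.

(** Over [[s, t]] the point moves by at most [2 v (sigma t - sigma s)], so the wind changes by at
    most [Kw] times as much: this is the origin of [2 v Kw]. The bound [M0] keeps the path in the
    ball where [Kw] is valid. *)
Lemma adm_reparametrization (Kw M0 : R) : 0 <= Kw -> xi 0 <> xi 1 ->
  \int[mu]_(x in `]0, 1]) f x <= M0 ->
  (forall x y, enorm x <= enorm (xi 0) + 2 * v * M0 ->
               enorm y <= enorm (xi 0) + 2 * v * M0 ->
     enorm (w y - w x) <= Kw * enorm (y - x)) ->
  exists g, adm (xi 0) (xi 1) (2 * v * Kw) (\int[mu]_(x in `]0, 1]) f x) g.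
Proof.
rewrite -/(sigma 1) => Kw0 xi01 sM HKw.
have v0 : 0 <= v by case/andP: cv => ? /ltW; exact: le_trans.
have ball t : 0 <= t -> t <= 1 -> enorm (xi t) <= enorm (xi 0) + 2 * v * M0.
  move=> t0 t1; rewrite -[xi t](subrK (xi 0)) (le_trans (enormD _ _))// addrC lerD2l.
  rewrite (le_trans (sigma_speed _ _ _))// sigma0 subr0 ler_wpM2l ?mulr_ge0//.
  by rewrite (le_trans _ sM)// sigma_le.
have wind s t : 0 <= s -> s <= t -> t <= 1 ->
    enorm (xi t - xi s - (sigma t - sigma s) *: w (xi s)) <=
    (sigma t - sigma s) * (v + 2 * v * Kw * (sigma t - sigma s)).
  move=> s0 st t1; have th0 : 0 <= sigma t - sigma s by rewrite subr_ge0 sigma_le.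
  apply: enorm_dual; last by rewrite mulr_ge0// addr_ge0// !mulr_ge0.
  move=> n n1; rewrite dotDr dotNr dotZr lerBlDr -mulrDr mulrC.
  apply: fdual => // x /andP[sx xt]; rewrite addrAC -addrA lerD2l.
  have := dot_le n (w (xi x) - w (xi s)); rewrite n1 mul1r dotDr dotNr => h1.
  have h2 : enorm (w (xi x) - w (xi s)) <= Kw * (2 * v * (sigma t - sigma s)).
    apply: (le_trans (HKw _ _ _ _)).
    - by apply: ball => //; exact: le_trans t1.
    - by apply: ball; [exact: le_trans sx|exact: le_trans t1].
    rewrite ler_wpM2l// (le_trans (sigma_speed s0 sx (le_trans xt t1)))//.
    rewrite ler_wpM2l ?mulr_ge0// lerD2r sigma_le//; exact: le_trans sx.
  rewrite (mulrC _ Kw) -mulrA; move: h1 h2.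
  move: (enorm _) (dot n _) (dot n _) (Kw * _) => *; lra.
have s1 : 0 < sigma 1.
  have := sigma_speed (lexx 0) ler01 (lexx 1); rewrite sigma0 subr0 => h.
  rewrite lt_neqAle -{2}sigma0 sigma_le// andbT; apply/eqP => s10.
  move: h; rewrite -s10 mulr0 => h; apply: xi01; apply/esym/eqP.
  by rewrite -subr_eq0 -enorm_eq0 eq_le h enorm_ge0.
have scont : {within `[0, 1], continuous sigma}.
  have := @parameterized_integral_continuous _ 0 1 f ler01 (bm_integrable_itv true false 0 1 bf).
  rewrite (_ : (fun x => _) = sigma)//; apply/funext => t; rewrite /sigma.
  by apply/esym/Rintegral_itv_obnd_cbnd; exact: bm_integrable_itv.
(* [sigma] may be constant on intervals, so [tau] is merely a chosen right inverse of
   [sigma / sigma 1], perhaps discontinuous. The two implications prescribe it at the endpoints,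
   where the path must start and end. *)
have /choice[tau tauP] : forall x : R, exists y, 0 <= x <= 1 -> [/\ 0 <= y <= 1,
    sigma y = sigma 1 * x, x = 0 -> y = 0 & x = 1 -> y = 1].
  move=> x.
  have [->|x0] := eqVneq x 0.
    exists 0 => _; split => //; first exact: in01_0; by rewrite sigma0 mulr0.
  have [->|x1] := eqVneq x 1.
    exists 1 => _; split => //; first exact: in01_1; by rewrite mulr1.
  have [x01|] := boolP (0 <= x <= 1); last by exists 0.
  have [|y] := @IVT _ sigma 0 1 (sigma 1 * x) ler01 scont.
    rewrite sigma0 min_l ?(ltW s1)// max_r ?(ltW s1)//.
    case/andP: x01 => ? ?; rewrite mulr_ge0 ?(ltW s1)//=.
    by rewrite ler_piMr// ltW.
  rewrite in_itv/= => y01 sy; exists y => _; split => //.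
    by move=> xx; rewrite xx eqxx in x0.
  by move=> xx; rewrite xx eqxx in x1.
exists (fun x => xi (tau x)); split.
- by have [_ _ h _] := tauP _ in01_0; rewrite h.
- by have [_ _ _ h] := tauP _ in01_1; rewrite h.
- move=> s t s0 st t1.
  have s01 : 0 <= s <= 1 by rewrite s0 (le_trans st).
  have t01 : 0 <= t <= 1 by rewrite t1 (le_trans s0).
  have [/andP[ts0 ts1] ss _ _] := tauP s s01.
  have [/andP[tt0 tt1] st' _ _] := tauP t t01.
  have E : sigma 1 * (t - s) = sigma (tau t) - sigma (tau s) by rewrite ss st' mulrBr.
  have tst : tau s <= tau t.
    have [->//|nst] := eqVneq s t.
    rewrite leNgt; apply/negP => /ltW /(sigma_le tt0) /(_ ts1).
    by rewrite ss st' ler_pM2l// leNgt lt_neqAle nst st.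
  by rewrite E; split; [exact: sigma_speed|exact: wind].
Qed.

End Path.
End Reparametrization.

(** * Existence of a fastest path *)

(** A cluster point of the image filter is a limit: for a neighbourhood [N] of it, the ultrafilter
    contains the preimage of [N] or of its complement, and the latter contradicts clustering. *)
Lemma ultra_cvg_compact {I : Type} {T : topologicalType} (U : set_system I)
    (A : set T) (f : I -> T) : UltraFilter U -> compact A -> (forall i, A (f i)) ->
  exists p : T, f @ U --> p.
Proof.
move=> UU cA Af; have PU : ProperFilter U := ultra_proper.
have FA : fmap f U A by apply: (@filterS _ U _ setT); [move=> i _; exact: Af|exact: filterT].
have [p [Ap clp]] := cA (fmap f U) _ FA; exists p => N Np /=.
have [//|UC] := in_ultra_setVsetC (f @^-1` N) UU.
have : (fmap f U) (~` N) by [].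
by move=> /clp /(_ Np) [x [/= nNx Nx]].
Qed.

Section Existence.
Context {R : realType} (v c : R) (w : 'rV[R]_2 -> 'rV[R]_2).
Hypothesis w_cont : continuous w.
Hypotheses (cv : 0 <= c < v) (wc : forall p, enorm (w p) <= c).
Variables (xO xD : 'rV[R]_2) (K M0 : R).
Hypotheses (K0 : 0 <= K).

Let v0 : 0 < v. Proof. by case/andP: cv; exact: le_lt_trans. Qed.

(** A wind of at most [c] leaves a ground speed of at least [v - c] in every direction. *)
Lemma adm_line : (enorm (xD - xO) <= (v - c) * M0) ->
  adm v w xO xD K M0 (fun t => xO + t *: (xD - xO)).
Proof.
case/andP: cv => c0 cv' xM.
have M00 : 0 <= M0.
  by rewrite -(pmulr_rge0 _ (_ : 0 < v - c)) ?subr_gt0// (le_trans (enorm_ge0 _) xM).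
split; rewrite ?scale0r ?addr0 ?scale1r ?[xO + _]addrC ?subrK//.
move=> s t s0 st t1.
have -> : xO + t *: (xD - xO) - (xO + s *: (xD - xO)) = (t - s) *: (xD - xO).
  by rewrite opprD addrACA subrr add0r -scalerBl.
have ts : 0 <= t - s by rewrite subr_ge0.
have h : (t - s) * enorm (xD - xO) <= (t - s) * ((v - c) * M0) by rewrite ler_wpM2l.
have tM : 0 <= (t - s) * M0 by rewrite mulr_ge0.
have tMc : 0 <= (t - s) * M0 * c by rewrite mulr_ge0.
have tMv : 0 <= (t - s) * M0 * v by rewrite mulr_ge0// ltW.
rewrite enormZ (ger0_norm ts); split.
  apply: (le_trans h); move: tMc tMv; lra.
apply: (le_trans (enormB _ _)); rewrite !enormZ (ger0_norm ts) ger0_norm ?mulr_ge0//.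
have h2 : M0 * (t - s) * enorm (w (xO + s *: (xD - xO))) <= M0 * (t - s) * c.
  by rewrite ler_wpM2l// mulr_ge0.
have h3 : 0 <= M0 * (t - s) * (K * (M0 * (t - s))) by rewrite !mulr_ge0.
have E : (t - s) * ((v - c) * M0) + M0 * (t - s) * c = M0 * (t - s) * v by ring.
by apply: (le_trans (lerD h h2)); rewrite E (mulrDr (M0 * (t - s))) lerDl.
Qed.

(* The limit is taken pointwise along an ultrafilter. *)
Lemma adm_limit (D : R) : 0 <= D -> D <= M0 ->
  (forall e, 0 < e -> exists M g, [/\ D <= M, M < D + e, M <= M0 & adm v w xO xD K M g]) ->
  exists g, adm v w xO xD K D g.
Proof.
move=> D0 DM H.
have /choice[Mg MgP] : forall n : nat, exists Mg : R * (R -> 'rV[R]_2),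
    [/\ D <= Mg.1, Mg.1 < D + n.+1%:R^-1, Mg.1 <= M0 & adm v w xO xD K Mg.1 Mg.2].
  move=> n; have [|M [g Mg]] := H (n.+1%:R^-1); first by rewrite invr_gt0.
  by exists (M, g).
(* Clamping keeps the values at all real [t] in one box, so that a limit can be chosen for each of
   them. *)
pose g n t := (Mg n).2 (clamp t).
have [U [UU FU]] : exists U, UltraFilter U /\ (\oo : set_system nat) `<=` U.
  exact: ultraFilterLemma.
have PU : ProperFilter U := ultra_proper.
have MD : (fun n => (Mg n).1) @ U --> D.
  apply: (@cvg_trans _ ((fun n => (Mg n).1) @ \oo)).
    by move=> A /= FA; exact: FU.
  apply/cvgrPdist_le => e e0; near=> n.
  have [D1 D2 _ _] := MgP n; rewrite distrC ger0_norm ?subr_ge0// lerBlDl.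
  rewrite (le_trans (ltW D2))// lerD2l ltW//; near: n.
  exact: (near_infty_natSinv_lt (PosNum e0)).
have gbox n t : forall i, `|g n t 0 i| <= enorm xO + 2 * v * M0.
  move=> i; apply: (le_trans (coord_le_enorm _ _)); rewrite /g.
  have [D1 D2 D3 [g0 g1 /(_ 0 (clamp t) (lexx _))]] := MgP n.
  case/andP: (clamp01 t) => c0 c1 => /(_ c0 c1)[+ _].
  rewrite g0 subr0 => h; rewrite -[(Mg n).2 _](subrK xO) (le_trans (enormD _ _))//.
  rewrite addrC lerD2l (le_trans h)// ler_wpM2l ?mulr_ge0 ?(ltW v0)//.
  have M1 : 0 <= (Mg n).1 by exact: le_trans D1.
  by rewrite (le_trans _ D3)// ler_piMr.
have /choice[l lP] : forall t, exists p : 'rV[R]_2, g ^~ t @ U --> p.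
  move=> t; apply: (@ultra_cvg_compact _ _ U _ (g ^~ t) UU
    (compact_box (r := enorm xO + 2 * v * M0))) => n i; exact: gbox.
have cvg_enorm (a : nat -> 'rV[R]_2) b : a @ U --> b -> (fun n => enorm (a n)) @ U --> enorm b.
  by move=> ab; apply: continuous_cvg ab; exact: continuous_enorm.
have lend t p : t = 0 \/ t = 1 -> (forall n, g n t = p) -> l t = p.
  move=> _ gp; have := lP t; rewrite (_ : g ^~ t = fun=> p); last exact/funext.
  move=> h; apply: (cvg_unique (@norm_hausdorff _ _) h).
  exact: cvg_cst.
exists l; split.
- apply: lend; first by left.
  by move=> n; rewrite /g clampE ?in01_0//; have [_ _ _ []] := MgP n.
- apply: lend; first by right.
  by move=> n; rewrite /g clampE ?in01_1//; have [_ _ _ []] := MgP n.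
move=> s t s0 st t1.
have Et : clamp t = t by rewrite clampE// t1 (le_trans s0).
have Es : clamp s = s by rewrite clampE// s0 (le_trans st).
have gts : (fun n => g n t - g n s) @ U --> l t - l s by apply: cvgB; exact: lP.
have Mts : (fun n => (Mg n).1 * (t - s)) @ U --> D * (t - s).
  by apply: cvgM => //; exact: cvg_cst.
have gw : (fun n => w (g n s)) @ U --> w (l s) by apply: continuous_cvg (lP s); exact: w_cont.
split.
  apply: (ler_cvg_to (cvg_enorm _ _ gts) (cvgM (cvg_cst (2 * v)) Mts)).
  apply: nearW => n; rewrite /g Et Es; have [_ _ _ [_ _ /(_ s t s0 st t1)[]]] := MgP n.
  by [].
apply: (ler_cvg_to (cvg_enorm _ _ (cvgB gts (cvgZ Mts gw)))
  (cvgM Mts (cvgD (cvg_cst v) (cvgM (cvg_cst K) Mts)))).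
apply: nearW => n; rewrite /g Et Es; have [_ _ _ [_ _ /(_ s t s0 st t1)[]]] := MgP n.
by [].
Unshelve. all: by end_near. Qed.

(** The restriction to [M <= M0] keeps all competitors in one bounded set, as [adm_limit] requires,
    and [adm_line] provides a competitor. *)
Lemma adm_minimum : enorm (xD - xO) <= (v - c) * M0 ->
  exists D g, [/\ 0 <= D <= M0, adm v w xO xD K D g &
    forall M g', 0 <= M <= M0 -> adm v w xO xD K M g' -> D <= M].
Proof.
move=> xM; have M00 : 0 <= M0.
  case/andP: cv => _ cv'.
  by rewrite -(pmulr_rge0 _ (_ : 0 < v - c)) ?subr_gt0// (le_trans (enorm_ge0 _) xM).
pose S := [set M | 0 <= M <= M0 /\ exists g, adm v w xO xD K M g].
have SM0 : S M0.
  by split; [rewrite M00 lexx|exists (fun t => xO + t *: (xD - xO)); exact: adm_line].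
have lbS : has_lbound S by exists 0 => M [/andP[]].
have infS : has_inf S by split => //; exists M0.
have DM0 : inf S <= M0 by exact: ge_inf.
have D0 : 0 <= inf S by apply: lb_le_inf; [exists M0|move=> M [/andP[]]].
have [|g gD] := adm_limit D0 DM0.
  move=> e e0; have [M [/andP[M1 M2] [g ag]] Me] := inf_adherent e0 infS.
  exists M, g; split => //; apply: ge_inf => //; split; first by rewrite M1.
  by exists g.
exists (inf S), g; split => //; first by rewrite D0.
by move=> M g' M01 ag; apply: ge_inf => //; split => //; exists g'.
Qed.

End Existence.

(** * Approximation by paths of constant speed *)

Section UnitSpeed.
Context {R : realType} (v : R) (w : 'rV[R]_2 -> 'rV[R]_2) (Om : set 'rV[R]_2).
Implicit Types (x y z : 'rV[R]_2) (P : R -> 'rV[R]_2) (s t l M : R).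

Lemma is_derive_shift {V : normedModType R} (f : R -> V) (a t : R) (d : V) :
  is_derive (t - a) 1 f d -> is_derive t 1 (fun s => f (s - a)) d.
Proof.
move=> /is_derive1P H; apply/is_derive1P.
by under eq_fun do rewrite -addrA.
Qed.

Lemma is_derive_dilate (f : R -> 'rV[R]_2) (l t : R) (d : 'rV[R]_2) :
  is_derive (l * t) 1 f d -> is_derive t 1 (fun s => f (l * s)) (l *: d).
Proof.
move=> df; have lt : is_derive t 1 (fun s => l * s) l.
  have := is_derive_mul (is_derive_cst l t 1) (is_derive_id t (1 : R)).
  by rewrite mulr1 mul0r addr0.
apply: is_derive_rV2; rewrite !mxE.
  by have := is_derive1_comp (is_derive_coord 0 df) lt; rewrite mulrC.
by have := is_derive1_comp (is_derive_coord 1 df) lt; rewrite mulrC.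
Qed.

(* A path of unit speed on [0, l], together with a clock [m] that runs at least
   as fast as the flight along the path, away from finitely many corners. *)
Definition unit_path x y l M := exists P (m : R -> R) B (bad : seq R),
  [/\ [/\ P 0 = x, P l = y, m 0 = 0 & m l = M],
    [/\ 0 <= l, 0 <= B & forall t, 0 <= t <= l -> Om (P t)],
    forall s t, 0 <= s <= l -> 0 <= t <= l ->
      enorm (P t - P s) <= `|t - s| /\ `|m t - m s| <= B * `|t - s|
  & forall t, 0 < t < l -> t \notin bad -> exists p' m',
      [/\ is_derive t 1 P p', is_derive t 1 m m', enorm p' = 1, 0 <= m' &
        enorm (p' - m' *: w (P t)) <= v * m']].

Lemma unit_path0 x : Om x -> unit_path x x 0 0.
Proof.
move=> Ox; exists (fun=> x), (fun=> 0), 0, [::]; split => //.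
  by move=> s t _ _; rewrite !subrr enorm0 normr0 mul0r.
by move=> t /andP[t0 /(lt_trans t0)]; rewrite ltxx.
Qed.

(** The clock runs at the constant rate [tau / |D|]; the hypothesis says that at every point of the
    segment this is slow enough for the wind there. *)
Lemma unit_path_segment x (D : 'rV[R]_2) (tau : R) : 0 <= tau -> D != 0 ->
  (forall s, 0 <= s <= 1 -> Om (x + s *: D) /\
     enorm (D - tau *: w (x + s *: D)) <= v * tau) ->
  unit_path x (x + D) (enorm D) tau.
Proof.
move=> tau0 D0 H; have e0 : 0 < enorm D by rewrite enorm_gt0.
have ei0 : 0 <= (enorm D)^-1 by rewrite invr_ge0 ltW.
exists (fun s => x + (s / enorm D) *: D), (fun s => tau / enorm D * s),
  (tau / enorm D), [::].
have in01 t : 0 <= t <= enorm D -> 0 <= t / enorm D <= 1.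
  by move=> /andP[t0 t1]; rewrite divr_ge0 ?(ltW e0)//= ler_pdivrMr// mul1r.
split.
- by rewrite mul0r scale0r addr0 divff ?gt_eqF// scale1r mulr0 divfK ?gt_eqF.
- split; [exact: ltW|exact: divr_ge0 (ltW e0)|].
  by move=> t /in01 /H [].
- move=> s t _ _.
  rewrite opprD addrACA subrr add0r -scalerBl -mulrBl enormZ normrM.
  rewrite (ger0_norm ei0) divfK ?gt_eqF//; split => //.
  by rewrite -mulrBr normrM (ger0_norm (divr_ge0 tau0 (ltW e0))).
move=> t /andP[t0 t1] _; exists ((enorm D)^-1 *: D), (tau / enorm D).
have dt := is_derive_id t (1 : R).
split.
- have -> : (fun s => x + (s / enorm D) *: D) = (fun s => (s / enorm D) *: D + x).
    by apply/funext => s; rewrite addrC.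
  have dsc : is_derive t 1 (fun s => s / enorm D) ((enorm D)^-1).
    have := is_derive_mul dt (is_derive_cst (enorm D)^-1 t 1).
    by rewrite mulr0 mul1r add0r.
  have := is_deriveD (is_derive_scale dsc (is_derive_cst D t 1)) (is_derive_cst x t 1).
  by rewrite scaler0 add0r addr0.
- have := is_derive_mul (is_derive_cst (tau / enorm D) t 1) dt.
  by rewrite mulr1 mul0r addr0.
- by rewrite enormZ (ger0_norm ei0) mulVf// gt_eqF.
- exact: divr_ge0 (ltW e0).
have /H[_ h] : 0 <= t / enorm D <= 1 by apply: in01; rewrite !ltW.
rewrite (mulrC tau).
have -> z : ((enorm D)^-1 * tau) *: z = (enorm D)^-1 *: (tau *: z) by rewrite scalerA.
by rewrite -scalerBr enormZ (ger0_norm ei0) mulrCA ler_wpM2l.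
Qed.

Lemma unit_path_cat x y z l M l' M' :
  unit_path x y l M -> unit_path y z l' M' -> unit_path x z (l + l') (M + M').
Proof.
move=> [P [m [B [bad [[P0 Pl m0 ml] [l0 B0 OP] lipP derP]]]]].
move=> [P' [m' [B' [bad' [[P'0 P'l m'0 m'l] [l'0 B'0 OP'] lipP' derP']]]]].
pose Q s := if s <= l then P s else P' (s - l).
pose q s := if s <= l then m s else M + m' (s - l).
have QE' s : l <= s -> Q s = P' (s - l).
  rewrite /Q; case: ltgtP => // <- _; by rewrite subrr P'0 Pl.
have qE' s : l <= s -> q s = M + m' (s - l).
  rewrite /q; case: ltgtP => // <- _; by rewrite subrr m'0 ml addr0.
have QE s : s <= l -> Q s = P s by rewrite /Q => ->.
have qE s : s <= l -> q s = m s by rewrite /q => ->.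
have ll : 0 <= l <= l by rewrite l0 lexx.
have z0 : (0 : R) <= 0 <= l' by rewrite lexx.
(* The junction [l] becomes an exceptional point, and those of the second path are shifted by
   [l]. *)
exists Q, q, (B + B'), (l :: bad ++ [seq l + b | b <- bad']); split.
- rewrite QE// qE// QE' ?lerDl// qE' ?lerDl// (addrC l) addrK.
  by split => //; rewrite m'l.
- split; [exact: addr_ge0|exact: addr_ge0|move=> t /andP[t0 t1]].
  have [tl|lt] := leP t l; first by rewrite QE//; apply: OP; rewrite t0.
  by rewrite QE' ?(ltW lt)//; apply: OP'; rewrite subr_ge0 (ltW lt) lerBlDl.
- move=> s t; wlog st : s t / s <= t.
    move=> W s01 t01; have [st|/ltW ts] := leP s t; first exact: W.
    by rewrite enorm_distC distrC (distrC (q t)); exact: W.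
  move=> /andP[s0 s1] /andP[t0 t1].
  have BB (a : R) : B * `|a| <= (B + B') * `|a| by rewrite ler_wpM2r// lerDl.
  have BB' (a : R) : B' * `|a| <= (B + B') * `|a| by rewrite ler_wpM2r// lerDr.
  have [tl|lt] := leP t l.
    have sl := le_trans st tl; rewrite !QE// !qE//.
    have ss : 0 <= s <= l by rewrite s0.
    have tt : 0 <= t <= l by rewrite t0.
    have [h1 h2] := lipP _ _ ss tt; split => //; exact: le_trans (BB _).
  have {}t1 : 0 <= t - l <= l' by rewrite subr_ge0 (ltW lt) lerBlDl.
  have [sl|ls] := leP s l; last first.
    have {}s1 : 0 <= s - l <= l' by rewrite subr_ge0 (ltW ls) lerBlDl.
    rewrite !QE' ?(ltW ls) ?(ltW lt)// !qE' ?(ltW ls) ?(ltW lt)//.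
    have [h1 h2] := lipP' _ _ s1 t1.
    have E : t - l - (s - l) = t - s by rewrite opprB addrA subrK.
    rewrite E in h1 h2; split => //.
    by rewrite opprD addrACA subrr add0r (le_trans h2).
  have s2 : 0 <= s <= l by rewrite s0.
  have [h1 h2] := lipP' _ _ z0 t1; have [h3 h4] := lipP _ _ s2 ll.
  have lt0 : 0 <= t - l by rewrite subr_ge0 ltW.
  have sl0 : 0 <= l - s by rewrite subr_ge0.
  rewrite subr0 (ger0_norm lt0) in h1 h2; rewrite (ger0_norm sl0) in h3 h4.
  rewrite QE' ?(ltW lt)// qE' ?(ltW lt)// QE// qE//.
  have ts0 : 0 <= t - s by rewrite subr_ge0.
  rewrite (ger0_norm ts0); split.
    have -> : P' (t - l) - P s = (P' (t - l) - P' 0) + (P l - P s).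
      by rewrite P'0 Pl addrA subrK.
    rewrite (le_trans (enormD _ _))// (le_trans (lerD h1 h3))//.
    by rewrite addrA subrK.
  have -> : M + m' (t - l) - m s = (m' (t - l) - m' 0) + (m l - m s).
    by rewrite m'0 ml subr0 addrA (addrC M).
  rewrite (le_trans (ler_normD _ _))// (le_trans (lerD h2 h4))//.
  have e1 : B' * (t - l) <= (B + B') * (t - l) by rewrite ler_wpM2r// lerDr.
  have e2 : B * (l - s) <= (B + B') * (l - s) by rewrite ler_wpM2r// lerDl.
  rewrite (le_trans (lerD e1 e2))// -mulrDr addrA subrK//.
move=> t /andP[t0 t1]; rewrite inE mem_cat !negb_or => /andP[tl /andP[tb tb']].
have [ltl|ltl] := ltP t l.
  have [|//|p' [m1 [d1 d2 d3 d4 d5]]] := derP t; first by rewrite t0.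
  exists p', m1; split => //.
  - apply: near_eq_is_derive d1; near=> s; rewrite QE// ltW//; near: s.
    exact: lt_nbhsl.
  - apply: near_eq_is_derive d2; near=> s; rewrite qE// ltW//; near: s.
    exact: lt_nbhsl.
  - by rewrite QE// ltW.
have lt : l < t by rewrite lt_neqAle ltl eq_sym tl.
have tb2 : t - l \notin bad'.
  by apply: contra tb' => tb'; apply/mapP; exists (t - l) => //; rewrite addrC subrK.
have [|//|p' [m1 [d1 d2 d3 d4 d5]]] := derP' (t - l).
  by rewrite subr_gt0 lt ltrBlDl.
exists p', m1; split => //.
- apply: near_eq_is_derive (is_derive_shift d1); near=> s; rewrite QE'// ltW//; near: s.
  exact: lt_nbhsr.
- have := is_derive_add (is_derive_cst M t 1) (is_derive_shift d2); rewrite add0r.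
  apply: near_eq_is_derive; near=> s; rewrite qE'// ltW//; near: s.
  exact: lt_nbhsr.
- by rewrite QE'.
Unshelve. all: by end_near. Qed.

End UnitSpeed.

(** * Comparison of admissible paths with paths of constant speed *)

Section Minimizers.
Context {R : realType} (v c : R) (w : 'rV[R]_2 -> 'rV[R]_2).
Hypothesis w_cont : continuous w.
Hypotheses (cv : 0 <= c < v) (wc : forall p, enorm (w p) <= c).
Local Notation mu := (@lebesgue_measure R).
Implicit Types (x y : 'rV[R]_2) (xi g : R -> 'rV[R]_2) (s t : R).

Let wv p : enorm (w p) < v.
Proof. by apply: (le_lt_trans (wc p)); case/andP: cv. Qed.

Let v0 : 0 < v. Proof. by case/andP: cv; exact: le_lt_trans. Qed.

Lemma ae_notin (bad : seq R) : {ae mu, forall t, t \notin bad}.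
Proof.
elim: bad => [|b bad IH]; first exact: aeW.
by apply: aeS (aeI (ae_neq b) IH) => t [tb tbad]; rewrite inE negb_or tb.
Qed.

(** By [fd_le] the rate of the clock dominates the flight density, and the rate of a Lipschitz clock
    integrates to its increment. *)
Lemma flight_duration_le_clock xi (m : R -> R) (K B : R) : lip_path xi K ->
  (forall s t, 0 <= s <= 1 -> 0 <= t <= 1 -> `|m t - m s| <= B * `|t - s|) ->
  {ae mu, forall t, t \in `[0, 1] -> exists p' m', [/\ is_derive t 1 xi p',
     is_derive t 1 m m', 0 <= m' & enorm (p' - m' *: w (xi t)) <= v * m']} ->
  flight_duration v w xi <= m 1 - m 0.
Proof.
move=> xiK mB H.
(* The clock as a coordinate of a plane path, to which [lip_path_derivative] applies. *)
pose mm t : 'rV[R]_2 := m t *: e_ 0.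
have mmE t : mm t 0 0 = m t by rewrite !mxE/= mulr1.
have mmK : lip_path mm B.
  move=> s t s01 t01; rewrite /mm -scalerBl enormZ.
  have -> : enorm (e_ 0 : 'rV[R]_2) = 1.
    by rewrite /enorm dotE !mxE/= mulr1 mulr0 addr0 sqrtr1.
  by rewrite mulr1 mB.
have [G [bG GI dG]] := lip_path_derivative mmK.
have -> : m 1 - m 0 = \int[mu]_(x in `[0, 1]) G x 0 0.
  rewrite -!mmE (GI 0 1 0) ?ler01//; apply: Rintegral_itv_obnd_cbnd.
  exact: bm_integrable_itv.
apply: abm_int_le; [exact: (flight_duration_abm w_cont cv wc xiK)|exact: bm_abm|].
apply: aeS (aeI H dG) => t [+ +] t01 => /(_ t01) [p' [m' [dp dm m'0 pm]]] /(_ t01) dmm.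
have dG' : is_derive t 1 m (G t 0 0).
  have -> : m = (fun s => mm s 0 0) by apply/funext => s; rewrite mmE.
  exact: is_derive_coord.
have -> : G t 0 0 = m' by rewrite -(@derive_val _ _ _ _ _ _ _ dG') (@derive_val _ _ _ _ _ _ _ dm).
by rewrite (is_derive_derive1 dp); exact: fd_le.
Qed.

(** Rescaling [[0, l]] to [[0, 1]] turns unit speed into constant speed [l], positive because the
    endpoints differ. *)
Lemma unit_path_Xhat xO xD Om l M : xO <> xD -> unit_path v w Om xO xD l M ->
  exists2 xi, Xhat xO xD Om xi & flight_duration v w xi <= M.
Proof.
move=> xOD [P [m [B [bad [[P0 Pl m0 ml] [l0 B0 OP] lipP derP]]]]].
have lgt0 : 0 < l.
  rewrite lt_neqAle l0 andbT; apply/eqP => l00; apply: xOD.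
  by rewrite -P0 -Pl -l00.
have in0l t : 0 <= t <= 1 -> 0 <= l * t <= l.
  by move=> /andP[t0 t1]; rewrite mulr_ge0//= ler_piMr.
have lipxi : lip_path (fun t => P (l * t)) l.
  move=> s t s01 t01; have [+ _] := lipP _ _ (in0l _ s01) (in0l _ t01).
  by rewrite -mulrBr normrM (ger0_norm l0).
have der : {ae mu, forall t, t \in `[0, 1] -> exists p' m',
    [/\ is_derive t 1 (fun t => P (l * t)) p', is_derive t 1 (fun t => m (l * t)) m',
       enorm p' = l, 0 <= m' & enorm (p' - m' *: w (P (l * t))) <= v * m']}.
  apply: aeS (aeI ae_oo01 (ae_notin [seq b / l | b <- bad])) => t [+ tb] t01.
  move=> /(_ t01)/andP[t0 t1].
  have ltb : l * t \notin bad.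
    apply: contra tb => tb; apply/mapP; exists (l * t) => //.
    by rewrite mulrC mulKf// gt_eqF.
  have ltl : 0 < l * t < l by rewrite mulr_gt0//= gtr_pMr.
  have [p' [m' [dp dm p1 m'0 pm]]] := derP _ ltl ltb.
  exists (l *: p'), (l * m'); split.
  - exact: is_derive_dilate.
  - have lt : is_derive t 1 (fun s => l * s) l.
      have := is_derive_mul (is_derive_cst l t 1) (is_derive_id t (1 : R)).
      by rewrite mulr1 mul0r addr0.
    by have := is_derive1_comp dm lt; rewrite mulrC.
  - by rewrite enormZ p1 mulr1 ger0_norm.
  - exact: mulr_ge0.
  - by rewrite -scalerA -scalerBr enormZ (ger0_norm l0) mulrCA ler_wpM2l.
exists (fun t => P (l * t)).
  split; last first.
    exists l; apply: aeS der => t + t01 => /(_ t01) [p' [m' [dp _ pl _ _]]].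
    by split; [case: dp|rewrite (is_derive_derive1 dp)].
  split; rewrite ?mulr0 ?mulr1//; first exact: lip_path_lipschitz lipxi.
  by move=> t; rewrite in_itv/= => t01; apply: OP; exact: in0l.
have -> : M = m (l * 1) - m (l * 0) by rewrite mulr1 mulr0 ml m0 subr0.
apply: (@flight_duration_le_clock _ (fun t => m (l * t)) l (B * l)) => //.
  move=> s t s01 t01; have [_] := lipP _ _ (in0l _ s01) (in0l _ t01).
  by rewrite -mulrBr normrM (ger0_norm l0) mulrA.
apply: aeS der => t + t01 => /(_ t01) [p' [m' [? ? _ ? ?]]].
by exists p', m'.
Qed.

(* The unit path is the polygon through the points g (i / N); on each chord the
   clock has to run faster by a factor 1 + O(1 / N) only. *)
Lemma adm_unit_path xO xD (K D Kw : R) g (Om : set 'rV[R]_2) (e : R) :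
  0 <= K -> 0 <= Kw -> 0 <= D -> 0 < e ->
  adm v w xO xD K D g ->
  (forall t, 0 <= t <= 1 -> Om (g t)) ->
  (forall x y s, 0 <= s <= 1 -> Om x -> Om y -> Om (x + s *: (y - x))) ->
  (forall x y, Om x -> Om y -> enorm (w y - w x) <= Kw * enorm (y - x)) ->
  exists l M, unit_path v w Om xO xD l M /\ M <= D + e.
Proof.
move=> K0 Kw0 D0 e0 [gO gD gadm] Og cvx HKw.
case/andP: cv => c0 cv'; have vc : 0 < v - c by rewrite subr_gt0.
(* [C th^2] bounds the error on one chord: [K] is the defect allowed by [adm], [2 v Kw] the change
   of the wind along the chord. The delays of the [N] chords add up to [A / N]. *)
pose C := K + 2 * v * Kw; have C0 : 0 <= C.
  by rewrite addr_ge0// !mulr_ge0// ltW.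
pose A := D * (C * D / (v - c)); have A0 : 0 <= A.
  by rewrite mulr_ge0// divr_ge0 ?(ltW vc)// mulr_ge0.
have [N N0 NA] : exists2 N : nat, (0 < N)%N & A / N%:R <= e.
  exists (Num.bound (A / e)).+1 => //.
  rewrite ler_pdivrMr// -ler_pdivrMl// mulrC.
  rewrite (le_trans (ltW (archi_boundP _)))//; first by rewrite divr_ge0// ltW.
  by rewrite ler_nat.
have NR0 : 0 < N%:R :> R by rewrite ltr0n.
pose th := D / N%:R; have th0 : 0 <= th by rewrite divr_ge0// ltW.
(* Chosen so that [(tau - th) (v - c) = C th^2]: extra time gains at least [v - c] per unit, which
   pays for the error. *)
pose tau := th * (1 + C * th / (v - c)).
have tau0 : 0 <= tau.
  by rewrite mulr_ge0// addr_ge0// divr_ge0 ?(ltW vc)// mulr_ge0.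
have step n : (n <= N)%N -> exists l M,
    unit_path v w Om xO (g (n%:R / N%:R)) l M /\ M <= n%:R * tau.
  elim: n => [_|n IH nN].
    exists 0, 0; rewrite !mul0r gO; split => //; apply: unit_path0.
    by rewrite -gO; apply: Og; exact: in01_0.
  have [l [M [up MM]]] := IH (ltnW nN).
  pose s := n%:R / N%:R : R; pose t := n.+1%:R / N%:R : R.
  have s0 : 0 <= s by rewrite divr_ge0// ltW.
  have ts : t - s = N%:R^-1 by rewrite -mulrBl -natr1 addrAC subrr add0r mul1r.
  have st : s <= t by rewrite -subr_ge0 ts invr_ge0 ltW.
  have t1 : t <= 1 by rewrite ler_pdivrMr// mul1r ler_nat.
  have Os : Om (g s) by apply: Og; rewrite s0 (le_trans st).
  have Ot : Om (g t) by apply: Og; rewrite t1 (le_trans s0).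
  have [h1 h2] := gadm s t s0 st t1.
  rewrite ts -/th in h1 h2.
  have MM' : M <= n.+1%:R * tau.
    by rewrite (le_trans MM)// ler_wpM2r// ler_nat.
  (* A chord of length 0 has no unit direction; the path built so far is kept. *)
  have [E|Dn0] := eqVneq (g t - g s) 0.
    exists l, M; split => //; move/eqP: E; rewrite subr_eq0 => /eqP ->.
    exact: up.
  exists (l + enorm (g t - g s)), (M + tau); split; last first.
    by rewrite -natr1 mulrDl mul1r lerD2r.
  apply: unit_path_cat up _; rewrite -/s -/t.
  have -> : g t = g s + (g t - g s) by rewrite addrC subrK.
  rewrite [X in unit_path _ _ _ _ _ (enorm (X - _))]addrC subrK.
  apply: unit_path_segment => // a a01; split; first exact: cvx.
  have Oa := cvx _ _ _ a01 Os Ot.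
  set p := g s + a *: _ in Oa *.
  have wp : enorm (w p - w (g s)) <= Kw * (2 * v * th).
    rewrite (le_trans (HKw _ _ Os Oa))// ler_wpM2l// /p addrAC subrr add0r enormZ.
    case/andP: a01 => a0 a1; rewrite (ger0_norm a0) (le_trans _ h1)//.
    by rewrite ler_piMl ?enorm_ge0.
  have -> : g t - g s - tau *: w p = (g t - g s - th *: w (g s)) -
      (th *: (w p - w (g s)) + (tau - th) *: w p).
    rewrite scalerBr scalerBl opprD !opprB !addrA.
    by apply: rV2P; rewrite !mxE; ring.
  apply: (le_trans (enormB _ _)).
  have tth : 0 <= tau - th.
    rewrite /tau mulrDr mulr1 addrAC subrr add0r mulr_ge0//.
    by rewrite divr_ge0 ?(ltW vc)// mulr_ge0.
  have h3 : enorm (th *: (w p - w (g s)) + (tau - th) *: w p) <=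
      th * (Kw * (2 * v * th)) + (tau - th) * c.
    rewrite (le_trans (enormD _ _))// !enormZ !ger0_norm// lerD//.
      by rewrite ler_wpM2l.
    by rewrite ler_wpM2l.
  apply: (le_trans (lerD h2 h3)).
  rewrite le_eqVlt; apply/orP; left; apply/eqP.
  by rewrite /tau /C; field; exact: lt0r_neq0.
have [l [M [up MM]]] := step N (leqnn N).
exists l, M; split; first by move: up; rewrite divff ?gt_eqF// gD.
rewrite (le_trans MM)// /tau mulrA /th (mulrC N%:R) divfK ?gt_eqF//.
rewrite mulrDr mulr1 lerD2l (le_trans _ NA)// /A.
rewrite le_eqVlt; apply/orP; left; apply/eqP; field.
by rewrite !lt0r_neq0.
Qed.

(** Dividing the integrated inclusion by the step and letting it tend to 0 removes the second order
    error and leaves [|l - D w| <= v D], to which [fd_le] applies. *)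
Lemma adm_derivative xO xD (K D : R) g t l : 0 <= K -> 0 <= D ->
  adm v w xO xD K D g -> 0 < t < 1 -> is_derive t 1 g l ->
  flight_density v w (g t) l <= D.
Proof.
move=> K0 D0 [_ _ gadm] /andP[t0 t1] /is_derive1P /cvg_dnbhs_at_right H.
apply: fd_le => //.
have hid : (fun h : R => h) @ 0^'+ --> (0 : R) by apply: cvg_at_right_filter; exact: cvg_id.
have H' : (fun h => enorm (h^-1 *: (g (h + t) - g t) - D *: w (g t))) @ 0^'+
    --> enorm (l - D *: w (g t)).
  apply: (continuous_cvg _ (@continuous_enorm R _)); apply: cvgB => //; exact: cvg_cst.
have H2 : (fun h => D * (v + K * (D * h))) @ 0^'+ --> D * (v + K * (D * 0)).
  apply: cvgM; first exact: cvg_cst.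
  apply: cvgD; first exact: cvg_cst.
  apply: cvgM; first exact: cvg_cst.
  by apply: cvgM; first exact: cvg_cst.
have -> : v * D = D * (v + K * (D * 0)) by rewrite !mulr0 addr0 mulrC.
apply: (ler_cvg_to H' H2); near=> h.
have h0 : 0 < h by near: h; exact: nbhs_right_gt.
have ht1 : h + t <= 1.
  by rewrite -lerBrDr; near: h; apply: nbhs_right_le; rewrite subr_gt0.
have tht : t <= h + t by rewrite lerDr ltW.
have [_] := gadm t (h + t) (ltW t0) tht ht1; rewrite addrK => hh.
have -> : h^-1 *: (g (h + t) - g t) - D *: w (g t) =
    h^-1 *: (g (h + t) - g t - (D * h) *: w (g t)).
  by rewrite [in RHS]scalerBr scalerA mulrC mulfK// gt_eqF.
rewrite enormZ ger0_norm ?invr_ge0 ?(ltW h0)// mulrC ler_pdivrMr//.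
by rewrite (le_trans hh)// mulrAC.
Unshelve. all: by end_near. Qed.

End Minimizers.

(** * The minimizer over [Xhat] is globally fastest *)

Section Fastest.
Context {R : realType} (v c : R) (w : 'rV[R]_2 -> 'rV[R]_2).
Hypothesis w_C2 : twice_cont_diff w.
Hypotheses (cv : 0 <= c < v) (wc : forall p, enorm (w p) <= c).
Variables (xO xD : 'rV[R]_2).
Hypothesis xOD : xO <> xD.
Local Notation mu := (@lebesgue_measure R).
Local Notation abm := ae_bounded_measurable.
Implicit Types (xi g : R -> 'rV[R]_2) (s t : R).

Let w_cont : continuous w. Proof. exact: wind_continuous. Qed.
Let wv p : enorm (w p) < v.
Proof. by case/andP: cv => _; apply: le_lt_trans. Qed.
Let v0 : 0 < v. Proof. by case/andP: cv; exact: le_lt_trans. Qed.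

Lemma flight_duration_adm xi Kx (Kw M0 : R) : lip_path xi Kx -> xi 0 = xO ->
  xi 1 = xD -> 0 <= Kw -> flight_duration v w xi <= M0 ->
  (forall x y, enorm x <= enorm xO + 2 * v * M0 ->
               enorm y <= enorm xO + 2 * v * M0 ->
     enorm (w y - w x) <= Kw * enorm (y - x)) ->
  exists g, adm v w xO xD (2 * v * Kw) (flight_duration v w xi) g.
Proof.
move=> xiK xi0 xi1 Kw0 TM HK.
have [H [mH xiI dH]] := lip_path_derivative xiK.
have [f bf fE] := fd_abm w_cont cv wc xiK mH.
have TE : flight_duration v w xi = \int[mu]_(x in `]0, 1]) f x.
  rewrite Rintegral_itv_obnd_cbnd; last exact: bm_integrable_itv.
  apply: ae_Rintegral_congr; apply: aeS (aeI fE dH) => t [h1 h2] t01.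
  by rewrite (is_derive_derive1 (h2 t01)) h1.
have xi01 : xi 0 <> xi 1 by rewrite xi0 xi1.
rewrite TE -xi0 -xi1.
apply: (adm_reparametrization cv wc mH xiI bf fE (M0 := M0) Kw0 xi01 _ _).
  by rewrite -TE.
by rewrite xi0; exact: HK.
Qed.

Lemma adm_lip_path K D g : adm v w xO xD K D g -> lip_path g (2 * v * D).
Proof.
move=> [_ _ H] s t /andP[s0 s1] /andP[t0 t1].
have [st|/ltW ts] := leP s t.
  have [h _] := H s t s0 st t1.
  by rewrite -mulrA ger0_norm// subr_ge0.
have [h _] := H t s t0 ts s1.
by rewrite -mulrA enorm_distC ler0_norm ?subr_le0// opprB.
Qed.

Lemma fastest_path : exists D g K r, [/\ 0 <= K, 0 < D, adm v w xO xD K D g,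
  forall t, 0 <= t <= 1 -> enorm (g t) <= r &
  forall xi Kx, lip_path xi Kx -> xi 0 = xO -> xi 1 = xD ->
    D <= flight_duration v w xi].
Proof.
have vc : 0 < v - c by rewrite subr_gt0; case/andP: cv.
(* Time enough to fly the straight segment. As [D <= M0], only competitors faster than [M0] require
   an argument. *)
set M0 := enorm (xD - xO) / (v - c).
have [Kw Kw0 HK] := wind_lipschitz w_C2 (enorm xO + 2 * v * M0).
have K0 : 0 <= 2 * v * Kw by rewrite !mulr_ge0// ltW.
have HM0 : enorm (xD - xO) <= (v - c) * M0.
  by rewrite /M0 mulrC divfK// gt_eqF.
have [D [g [/andP[D0 DM] gadm Dmin]]] := adm_minimum w_cont cv wc K0 HM0.
have gL := adm_lip_path gadm.
have [g0 g1 _] := gadm.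
have Dpos : 0 < D.
  have := gL 0 1 in01_0 in01_1; rewrite g0 g1 subr0 normr1 mulr1 => h.
  have : 0 < 2 * v * D.
    by apply: lt_le_trans h; rewrite enorm_gt0 subr_eq0; apply/eqP => E; exact: xOD.
  by rewrite pmulr_rgt0// mulr_gt0.
exists D, g, (2 * v * Kw), (enorm xO + 2 * v * M0); split => //.
  move=> t t01; have := gL 0 t in01_0 t01; rewrite g0 subr0 => h.
  rewrite -[g t](subrK xO) addrC (le_trans (enormD _ _))// lerD2l (le_trans h)//.
  case/andP: t01 => t0 t1; rewrite (ger0_norm t0) -mulrA ler_pM2l ?mulr_gt0//.
  by rewrite (le_trans _ DM)// ler_piMr.
move=> xi Kx xiK xi0 xi1.
have [h|h] := leP (flight_duration v w xi) M0; last by rewrite (le_trans DM)// ltW.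
have [g' ad'] := flight_duration_adm xiK xi0 xi1 Kw0 h HK.
apply: Dmin ad'; rewrite h andbT.
apply: abm_int_ge0; first exact: (flight_duration_abm w_cont cv wc xiK).
by apply: (@aeS _ xpredT) => [t _ _|]; [exact: fd_ge0|exact: aeW].
Qed.

(** The speed of a [trajectory] must not vanish. The density of [g] is at most [D] almost everywhere
    and its integral is at least [D], so it equals [D > 0] almost everywhere, whereas it is 0 at
    zero velocity. *)
Lemma fastest_path_minimizer K D g : 0 <= K -> 0 < D -> adm v w xO xD K D g ->
  (forall xi Kx, lip_path xi Kx -> xi 0 = xO -> xi 1 = xD ->
    D <= flight_duration v w xi) ->
  minimizer (flight_duration v w) (trajectory xO xD) g.
Proof.
move=> K0 D0 gadm Dmin.
have gL := adm_lip_path gadm; have [g0 g1 _] := gadm.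
have abg := flight_duration_abm w_cont cv wc gL.
have [H [_ _ dH]] := lip_path_derivative gL.
have le_D : {ae mu, forall t, t \in `[0, 1] ->
    flight_density v w (g t) (derive1 g t) <= D}.
  apply: aeS (aeI dH ae_oo01) => t [h1 h2] t01.
  rewrite (is_derive_derive1 (h1 t01)).
  exact: (adm_derivative cv wc K0 (ltW D0) gadm (h2 t01) (h1 t01)).
have TD : flight_duration v w g = D.
  apply/le_anti; rewrite (Dmin _ _ gL)// andbT -[leRHS](abm_int_cst D).
  by apply: abm_int_le => //; exact: abm_cst.
have eD : {ae mu, forall t, t \in `[0, 1] ->
    D - flight_density v w (g t) (derive1 g t) = 0}.
  apply: abm_int_eq0.
  - by apply: abmD; [exact: abm_cst|exact: abmN].
  - by apply: aeS le_D => t h /h; rewrite subr_ge0.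
  - by rewrite (abm_intB (abm_cst D) abg) abm_int_cst -/(flight_duration v w g) TD subrr.
split.
  split; first by split => //; exact: lip_path_lipschitz gL.
  apply: aeS (aeI dH eD) => t [h1 h2] t01; split; first by case: (h1 t01).
  apply/eqP => E; have := h2 t01; rewrite E.
  have -> : flight_density v w (g t) 0 = 0.
    by rewrite /flight_density !dot0l oppr0 expr0n/= mulr0 addr0 sqrtr0 addr0 mul0r.
  by rewrite subr0 => D00; move: D0; rewrite D00 ltxx.
move=> xi [[/lipschitz_lip_path[Kx _ xiK] _ xi0 xi1] _].
by rewrite TD; exact: Dmin xiK xi0 xi1.
Qed.

Lemma Xhat_minimizer_global (a : R) xiC xi Kx :
  (forall xi : R -> 'rV[R]_2,
     minimizer (flight_duration v w) (trajectory xO xD) xi ->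
     forall t : R, t \in `[0, 1] -> filled_ellipse xO xD a (xi t)) ->
  minimizer (flight_duration v w) (Xhat xO xD (filled_ellipse xO xD a)) xiC ->
  lip_path xi Kx -> xi 0 = xO -> xi 1 = xD ->
  flight_duration v w xiC <= flight_duration v w xi.
Proof.
move=> Om_min [_ minC] xiK xi0 xi1.
have [D [g [K [r [K0 D0 gadm gr Dmin]]]]] := fastest_path.
have gOm := Om_min _ (fastest_path_minimizer K0 D0 gadm Dmin).
apply: le_trans (Dmin _ _ xiK xi0 xi1); apply/ler_addgt0Pr => e e0.
have [Kw Kw0 HK] := wind_lipschitz w_C2 r.
(* The ball, which contains [g] as well, provides a Lipschitz constant for [w]; the intersection is
   still convex. *)
pose Om := filled_ellipse xO xD a `&` [set p | enorm p <= r].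
have gOm' t : 0 <= t <= 1 -> Om (g t).
  by move=> t01; split; [apply: gOm; rewrite in_itv|exact: gr].
have cvx x y s : 0 <= s <= 1 -> Om x -> Om y -> Om (x + s *: (y - x)).
  move=> s01 [x1 x2] [y1 y2]; split; last exact: enorm_convex.
  have conv z : enorm (x + s *: (y - x) - z) <=
      (1 - s) * enorm (x - z) + s * enorm (y - z).
    have -> : x + s *: (y - x) - z = (1 - s) *: (x - z) + s *: (y - z).
      by apply: rV2P; rewrite !mxE; ring.
    case/andP: s01 => s0 s1; apply: (le_trans (enormD _ _)).
    by rewrite !enormZ !ger0_norm// subr_ge0.
  rewrite /filled_ellipse/=; apply: le_trans (lerD (conv _) (conv _)) _.
  move: x1 y1 s01; rewrite /filled_ellipse/=.
  move: (enorm (x - xO)) (enorm (y - xO)) (enorm (x - xD)) (enorm (y - xD)).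
  clear; move=> p q p' q' h1 h2 /andP[s0 s1].
  have s1' : 0 <= 1 - s by rewrite subr_ge0.
  have := lerD (ler_wpM2l s1' h1) (ler_wpM2l s0 h2); lra.
have [l [M [[P [m [B [bad [H1 [l0 B0 HOm] H3 H4]]]]] MD]]] :=
  adm_unit_path cv wc K0 Kw0 (ltW D0) e0 gadm gOm' cvx
   (fun x y hx hy => HK x y hx.2 hy.2).
have up : unit_path v w (filled_ellipse xO xD a) xO xD l M.
  exists P, m, B, bad; split => //; split => // t tl.
  by have [] := HOm t tl.
have [xi' X' T'] := unit_path_Xhat w_cont cv wc xOD up.
by rewrite (le_trans (minC _ X'))// (le_trans T').
Qed.

End Fastest.

(** * Paths close to the minimizer *)

Section PathNorms.
Context {R : realType}.
Local Notation mu := (@lebesgue_measure R).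
Local Notation abm := ae_bounded_measurable.
Implicit Types (g : R -> 'rV[R]_2) (s t : R).

Lemma Linfty01_ae g (r : R) : (Linfty01 g <= r%:E)%E ->
  {ae mu, forall t, t \in `[0, 1] -> enorm (g t) <= r}.
Proof.
rewrite /Linfty01 unlock /Lnorm.
have muT : (0 < mu setT)%E.
  apply: (@lt_le_trans _ _ (mu `[0%R, 1%R]%classic)).
    by rewrite lebesgue_measure_itv/= lte_fin ltr01 sube0 lte_fin.
  by apply: le_measure; rewrite ?inE.
rewrite muT => /ess_supP; apply: aeS => t + t01.
rewrite /= patchE ifT; last by rewrite inE.
by rewrite /= lee_fin ger0_norm ?enorm_ge0.
Qed.

Lemma C01_norm_ae g (r : R) : (C01_norm g <= r%:E)%E ->
  {ae mu, forall t, t \in `[0, 1] -> enorm (g t) <= r /\ enorm (derive1 g t) <= r}.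
Proof.
have ge0 h : (0 <= Linfty01 h)%E by exact: Lnorm_ge0.
move=> H; have H1 : (Linfty01 g <= r%:E)%E by apply: le_trans H; apply: leeDl; exact: ge0.
have H2 : (Linfty01 (derive1 g) <= r%:E)%E by apply: le_trans H; apply: leeDr; exact: ge0.
apply: aeS (aeI (Linfty01_ae H1) (Linfty01_ae H2)) => t [h1 h2] t01.
by split; [exact: h1|exact: h2].
Qed.

(** Where the representative of [f] is below [k] it is replaced by [k], which bounds the inverse
    everywhere. *)
Lemma abmV (f : R -> R) (k : R) : 0 < k -> abm f ->
  {ae mu, forall t, t \in `[0, 1] -> k <= f t} -> abm (fun t => (f t)^-1).
Proof.
move=> k0 [f' [mf [K fK]] ff'] kf.
have mk0 x : 0 < Num.max k x by rewrite lt_max k0.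
exists (fun t => (Num.max k (f' t))^-1).
  split.
    rewrite (_ : (fun t => _) = (fun t => Num.max k (f' t) `^ (-1))).
      apply: (measurableT_comp (f := fun x => x `^ (-1))).
        exact: measurable_powR.
      by apply: measurable_maxr => //; exact: measurable_cst.
    by apply/funext => t; rewrite powR_inv1// ltW.
  exists k^-1 => t; rewrite ger0_norm ?invr_ge0 ?(ltW (mk0 _))//.
  by rewrite lef_pV2 ?posrE// le_max lexx.
apply: aeS (aeI ff' kf) => t [h1 h2] t01.
by rewrite -h1// max_r// h2.
Qed.

Lemma abm_derive1 g K : lip_path g K -> forall i, abm (fun t => derive1 g t 0 i).
Proof.
move=> gK i; have [H [mH _ dH]] := lip_path_derivative gK.
apply: abm_ae (bm_abm (mH i)); apply: aeS dH => t + t01 => /(_ t01) d.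
by rewrite (is_derive_derive1 d).
Qed.

Lemma abm_enorm_derive1 g K : lip_path g K -> abm (fun t => enorm (derive1 g t)).
Proof.
move=> gK; rewrite /enorm; apply: abm_sqrt.
by apply: abm_dot => i; exact: abm_derive1 gK i.
Qed.

(** Each coordinate at [t] is at most the integral of the modulus of its derivative, and
    Cauchy-Schwarz applies; summing the squares of the coordinates gives the constant 1. *)
Lemma poincare01 g K t : lip_path g K -> g 0 = 0 -> 0 <= t <= 1 ->
  enorm (g t) ^+ 2 <= \int[mu]_(s in `[0, 1]) (enorm (derive1 g s) ^+ 2).
Proof.
move=> gK g0 /andP[t0 t1]; have [H [mH HI dH]] := lip_path_derivative gK.
have a2 i : abm (fun s => H s 0 i ^+ 2) by exact: abmX2 (bm_abm (mH i)).
have -> : \int[mu]_(s in `[0, 1]) (enorm (derive1 g s) ^+ 2) =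
    \int[mu]_(s in `[0, 1]) (H s 0 0 ^+ 2 + H s 0 1 ^+ 2).
  apply: ae_Rintegral_congr; apply: aeS dH => s + s01 => /(_ s01) d.
  by rewrite (is_derive_derive1 d) enormX2 dotE -!expr2.
rewrite (abm_intD (a2 0) (a2 1)) enormX2 dotE -!expr2.
have bound i : g t 0 i ^+ 2 <= \int[mu]_(s in `[0, 1]) (H s 0 i ^+ 2).
  have aN : abm (fun s => `|H s 0 i|) by exact: abm_norm (bm_abm (mH i)).
  have -> : \int[mu]_(s in `[0, 1]) (H s 0 i ^+ 2) =
      \int[mu]_(s in `[0, 1]) (`|H s 0 i| ^+ 2).
    by apply: eq_Rintegral => s _; rewrite real_normK ?num_real.
  apply: le_trans (abm_int_sqr aN).
  rewrite -[leLHS]real_normK ?num_real// ler_sqr ?nnegrE//; last first.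
    by apply: abm_int_ge0 => //; apply: (@aeS _ xpredT) => [s _ _|]; [exact: normr_ge0|exact: aeW].
  have := HI 0 t i (lexx 0) t0 t1; rewrite g0 mxE subr0 => ->.
  apply: (le_trans (le_normr_Rintegral _ _)) => //; first exact: bm_integrable_itv.
  have bN := bm_norm (mH i).
  have -> : \int[mu]_(s in `[0, 1]) `|H s 0 i| = \int[mu]_(s in `]0, 1]) `|H s 0 i|.
    by rewrite Rintegral_itv_obnd_cbnd//; exact: bm_integrable_itv.
  rewrite -subr_ge0 (bm_intB bN t0 t1) -[leLHS](_ : \int[mu]_(s in `]t, 1]) 0 = 0).
    apply: bm_int_le => //; first exact: bm_cst.
    by apply: (@aeS _ xpredT) => [s _ _|]; [exact: normr_ge0|exact: aeW].
  by rewrite Rintegral_cst// mul0r.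
by rewrite lerD.
Qed.

End PathNorms.

(** * The remainder of the Taylor bound and its comparison with the coefficients alpha *)

Section Variation.
Context {R : realType} (v c : R) (w : 'rV[R]_2 -> 'rV[R]_2).
Hypothesis w_C2 : twice_cont_diff w.
Hypotheses (cv : 0 <= c < v) (wc : forall p, enorm (w p) <= c).
Local Notation mu := (@lebesgue_measure R).
Local Notation abm := ae_bounded_measurable.
Implicit Types (xi dx : R -> 'rV[R]_2) (s t : R) (p q d e : 'rV[R]_2).

Let w_cont : continuous w. Proof. exact: wind_continuous. Qed.
Let wv p : enorm (w p) < v.
Proof. by case/andP: cv => _; apply: le_lt_trans. Qed.
Let v0 : 0 < v. Proof. by case/andP: cv; exact: le_lt_trans. Qed.

(** The remainder in [fd_taylor], with [x] and [y] standing for the sizes of the perturbations of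
    position and velocity. *)
Definition quad_bound (L A1 A2 x y : R) : R :=
  4 / 5 / (L * v) * y ^+ 2 + 13 / 2 * A1 / v ^+ 2 * y * x
  + (48 / 5 * L * A1 ^+ 2 / v ^+ 3 + 2 * L * A2 / v ^+ 2) * x ^+ 2.

Lemma quad_boundZ L A1 A2 k x y :
  quad_bound L A1 A2 (k * x) (k * y) = k ^+ 2 * quad_bound L A1 A2 x y.
Proof. by rewrite /quad_bound !exprMn; ring. Qed.

Lemma fdW1Z W W1 q d k : fdW1 v W (k *: W1) q (k *: d) = k * fdW1 v W W1 q d.
Proof.
rewrite /fdW1 mulrA; congr (_ / _).
by rewrite !(dotDr, dotNr, dotZr, dotDl, dotNl, dotZl); ring.
Qed.

(** The moduli of continuity are uniform on the ball of radius [B], so one [r] serves all its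
    points. The margins [v / 100] and [L / 50] are those that [fd_taylor] leaves for the wind and
    the velocity. *)
Lemma fd_taylor_uniform (B L eps : R) : 0 < L -> 0 < eps ->
  exists2 r, 0 < r & forall p e q d, enorm p <= B ->
    enorm (w p) <= v / Num.sqrt 5 -> enorm q = L -> enorm e <= r -> enorm d <= r ->
    flight_density v w (p + e) (q + d) <= flight_density v w p q +
      fdW1 v (w p) ('d w p e) q d +
      quad_bound L (c1 w p + eps) (c2 w p + eps) (enorm e) (enorm d).
Proof.
move=> L0 eps0.
have v100 : 0 < v / 100 by rewrite divr_gt0.
have [d1 d10 H1] := heine_enorm B w_cont v100.
have [d2 d20 H2] := dwind_modulus w_C2 B eps0.
have [d3 d30 H3] := second_deriv_modulus w_C2 B eps0.
exists (Num.min (Num.min d1 d2) (Num.min d3 (L / 50))).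
  by rewrite !lt_min d10 d20 d30 divr_gt0.
move=> p e q d pB wp qL; rewrite !le_min => /andP[/andP[e1 e2] /andP[e3 _]].
case/andP=> _ /andP[_ dL].
apply: fd_taylor => //; rewrite ?addr_ge0 ?c1_ge0 ?c2_ge0 ?(ltW eps0)// => s s01.
have [s0 s1] := andP s01.
have se : enorm (p + s *: e - p) <= enorm e.
  by rewrite addrAC subrr add0r enormZ ger0_norm// ler_piMl ?enorm_ge0.
split.
- have h := H1 _ _ pB (le_trans se e1).
  have h2 := enormD (w (p + s *: e) - w p) (w p); rewrite subrK in h2.
  (* Together with the variation [v / 100]: [45/100 + 1/100 < 6/13]. *)
  have h5 : v / Num.sqrt 5 <= 45 / 100 * v.
    rewrite mulrC ler_pM2r// -[leRHS]invrK lef_pV2 ?posrE ?invr_gt0 ?divr_gt0 ?sqrtr_gt0//.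
    rewrite -(@ler_sqr R) ?nnegrE ?sqrtr_ge0 ?invr_ge0 ?divr_ge0// sqr_sqrtr//.
    by rewrite invf_div; lra.
  move: h h2 h5 wp v0; move: (enorm _) (enorm _) (enorm _) (v / Num.sqrt 5).
  by clear; move=> *; lra.
- have sd : enorm (s *: d) <= L / 50.
    by rewrite enormZ ger0_norm// (le_trans _ dL)// ler_piMl ?enorm_ge0.
  have h1 := enormD q (s *: d).
  have h2 := enormB (q + s *: d) (s *: d); rewrite addrK in h2.
  move: sd h1 h2; rewrite qL; move: (enorm _) (enorm _).
  move=> x y h1 h2 h3; apply/andP; split; lra.
- have h := H2 _ _ pB (le_trans se e2) e.
  have := enormD ('d w (p + s *: e) e - 'd w p e) ('d w p e); rewrite subrK => h2.
  rewrite (le_trans h2)// addrC mulrDl lerD//; exact: c1_ge.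
- have h := H3 _ _ pB (le_trans se e3) e e.
  have := enormD (second_deriv w (p + s *: e) e e - second_deriv w p e e)
    (second_deriv w p e e); rewrite subrK => h2.
  by rewrite (le_trans h2)// addrC mulrDl expr2 !mulrA lerD//; exact: c2_ge.
Qed.

(** Passing from [v] to [V] only enlarges the right side. The terms in [eps] cost at most
    [x^2 + y^2 / 5] in units of [1 / (L v)]. Added to the [4/5] already present, the coefficient of
    [y^2] becomes 1 out of the available 2, which leaves the final [- y^2]. *)
Lemma quad_bound_le (V L C1 C2 eps x y : R) : 0 < L -> 0 < V <= v ->
  0 <= C1 -> 0 <= C2 -> 0 <= eps <= v -> 65 * L * eps <= 4 * v ->
  125 * L ^+ 2 * eps <= 2 * v -> 0 <= x -> 0 <= y ->
  quad_bound L (C1 + eps) (C2 + eps) x y <=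
    L / V ^+ 3 * (12 * C1 ^+ 2 + 4 * V * C2) * x ^+ 2
    + 8 * C1 / V ^+ 2 * x * y + 2 / (L * V) * y ^+ 2
    + (x ^+ 2 - y ^+ 2) / (L * v).
Proof.
move=> L0 /andP[V0 Vv] C10 C20 /andP[e0 ev] h65 h125 x0 y0.
have iVv k : (v ^+ k)^-1 <= (V ^+ k)^-1.
  have Vk : V ^+ k <= v ^+ k by apply: lerXn2r => //; rewrite nnegrE ltW.
  by rewrite lef_pV2// posrE exprn_gt0.
have i0 k : 0 <= (v ^+ k)^-1 by rewrite invr_ge0 exprn_ge0 ?ltW.
have t1 : 13 / 2 * C1 / v ^+ 2 * y * x <= 8 * C1 / V ^+ 2 * x * y.
  rewrite -!mulrA (mulrC x y) !mulrA ler_wpM2r// ler_wpM2r//.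
  by apply: ler_pM => //; lra.
have t2 : 2 / (L * v) * y ^+ 2 <= 2 / (L * V) * y ^+ 2.
  rewrite ler_wpM2r ?sqr_ge0// ler_wpM2l// lef_pV2 ?posrE ?mulr_gt0//.
  by rewrite ler_pM2l.
have t3 : 12 * L * C1 ^+ 2 / v ^+ 3 * x ^+ 2 <= 12 * L * C1 ^+ 2 / V ^+ 3 * x ^+ 2.
  by rewrite ler_wpM2r ?sqr_ge0// ler_wpM2l// !mulr_ge0 ?sqr_ge0// ltW.
have t4 : 2 * L * C2 / v ^+ 2 * x ^+ 2 <= 4 * L * C2 / V ^+ 2 * x ^+ 2.
  rewrite ler_wpM2r ?sqr_ge0//; have LC := mulr_ge0 (ltW L0) C20.
  by apply: ler_pM => //; lra.
(* The factor [5/4] turns [48/5] into the [12] of [alpha0]. *)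
have sq : (C1 + eps) ^+ 2 <= 5 / 4 * C1 ^+ 2 + 5 * eps ^+ 2.
  have := sqr_ge0 (C1 / 2 - 2 * eps); rewrite !expr2; lra.
have t5 : 48 / 5 * L * (C1 + eps) ^+ 2 / v ^+ 3 * x ^+ 2 <=
    12 * L * C1 ^+ 2 / v ^+ 3 * x ^+ 2 + 48 * L * eps ^+ 2 / v ^+ 3 * x ^+ 2.
  rewrite -!mulrDl ler_wpM2r ?sqr_ge0// ler_wpM2r//.
  have := ler_wpM2l (ltW L0) sq; lra.
(* By [2 x y <= x^2 + y^2]; the condition with 65 says that the coefficient is at most
   [2/5 / (L v)]. *)
have t6 : 13 / 2 * eps / v ^+ 2 * y * x <= 1 / 5 / (L * v) * (x ^+ 2 + y ^+ 2).
  have k : 13 / 2 * eps / v ^+ 2 <= 2 / 5 / (L * v).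
    rewrite ler_pdivlMr ?mulr_gt0// mulrAC ler_pdivrMr ?exprn_gt0//.
    have := ler_wpM2r (ltW v0) h65; rewrite expr2; lra.
  have z0 : 0 <= (L * v)^-1 by rewrite invr_ge0 mulr_ge0 ?(ltW L0) ?(ltW v0).
  have := mulr_ge0 z0 (sqr_ge0 (x - y)); have := ler_wpM2r (mulr_ge0 y0 x0) k.
  move: (13 / 2 * eps / _) (L * v)^-1 => A z; rewrite !expr2; lra.
(* [eps <= v] merges the two terms into [50 L eps / v^2], and the condition with 125 bounds that by
   [4/5 / (L v)]. *)
have t7 : 48 * L * eps ^+ 2 / v ^+ 3 * x ^+ 2 + 2 * L * eps / v ^+ 2 * x ^+ 2 <=
    4 / 5 / (L * v) * x ^+ 2.
  rewrite -mulrDl ler_wpM2r ?sqr_ge0//.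
  apply: (@le_trans _ _ (50 * L * eps / v ^+ 2)).
    have : eps ^+ 2 / v ^+ 3 <= eps / v ^+ 2.
      rewrite ler_pdivlMr ?exprn_gt0// mulrAC ler_pdivrMr ?exprn_gt0//.
      have : eps * (eps * v ^+ 2) <= eps * (v * v ^+ 2).
        by rewrite ler_wpM2l// ler_wpM2r// sqr_ge0.
      by rewrite (exprS v 2) expr2 mulrA.
    move/(ler_wpM2l (ltW L0)); move: (v ^+ 3)^-1 (v ^+ 2)^-1 => i j; lra.
  rewrite ler_pdivlMr ?mulr_gt0// mulrAC ler_pdivrMr ?exprn_gt0//.
  have := ler_wpM2r (ltW v0) h125; rewrite !expr2; lra.
have -> : L / V ^+ 3 * (12 * C1 ^+ 2 + 4 * V * C2) * x ^+ 2 =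
    12 * L * C1 ^+ 2 / V ^+ 3 * x ^+ 2 + 4 * L * C2 / V ^+ 2 * x ^+ 2.
  by field; exact: lt0r_neq0.
have -> : quad_bound L (C1 + eps) (C2 + eps) x y =
    4 / 5 / (L * v) * y ^+ 2 +
    (13 / 2 * C1 / v ^+ 2 * y * x + 13 / 2 * eps / v ^+ 2 * y * x) +
    (48 / 5 * L * (C1 + eps) ^+ 2 / v ^+ 3 * x ^+ 2 +
     (2 * L * C2 / v ^+ 2 * x ^+ 2 + 2 * L * eps / v ^+ 2 * x ^+ 2)).
  by rewrite /quad_bound; ring.
move: t1 t2 t3 t4 t5 t6 t7.
move: (L * v)^-1 (L * V)^-1 (v ^+ 2)^-1 (v ^+ 3)^-1 (V ^+ 2)^-1 (V ^+ 3)^-1.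
move=> *; lra.
Qed.

End Variation.

(** * From the pointwise expansion to flight durations *)

Section Stationarity.
Context {R : realType} (v c : R) (w : 'rV[R]_2 -> 'rV[R]_2).
Hypothesis w_C2 : twice_cont_diff w.
Hypotheses (cv : 0 <= c < v) (wc : forall p, enorm (w p) <= c).
Local Notation mu := (@lebesgue_measure R).
Local Notation abm := ae_bounded_measurable.
Implicit Types (xi dx : R -> 'rV[R]_2) (s t : R) (p q d e : 'rV[R]_2).

Let w_cont : continuous w. Proof. exact: wind_continuous. Qed.
Let wv p : enorm (w p) < v.
Proof. by case/andP: cv => _; apply: le_lt_trans. Qed.
Let v0 : 0 < v. Proof. by case/andP: cv; exact: le_lt_trans. Qed.

Section Paths.
Variables (xiC dx : R -> 'rV[R]_2) (KC Kd : R).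
Hypotheses (CK : lip_path xiC KC) (dK : lip_path dx Kd).

Lemma lip_path_combine s : lip_path (fun t => xiC t + s *: dx t) (KC + `|s| * Kd).
Proof.
move=> x y x01 y01; rewrite mulrDl opprD addrACA -scalerBr.
rewrite (le_trans (enormD _ _))// lerD ?CK// enormZ -mulrA ler_wpM2l//.
exact: dK.
Qed.

(** One null set serves all [s]: the union of those of the two paths. *)
Lemma derive1_combine : {ae mu, forall t, t \in `[0, 1] -> forall s,
  derive1 (fun t => xiC t + s *: dx t) t = derive1 xiC t + s *: derive1 dx t}.
Proof.
have [H [_ _ dH]] := lip_path_derivative CK.
have [H' [_ _ dH']] := lip_path_derivative dK.
apply: aeS (aeI dH dH') => t [h h'] t01 s; apply: is_derive_derive1.
rewrite (is_derive_derive1 (h t01)) (is_derive_derive1 (h' t01)).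
have := h t01; have := h' t01 => dx' xi'.
exact: is_deriveD.
Qed.

(* Negative s close to 0 show that the integral of [l] is nonpositive; then take
   s = 1. *)
Lemma second_order_bound (l Q : R -> R) :
  (forall s, -1 <= s <= 1 ->
    flight_duration v w xiC <= flight_duration v w (fun t => xiC t + s *: dx t)) ->
  abm l -> abm Q ->
  {ae mu, forall t, t \in `[0, 1] -> forall s, -1 <= s <= 1 ->
     flight_density v w (xiC t + s *: dx t) (derive1 xiC t + s *: derive1 dx t) <=
     flight_density v w (xiC t) (derive1 xiC t) + s * l t + s ^+ 2 * Q t} ->
  flight_duration v w (fun t => xiC t + 1 *: dx t) <=
    flight_duration v w xiC + \int[mu]_(t in `[0, 1]) Q t.
Proof.
move=> minC al aQ H; set T0 := flight_duration v w xiC.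
set IL := \int[mu]_(t in `[0, 1]) l t; set IQ := \int[mu]_(t in `[0, 1]) Q t.
have a0 := flight_duration_abm w_cont cv wc CK.
have asl s : abm (fun t => s * l t) by apply: abmM al; exact: abm_cst.
have asQ s : abm (fun t => s ^+ 2 * Q t) by apply: abmM aQ; exact: abm_cst.
have T_le s : -1 <= s <= 1 ->
    flight_duration v w (fun t => xiC t + s *: dx t) <= T0 + s * IL + s ^+ 2 * IQ.
  move=> s1; rewrite -(abm_intZ s al) -(abm_intZ (s ^+ 2) aQ).
  rewrite -(abm_intD a0 (asl s)) -(abm_intD (abmD a0 (asl s)) (asQ s)).
  apply: abm_int_le.
  - exact: (flight_duration_abm w_cont cv wc (lip_path_combine s)).
  - by apply: abmD (asQ s); exact: abmD.
  apply: aeS (aeI H derive1_combine) => t [h1 h2] t01.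
  by rewrite (h2 t01); exact: h1.
have IL0 : IL <= 0.
  apply/ler_addgt0Pr => e e0; rewrite add0r.
  (* Minimality at [- s] gives [IL <= s IQ], which this choice makes at most [e]. *)
  pose s := Num.min 1 (e / (`|IQ| + 1)).
  have IQ1 : 0 < `|IQ| + 1 by rewrite ltr_wpDl.
  have s0 : 0 < s by rewrite lt_min ltr01 divr_gt0.
  have s1 : s <= 1 by rewrite ge_min lexx.
  have se : s * (`|IQ| + 1) <= e by rewrite -ler_pdivlMr// ge_min lexx orbT.
  have sN : -1 <= - s <= 1 by apply/andP; split; lra.
  have := le_trans (minC _ sN) (T_le _ sN).
  rewrite -addrA lerDl sqrrN mulNr addrC subr_ge0 expr2 -mulrA ler_pM2l// => h.
  apply: (le_trans h); apply: le_trans se; rewrite ler_pM2l//.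
  by rewrite (le_trans (ler_norm _))// lerDl.
have s1 : -1 <= (1 : R) <= 1 by apply/andP; split; lra.
apply: (le_trans (T_le _ s1)); rewrite mul1r expr1n mul1r; lra.
Qed.

(** The constant speed keeps the denominator away from 0: it is at least [sqrt(v^2 - c^2) L]. *)
Lemma first_variation_abm (L : R) : 0 < L ->
  {ae mu, forall t, t \in `[0, 1] -> enorm (derive1 xiC t) = L} ->
  abm (fun t => fdW1 v (w (xiC t)) ('d w (xiC t) (dx t)) (derive1 xiC t)
                  (derive1 dx t)).
Proof.
move=> L0 HL.
have aw i : abm (fun t => w (xiC t) 0 i).
  by apply: (@abm_path _ (fun p => w p 0 i) _ KC _ CK); exact: continuous_coord.
have ad i : abm (fun t => dx t 0 i).
  by apply: (@abm_path _ (fun p => p 0 i) _ Kd _ dK); exact: coord_continuous.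
have adw i : abm (fun t => 'd w (xiC t) (dx t) 0 i).
  rewrite (_ : (fun t => _) = (fun t => dx t 0 0 * 'd w (xiC t) (e_ 0) 0 i
      + dx t 0 1 * 'd w (xiC t) (e_ 1) 0 i)).
    by apply: abmD; apply: abmM => //;
      apply: (@abm_path _ (fun p => 'd w p (e_ _) 0 i) _ KC _ CK);
      apply: (continuous_coord (Phi := fun p => 'd w p (e_ _))); exact: dwind_continuous.
  apply/funext => t.
  by rewrite (linear_decomp (dx t) (diff_linear w (xiC t))) !mxE.
have aq := abm_derive1 CK; have aqd := abm_derive1 dK.
have aF : abm (fun t => fdW v (w (xiC t)) (derive1 xiC t)).
  exact: (flight_duration_abm w_cont cv wc CK).
have ar : abm (fun t => rhoW v (w (xiC t)) (derive1 xiC t)).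
  rewrite /rhoW; apply: abmD; last exact: abm_dot.
  by apply: abmM => //; apply: abmD; [exact: abm_cst|apply: abmN; exact: abm_dot].
have k0 : 0 < Num.sqrt (v ^+ 2 - c ^+ 2) * L.
  rewrite mulr_gt0// sqrtr_gt0 subr_gt0 ltr_sqr ?nnegrE ?(ltW v0)//;
  by case/andP: cv.
rewrite /fdW1; apply: abmM.
  apply: abm_dot => i.
    rewrite (_ : (fun t => _) = (fun t => derive1 xiC t 0 i -
       fdW v (w (xiC t)) (derive1 xiC t) * w (xiC t) 0 i)).
      by apply: abmD => //; apply: abmN; exact: abmM.
    by apply/funext => t; rewrite !mxE.
  rewrite (_ : (fun t => _) = (fun t => derive1 dx t 0 i -
     fdW v (w (xiC t)) (derive1 xiC t) * 'd w (xiC t) (dx t) 0 i)).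
    by apply: abmD => //; apply: abmN; exact: abmM.
  by apply/funext => t; rewrite !mxE.
apply: (abmV k0 ar); apply: aeS HL => t + t01 => /(_ t01) qL.
apply: le_trans (rhoW_ge _ (wv _)); rewrite qL ler_wpM2r ?(ltW L0)//.
rewrite ler_wsqrtr// lerB// -enormX2 ler_sqr ?nnegrE ?enorm_ge0//.
by case/andP: cv.
Qed.

Lemma quad_bound_abm (L eps : R) :
  abm (fun t => quad_bound v L (c1 w (xiC t) + eps) (c2 w (xiC t) + eps)
    (enorm (dx t)) (enorm (derive1 dx t))).
Proof.
have aA1 : abm (fun t => c1 w (xiC t) + eps).
  by apply: abmD (abm_cst _); exact: abm_path (c1_continuous w_C2) CK.
have aA2 : abm (fun t => c2 w (xiC t) + eps).
  by apply: abmD (abm_cst _); exact: abm_path (c2_continuous w_C2) CK.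
have ax : abm (fun t => enorm (dx t)) by exact: abm_path (@continuous_enorm R) dK.
have ay := abm_enorm_derive1 dK.
rewrite /quad_bound; apply: abmD.
  apply: abmD; first by apply: abmM; [exact: abm_cst|exact: abmX2].
  apply: abmM ax; apply: abmM ay; apply: abmM (abm_cst _).
  by apply: abmM aA1; exact: abm_cst.
apply: abmM; last exact: abmX2.
apply: abmD; apply: abmM (abm_cst _); apply: abmM; try exact: abm_cst.
- exact: abmX2.
- exact: aA2.
Qed.

Lemma alpha_abm (L : R) :
  abm (fun t => alpha0 v w L (xiC t) * enorm (dx t) ^+ 2
    + alpha1 v w (xiC t) * enorm (dx t) * enorm (derive1 dx t)
    + alpha2 v w L (xiC t) * enorm (derive1 dx t) ^+ 2).
Proof.
have ax : abm (fun t => enorm (dx t)) by exact: abm_path (@continuous_enorm R) dK.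
have ay := abm_enorm_derive1 dK.
have a1 : abm (fun t => c1 w (xiC t)) by exact: abm_path (c1_continuous w_C2) CK.
have a2 : abm (fun t => c2 w (xiC t)) by exact: abm_path (c2_continuous w_C2) CK.
have vE p : v_low v w p = Num.sqrt (v ^+ 2 - dot (w p) (w p)).
  by rewrite /v_low /c0 enormX2.
have cV : continuous (v_low v w).
  move=> p; rewrite (_ : v_low v w = fun p => Num.sqrt (v ^+ 2 - dot (w p) (w p))).
    apply: (@continuous_cvg _ _ _ _ (nbhs_filter p) _ (@Num.sqrt R)).
      exact: sqrt_continuous.
    exact: (slack_continuous w_cont).
  by apply/funext => x; rewrite vE.
have aV : abm (fun t => v_low v w (xiC t)) by exact: abm_path cV CK.
have aiV : abm (fun t => (v_low v w (xiC t))^-1).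
  apply: (@abm_path _ (fun p => (v_low v w p)^-1) _ KC _ CK) => p.
  apply: (cvgV (FF := nbhs_filter p)); last exact: cV.
  by rewrite vE gt_eqF// sqrtr_gt0 slack_gt0.
apply: abmD; first apply: abmD.
- apply: abmM (abmX2 ax); rewrite /alpha0; apply: abmM.
    rewrite (_ : (fun t => _) = (fun t => L * ((v_low v w (xiC t))^-1 ^+ 2 *
       (v_low v w (xiC t))^-1))).
      by apply: abmM; [exact: abm_cst|exact: (abmM (abmX2 aiV) aiV)].
    by apply/funext => t; rewrite -exprVn exprSr.
  apply: abmD; first by apply: abmM; [exact: abm_cst|exact: abmX2].
  by apply: abmM => //; apply: abmM => //; exact: abm_cst.
- apply: abmM ay; apply: abmM ax; rewrite /alpha1.
  rewrite (_ : (fun t => _) = (fun t => 8 * c1 w (xiC t) * (v_low v w (xiC t))^-1 ^+ 2)).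
    by apply: abmM; [apply: abmM => //; exact: abm_cst|exact: (abmX2 aiV)].
  by apply/funext => t; rewrite exprVn.
- apply: abmM (abmX2 ay); rewrite /alpha2.
  rewrite (_ : (fun t => _) = (fun t => 2 * (L^-1 * (v_low v w (xiC t))^-1))).
    by apply: abmM; [exact: abm_cst|apply: abmM => //; exact: abm_cst].
  by apply/funext => t; rewrite invfM.
Qed.

End Paths.
End Stationarity.

Theorem theorem2 (R : realType) (xO xD : 'rV[R]_2) (v a : R)
    (w : 'rV[R]_2 -> 'rV[R]_2)
    (xOD : xO <> xD) (v_gt0 : 0 < v)
    (w_C2 : twice_cont_diff w) (w_lt : (Linfty_plane w < v%:E)%E)
    (a_gt : enorm (xO - xD) < 2 * a)
    (Omega_min : forall xi : R -> 'rV[R]_2,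
       minimizer (flight_duration v w) (trajectory xO xD) xi ->
       forall t : R, t \in `[0, 1] -> filled_ellipse xO xD a (xi t))
    (w_small : forall p : 'rV[R]_2,
       filled_ellipse xO xD a p -> enorm (w p) <= v / Num.sqrt 5)
    (xiC : R -> 'rV[R]_2)
    (xiC_min : minimizer (flight_duration v w)
                 (Xhat xO xD (filled_ellipse xO xD a)) xiC)
    (L : R) (L_gt0 : 0 < L) (xiC_speed : constant_speed xiC L) :
  exists2 r : R, 0 < r &
    forall xi : R -> 'rV[R]_2,
      let dxi := xi - xiC in
      Xhat xO xD (filled_ellipse xO xD a) xi ->
      (C01_norm dxi <= r%:E)%E ->
      flight_duration v w xi <=
        flight_duration v w xiC +
        \int[@lebesgue_measure R]_(t in `[0, 1])
          (alpha0 v w L (xiC t) * enorm (dxi t) ^+ 2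
           + alpha1 v w (xiC t) * enorm (dxi t) * enorm (derive1 dxi t)
           + alpha2 v w L (xiC t) * enorm (derive1 dxi t) ^+ 2).
Proof.
have [c cv wc] := wind_lt (wind_continuous w_C2) v_gt0 w_lt.
pose eps := Num.min v (Num.min (4 * v / (65 * L)) (2 * v / (125 * L ^+ 2))).
have eps0 : 0 < eps by rewrite !lt_min v_gt0 !divr_gt0 ?mulr_gt0 ?exprn_gt0.
have epsv : 0 <= eps <= v by rewrite (ltW eps0) ge_min lexx.
have eps65 : 65 * L * eps <= 4 * v.
  by rewrite mulrC -ler_pdivlMr ?mulr_gt0// !ge_min lexx !orbT.
have eps125 : 125 * L ^+ 2 * eps <= 2 * v.
  by rewrite mulrC -ler_pdivlMr ?mulr_gt0 ?exprn_gt0// !ge_min lexx !orbT.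
(* [2 a + |xO|] is the radius of a ball around 0 that contains the ellipse. *)
have [r r0 taylor] := fd_taylor_uniform w_C2 cv (2 * a + enorm xO) L_gt0 eps0.
exists r => // xi dxi [[xi_lip xi_Om xi0 xi1] _] /C01_norm_ae dxi_r.
have [[[xiC_lip xiC_Om xiC0 xiC1] _] _] := xiC_min.
have [KC _ CK] := lipschitz_lip_path xiC_lip.
have [Kx _ xK] := lipschitz_lip_path xi_lip.
have dE t : dxi t = xi t - xiC t by [].
have dK : lip_path dxi (Kx + KC).
  move=> s t s01 t01; have -> : dxi t - dxi s = (xi t - xi s) - (xiC t - xiC s).
    by rewrite !dE; apply: rV2P; rewrite !mxE; ring.
  by rewrite (le_trans (enormB _ _))// mulrDl lerD ?xK ?CK.
have d0 : dxi 0 = 0 by rewrite dE xi0 xiC0 subrr.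
have d1 : dxi 1 = 0 by rewrite dE xi1 xiC1 subrr.
have speed : {ae lebesgue_measure, forall t : R, t \in `[0, 1] ->
    enorm (derive1 xiC t) = L}.
  by apply: aeS xiC_speed => t + t01 => /(_ t01) [].
pose x t := enorm (dxi t); pose y t := enorm (derive1 dxi t).
pose Q (t : R) := quad_bound v L (c1 w (xiC t) + eps) (c2 w (xiC t) + eps) (x t) (y t).
have minC s : -1 <= s <= 1 -> flight_duration v w xiC <=
    flight_duration v w (fun t => xiC t + s *: dxi t).
  move=> _; apply: (Xhat_minimizer_global w_C2 cv wc xOD Omega_min xiC_min
    (lip_path_combine CK dK s)).
    by rewrite d0 scaler0 addr0.
  by rewrite d1 scaler0 addr0.
have aQ := quad_bound_abm v w_C2 CK dK L eps.
have al := first_variation_abm w_C2 cv wc CK dK L_gt0 speed.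
have TQ := second_order_bound w_C2 cv wc CK dK minC al aQ.
have xiE : xi = (fun t => xiC t + 1 *: dxi t).
  by apply/funext => t; rewrite scale1r dE addrC subrK.
rewrite [in leLHS]xiE; apply: (le_trans (TQ _)).
  apply: aeS (aeI dxi_r speed) => t [dr qL] t01 s s1.
  have [xr yr] := dr t01; have s1' : `|s| <= 1 by rewrite ler_norml.
  have pOm := xiC_Om t t01.
  have pB : enorm (xiC t) <= 2 * a + enorm xO.
    rewrite -[xiC t](subrK xO) (le_trans (enormD _ _))// lerD2r.
    by apply: le_trans pOm; rewrite lerDl enorm_ge0.
  have sx : enorm (s *: dxi t) <= r.
    by rewrite enormZ (le_trans _ xr)// ler_piMl ?enorm_ge0.
  have sy : enorm (s *: derive1 dxi t) <= r.
    by rewrite enormZ (le_trans _ yr)// ler_piMl ?enorm_ge0.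
  have := taylor _ _ _ _ pB (w_small _ pOm) (qL t01) sx sy.
  rewrite !enormZ quad_boundZ real_normK ?num_real//.
  by rewrite (linear_scale _ _ (diff_linear w (xiC t))) fdW1Z.
rewrite lerD2l.
have ax : ae_bounded_measurable x by exact: abm_path (@continuous_enorm R) dK.
have ay : ae_bounded_measurable y by exact: abm_enorm_derive1 dK.
have aA := alpha_abm w_C2 cv wc CK dK L.
(* The error left by [quad_bound_le]. Its integral is nonpositive by [poincare01], so it may be
   added to the right side, after which the integrands compare pointwise. *)
pose E t := (L * v)^-1 * (x t ^+ 2 - y t ^+ 2).
have aE2 : ae_bounded_measurable (fun t => x t ^+ 2 - y t ^+ 2).
  by apply: abmD; [exact: abmX2|apply: abmN; exact: abmX2].
have aE : ae_bounded_measurable E by apply: abmM aE2; exact: abm_cst.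
have E0 : \int[lebesgue_measure]_(t in `[0, 1]) E t <= 0.
  rewrite /E (abm_intZ _ aE2) (abm_intB (abmX2 ax) (abmX2 ay)).
  rewrite mulr_ge0_le0 ?invr_ge0 ?mulr_ge0 ?(ltW L_gt0) ?(ltW v_gt0)// subr_le0.
  set M := (leRHS); rewrite -[leRHS](abm_int_cst M).
  apply: abm_int_le; [exact: abmX2|exact: abm_cst|].
  apply: (@aeS _ xpredT) => [t _ t01|]; last exact: aeW.
  by apply: (poincare01 dK d0); rewrite in_itv in t01.
rewrite -[leRHS]addr0; apply: le_trans (lerD (lexx _) E0).
rewrite -(abm_intD aA aE); apply: abm_int_le => //; first exact: abmD.
apply: (@aeS _ xpredT) => [t _ t01|]; last exact: aeW.
have pOm := xiC_Om t t01.
have V0 : 0 < v_low v w (xiC t) <= v.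
  have wp : enorm (w (xiC t)) < v.
    by apply: (le_lt_trans (wc _)); case/andP: cv.
  rewrite /v_low sqrtr_gt0 subr_gt0 ltr_sqr ?nnegrE ?enorm_ge0 ?(ltW v_gt0)// wp/=.
  rewrite -[leRHS](ger0_norm (ltW v_gt0)) -sqrtr_sqr ler_wsqrtr// gerBl.
  exact: sqr_ge0.
rewrite /E [X in _ <= _ + X]mulrC.
exact: (quad_bound_le cv L_gt0 V0 (c1_ge0 w _) (c2_ge0 w_C2 _) epsv eps65 eps125
  (enorm_ge0 (dxi t)) (enorm_ge0 (derive1 dxi t))).
Qed.
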